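(* The pro-Picard--Vessiot group of the inverse system of difference systems over $\mathbf k(s)$ $$\sigma(Y)=\rho_N\big(x_N(\tfrac1{s+1})\big)Y,\qquad x_N(t)=\exp\Big(\sum_{m=1}^Ne_mt^m\Big),\qquad N\ge1,$$ is $$\varprojlim_N\mathcal G_N=\exp\widehat{\mathfrak f}(e_1,e_2,\ldots).$$
   Context: $\mathbf k$ is an algebraically closed field of characteristic zero; the base difference field is $\mathbf k(s)$ with $\sigma(s)=s+1$. $\mathfrak f=\mathfrak f(e_1,e_2,\ldots)$ is the free Lie algebra over $\mathbf k$ on generators $e_m$ of weight $m$, and $\widehat{\mathfrak f}$ is its completion with respect to weight; $\mathfrak f_{\le N}=\mathfrak f/\bigoplus_{q>N}\mathfrak f_q$ is a finite-dimensional nilpotent Lie algebra and $\mathcal G_N=\exp(\mathfrak f_{\le N})$ the corresponding unipotent algebraic group. $\rho_N\colon\mathcal G_N\to\operatorname{GL}(V_N)$ is a chosen faithful finite-dimensional representation. The Picard--Vessiot ring $R_N$ of the $N$-th system is realized in the ring $\operatorname{Seq}(\mathbf k)$ of sequences in $\mathbf k$ modulo finitely many places (with the shift as $\sigma$, $\mathbf k(s)$ embedded by evaluation at large integers): it is generated over $\mathbf k(s)$ by the matrix entries of $\rho_N(\Phi_N(M))$, where $\Phi_N(M)=x_N(1/M)x_N(1/(M-1))\cdots x_N(1)$, $\Phi_N(0)=1$. A Picard--Vessiot ring is a difference ring extension of $\mathbf k(s)$ without nontrivial $\sigma$-ideals generated by the entries of a fundamental matrix and the inverse of its determinant; the difference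 Galois group is the algebraic group of its $\sigma$-automorphisms over $\mathbf k(s)$, acting by right multiplication on the fundamental matrix. The pro-Picard--Vessiot group of the inverse system is the inverse limit over $N$ of the difference Galois groups of the compatible finite-weight systems, with transition maps given by restricting automorphisms (these systems are compatible under the natural projections $\mathcal G_{N+1}\to\mathcal G_N$). *)

(* Defs.v *)
From HB Require Import structures.
From mathcomp Require Import all_boot all_order all_algebra.
From mathcomp Require Import generic_quotient ring_quotient fraction.
From mathcomp Require Import boolp classical_sets functions.

Set Implicit Arguments.
Unset Strict Implicit.
Unset Printing Implicit Defensive.

Import GRing.Theory.
Local Open Scope ring_scope.
Local Open Scope quotient_scope.
Local Open Scope classical_set_scope.

HB.mixin Record isLieAlgebra (K : fieldType) L of GRing.Lmodule K L := {
  lie_bracket : L -> L -> L;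
  lie_linearl : forall (a : K) (x y z : L),
    lie_bracket (a *: x + y) z = a *: lie_bracket x z + lie_bracket y z;
  lie_linearr : forall (a : K) (x y z : L),
    lie_bracket z (a *: x + y) = a *: lie_bracket z x + lie_bracket z y;
  lie_alternating : forall x : L, lie_bracket x x = 0;
  lie_jacobi : forall x y z : L,
    lie_bracket x (lie_bracket y z) + lie_bracket y (lie_bracket z x) +
    lie_bracket z (lie_bracket x y) = 0
}.

#[short(type="lieAlgType")]
HB.structure Definition LieAlgebra (K : fieldType) :=
  {L of isLieAlgebra K L & GRing.Lmodule K L}.

Notation "[ 'lie' x , y ]" := (lie_bracket x y)
  (at level 0, format "[ 'lie'  x ,  y ]") : ring_scope.

Section LieTheory.
Variables (K : fieldType) (L : lieAlgType K).
Implicit Types x y z : L.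

Lemma lie0l x : [lie (0 : L), x] = 0.
Proof.
have := lie_linearl 1 0 0 x; rewrite scaler0 addr0 scale1r.
by rewrite -[LHS]addr0 => /addrI.
Qed.

Lemma lie0r x : [lie x, (0 : L)] = 0.
Proof.
have := lie_linearr 1 0 0 x; rewrite scaler0 addr0 scale1r.
by rewrite -[LHS]addr0 => /addrI.
Qed.

Lemma lieDl x y z : [lie x + y, z] = [lie x, z] + [lie y, z].
Proof. by have := lie_linearl 1 x y z; rewrite !scale1r. Qed.

Lemma lieDr x y z : [lie z, x + y] = [lie z, x] + [lie z, y].
Proof. by have := lie_linearr 1 x y z; rewrite !scale1r. Qed.

Lemma lieZl a x z : [lie a *: x, z] = a *: [lie x, z].
Proof. by have := lie_linearl a x 0 z; rewrite addr0 lie0l addr0. Qed.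

Lemma lieZr a x z : [lie z, a *: x] = a *: [lie z, x].
Proof. by have := lie_linearr a x 0 z; rewrite addr0 lie0r addr0. Qed.

Lemma lieNl x z : [lie - x, z] = - [lie x, z].
Proof. by rewrite -scaleN1r lieZl scaleN1r. Qed.

Lemma lieNr x z : [lie z, - x] = - [lie z, x].
Proof. by rewrite -scaleN1r lieZr scaleN1r. Qed.

Lemma lieC x y : [lie x, y] = - [lie y, x].
Proof.
apply/eqP; rewrite -addr_eq0; apply/eqP.
have := lie_alternating (x + y); rewrite lieDl !lieDr.
by rewrite !lie_alternating add0r addr0.
Qed.

(* Right-normed bracket [a1, [a2, [..., an]]]. *)
Fixpoint lie_word (s : seq L) : L :=
  match s with
  | [::] => 0
  | a :: s' => if s' is [::] then a else [lie a, lie_word s']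
  end.

(* Component of total degree l of the Baker-Campbell-Hausdorff series
   log (exp x exp y), in Dynkin's form
     1/l \sum_j (-1)^(j-1)/j \sum
       [x^(r_1) y^(s_1) ... x^(r_j) y^(s_j)] / \prod_i r_i! s_i!,
   the inner sum over the r_i, s_i >= 0 with r_i + s_i > 0 for all i and
   \sum_i (r_i + s_i) = l.  *)
Definition bch_comp (l : nat) x y : L :=
  l%:R^-1 *: \sum_(1 <= j < l.+1) ((-1) ^+ j.-1 / j%:R) *:
    \sum_(rs : {ffun 'I_j -> 'I_l.+1 * 'I_l.+1} |
          [forall i, (0 < (rs i).1 + (rs i).2)%N] &&
          (\sum_i ((rs i).1 + (rs i).2) == l)%N)
      (\prod_i (((rs i).1)`! * ((rs i).2)`!)%N%:R)^-1 *:
      lie_word (flatten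
        [seq nseq (rs i).1 x ++ nseq (rs i).2 y | i <- enum 'I_j]).

(* Partial sum of the series; it is the whole series when all brackets of more
   than [n] elements vanish. *)
Definition bch (n : nat) x y : L := \sum_(1 <= l < n.+1) bch_comp l x y.

End LieTheory.

Section LieMorphism.
Variables (K : fieldType) (L M : lieAlgType K) (f : L -> M).

Definition lie_morphism : Prop :=
  [/\ forall (a : K) x y, f (a *: x + y) = a *: f x + f y
    & forall x y, f [lie x, y] = [lie f x, f y] ].

Hypothesis fM : lie_morphism.

Lemma lie_morph0 : f 0 = 0.
Proof.
case: fM => lf _; have := lf 1 0 0.
by rewrite scaler0 addr0 scale1r -[LHS]addr0 => /addrI.
Qed.

Lemma lie_morphD x y : f (x + y) = f x + f y.
Proof. by case: fM => lf _; have := lf 1 x y; rewrite !scale1r. Qed.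

Lemma lie_morphZ a x : f (a *: x) = a *: f x.
Proof. by case: fM => lf _; have := lf a x 0; rewrite addr0 lie_morph0 addr0. Qed.

Lemma lie_morph_sum I (r : seq I) (P : pred I) (F : I -> L) :
  f (\sum_(i <- r | P i) F i) = \sum_(i <- r | P i) f (F i).
Proof. exact: (big_morph f lie_morphD lie_morph0). Qed.

Lemma lie_morph_word s : f (lie_word s) = lie_word (map f s).
Proof.
elim: s => [|a [|b s] IHs] //=; first exact: lie_morph0.
by case: fM => _ ->; congr [lie _, _]; exact: IHs.
Qed.

Lemma lie_morph_bch_comp l x y : f (bch_comp l x y) = bch_comp l (f x) (f y).
Proof.
rewrite /bch_comp lie_morphZ lie_morph_sum; congr (_ *: _).
apply: eq_bigr => j _; rewrite lie_morphZ lie_morph_sum; congr (_ *: _).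
apply: eq_bigr => rs _; rewrite lie_morphZ lie_morph_word; congr (_ *: _).
rewrite map_flatten -map_comp; congr (lie_word (flatten _)).
by apply: eq_map => i /=; rewrite map_cat !map_nseq.
Qed.

Lemma lie_morph_bch n x y : f (bch n x y) = bch n (f x) (f y).
Proof.
by rewrite /bch lie_morph_sum; apply: eq_bigr => l _; exact: lie_morph_bch_comp.
Qed.

End LieMorphism.

Section Span.
Variables (K : fieldType) (V : lmodType K).

Definition submodule (W : set V) : Prop :=
  W 0 /\ forall (a : K) x y, W x -> W y -> W (a *: x + y).

Definition span (S : set V) : set V := smallest submodule S.

Lemma span_submodule S : submodule (span S).
Proof.
split=> [W [[W0 _] _]|a x y Sx Sy W WP] //.
by case: (WP) => [[_ lW] _]; apply: lW; [exact: Sx|exact: Sy].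
Qed.

Lemma sub_span S : S `<=` span S.
Proof. by move=> x Sx W [_]; apply. Qed.

Lemma span_min (S W : set V) : submodule W -> S `<=` W -> span S `<=` W.
Proof. by move=> sW SW x; apply. Qed.

End Span.

Record lie_ideal (K : fieldType) (L : lieAlgType K) := LieIdeal {
  ideal_set :> L -> Prop;
  ideal_submodule : submodule ideal_set;
  ideal_bracket : forall x y, ideal_set y -> ideal_set [lie x, y] }.

Section LieQuotient.
Variables (K : fieldType) (L : lieAlgType K) (I : lie_ideal L).

Lemma ideal0 : I 0. Proof. by case: (ideal_submodule I). Qed.

Lemma idealD x y : I x -> I y -> I (x + y).
Proof.
by case: (ideal_submodule I) => _ lI Ix Iy; rewrite -[x]scale1r; exact: lI.
Qed.

Lemma idealZ a x : I x -> I (a *: x).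
Proof.
case: (ideal_submodule I) => I0 lI Ix.
by rewrite -[_ *: _]addr0; exact: lI.
Qed.

Lemma idealN x : I x -> I (- x).
Proof. by move=> Ix; rewrite -scaleN1r; exact: idealZ. Qed.

Lemma ideal_bracketl x y : I x -> I [lie x, y].
Proof. by move=> Ix; rewrite lieC; apply/idealN/ideal_bracket. Qed.

Definition lie_equiv (x y : L) : bool := `[< I (x - y) >].

Lemma lie_equiv_refl : reflexive lie_equiv.
Proof. by move=> x; apply/asboolP; rewrite subrr; exact: ideal0. Qed.

Lemma lie_equiv_sym : symmetric lie_equiv.
Proof.
by move=> x y; apply/asboolP/asboolP => /idealN; rewrite opprB.
Qed.

Lemma lie_equiv_trans : transitive lie_equiv.
Proof.
move=> y x z /asboolP xy /asboolP yz; apply/asboolP.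
by have := idealD xy yz; rewrite addrA subrK.
Qed.

Canonical lie_equiv_rel :=
  EquivRel lie_equiv lie_equiv_refl lie_equiv_sym lie_equiv_trans.

Definition lie_quot : Type := {eq_quot lie_equiv}.

HB.instance Definition _ : EqQuotient _ lie_equiv lie_quot :=
  EqQuotient.on lie_quot.
HB.instance Definition _ := Choice.on lie_quot.

Definition lie_pi (x : L) : lie_quot := \pi_lie_quot x.

Lemma lie_piP x y : lie_pi x = lie_pi y <-> I (x - y).
Proof.
split=> [/eqP|Ixy]; first by rewrite eqmodE => /asboolP.
by apply/eqP; rewrite eqmodE; apply/asboolP.
Qed.

Lemma lie_piK (u : lie_quot) : lie_pi (repr u) = u.
Proof. exact: reprK. Qed.

Lemma lie_repr x : I (repr (lie_pi x) - x).
Proof. by apply/lie_piP; rewrite lie_piK. Qed.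

Let qzero := lie_pi 0.
Let qopp (u : lie_quot) := lie_pi (- repr u).
Let qadd (u v : lie_quot) := lie_pi (repr u + repr v).
Let qscale (a : K) (u : lie_quot) := lie_pi (a *: repr u).
Let qbr (u v : lie_quot) := lie_pi [lie repr u, repr v].

Let qaddE x y : qadd (lie_pi x) (lie_pi y) = lie_pi (x + y).
Proof.
by apply/lie_piP; rewrite opprD addrACA; apply: idealD; exact: lie_repr.
Qed.

Let qoppE x : qopp (lie_pi x) = lie_pi (- x).
Proof. by apply/lie_piP; rewrite -opprD; apply/idealN/lie_repr. Qed.

Let qscaleE a x : qscale a (lie_pi x) = lie_pi (a *: x).
Proof. by apply/lie_piP; rewrite -scalerBr; apply/idealZ/lie_repr. Qed.

Let qbrE x y : qbr (lie_pi x) (lie_pi y) = lie_pi [lie x, y].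
Proof.
apply/lie_piP; set x' := repr _; set y' := repr _.
have -> : [lie x', y'] - [lie x, y] = [lie x' - x, y'] + [lie x, y' - y].
  by rewrite lieDl lieNl lieDr lieNr addrA subrK.
by apply: idealD; [apply: ideal_bracketl | apply: ideal_bracket];
   exact: lie_repr.
Qed.

Let ind (P : lie_quot -> Prop) : (forall x, P (lie_pi x)) -> forall u, P u.
Proof. by move=> Ppi u; rewrite -[u]lie_piK. Qed.

Let qaddA : associative qadd.
Proof.
elim/ind=> x; elim/ind=> y; elim/ind=> z.
by rewrite !qaddE addrA.
Qed.

Let qaddC : commutative qadd.
Proof. by elim/ind=> x; elim/ind=> y; rewrite !qaddE addrC. Qed.

Let qadd0 : left_id qzero qadd.
Proof. by elim/ind=> x; rewrite /qzero qaddE add0r. Qed.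

Let qaddN : left_inverse qzero qopp qadd.
Proof. by elim/ind=> x; rewrite qoppE qaddE addNr. Qed.

HB.instance Definition _ := GRing.isZmodule.Build lie_quot
  qaddA qaddC qadd0 qaddN.

Let addE x y : lie_pi x + lie_pi y = lie_pi (x + y). Proof. exact: qaddE. Qed.

Let qscaleA a b u : qscale a (qscale b u) = qscale (a * b) u.
Proof. by elim/ind: u => x; rewrite !qscaleE scalerA. Qed.

Let qscale1 : left_id 1 qscale.
Proof. by elim/ind=> x; rewrite qscaleE scale1r. Qed.

Let qscaleDr : right_distributive qscale +%R.
Proof.
move=> a; elim/ind=> x; elim/ind=> y.
by rewrite !(addE, qscaleE) scalerDr.
Qed.

Let qscaleDl u : {morph qscale^~ u : a b / a + b}.
Proof.
move=> a b; elim/ind: u => x.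
by rewrite !(qscaleE, addE) scalerDl.
Qed.

HB.instance Definition _ := GRing.Zmodule_isLmodule.Build K lie_quot
  qscaleA qscale1 qscaleDr qscaleDl.

Let scaleE a x : a *: lie_pi x = lie_pi (a *: x). Proof. exact: qscaleE. Qed.

Let qbr_linl a u v w : qbr (a *: u + v) w = a *: qbr u w + qbr v w.
Proof.
elim/ind: u => x; elim/ind: v => y; elim/ind: w => z.
by rewrite scaleE addE !qbrE scaleE addE lie_linearl.
Qed.

Let qbr_linr a u v w : qbr w (a *: u + v) = a *: qbr w u + qbr w v.
Proof.
elim/ind: u => x; elim/ind: v => y; elim/ind: w => z.
by rewrite scaleE addE !qbrE scaleE addE lie_linearr.
Qed.

Let qbr_alt u : qbr u u = 0.
Proof. by elim/ind: u => x; rewrite qbrE lie_alternating. Qed.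

Let qbr_jacobi u v w : qbr u (qbr v w) + qbr v (qbr w u) + qbr w (qbr u v) = 0.
Proof.
elim/ind: u => x; elim/ind: v => y; elim/ind: w => z.
by rewrite !qbrE !addE lie_jacobi.
Qed.

HB.instance Definition _ := isLieAlgebra.Build K lie_quot
  qbr_linl qbr_linr qbr_alt qbr_jacobi.

Lemma lie_pi_morphism : lie_morphism lie_pi.
Proof.
split=> [a x y|x y]; first by rewrite scaleE addE.
by apply/esym; exact: qbrE.
Qed.

End LieQuotient.

Section FreeLie.
Variable K : fieldType.

(* [TGen i] stands for the generator e_(i+1). *)
Inductive lie_term : Type :=
| TGen of nat
| TZero
| TAdd of lie_term & lie_term
| TOpp of lie_term
| TScale of K & lie_term
| TBr of lie_term & lie_term.

(* Equality of terms provable from the axioms of Lie algebras over [K]. *)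
Inductive term_eq : lie_term -> lie_term -> Prop :=
| TE_refl x : term_eq x x
| TE_sym x y : term_eq x y -> term_eq y x
| TE_trans x y z : term_eq x y -> term_eq y z -> term_eq x z
| TE_add x x' y y' :
    term_eq x x' -> term_eq y y' -> term_eq (TAdd x y) (TAdd x' y')
| TE_opp x x' : term_eq x x' -> term_eq (TOpp x) (TOpp x')
| TE_scale a x x' : term_eq x x' -> term_eq (TScale a x) (TScale a x')
| TE_br x x' y y' :
    term_eq x x' -> term_eq y y' -> term_eq (TBr x y) (TBr x' y')
| TE_addA x y z : term_eq (TAdd x (TAdd y z)) (TAdd (TAdd x y) z)
| TE_addC x y : term_eq (TAdd x y) (TAdd y x)
| TE_add0 x : term_eq (TAdd TZero x) x
| TE_addN x : term_eq (TAdd (TOpp x) x) TZero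
| TE_scaleA a b x : term_eq (TScale a (TScale b x)) (TScale (a * b) x)
| TE_scale1 x : term_eq (TScale 1 x) x
| TE_scaleDr a x y :
    term_eq (TScale a (TAdd x y)) (TAdd (TScale a x) (TScale a y))
| TE_scaleDl a b x :
    term_eq (TScale (a + b) x) (TAdd (TScale a x) (TScale b x))
| TE_brl a x y z :
    term_eq (TBr (TAdd (TScale a x) y) z) (TAdd (TScale a (TBr x z)) (TBr y z))
| TE_brr a x y z :
    term_eq (TBr z (TAdd (TScale a x) y)) (TAdd (TScale a (TBr z x)) (TBr z y))
| TE_alt x : term_eq (TBr x x) TZero
| TE_jacobi x y z :
    term_eq (TAdd (TAdd (TBr x (TBr y z)) (TBr y (TBr z x))) (TBr z (TBr x y)))
            TZero.

HB.instance Definition _ := gen_eqMixin lie_term.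
HB.instance Definition _ := gen_choiceMixin lie_term.

Definition term_equiv (x y : lie_term) : bool := `[< term_eq x y >].

Lemma term_equiv_refl : reflexive term_equiv.
Proof. by move=> x; apply/asboolP; exact: TE_refl. Qed.

Lemma term_equiv_sym : symmetric term_equiv.
Proof. by move=> x y; apply/asboolP/asboolP => /TE_sym. Qed.

Lemma term_equiv_trans : transitive term_equiv.
Proof.
move=> y x z /asboolP xy /asboolP yz.
by apply/asboolP; exact: TE_trans xy yz.
Qed.

Canonical term_equiv_rel :=
  EquivRel term_equiv term_equiv_refl term_equiv_sym term_equiv_trans.

Definition free_lie : Type := {eq_quot term_equiv}.

HB.instance Definition _ : EqQuotient _ term_equiv free_lie :=
  EqQuotient.on free_lie.
HB.instance Definition _ := Choice.on free_lie.

Let tpi (x : lie_term) : free_lie := \pi_free_lie x.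

Let tpiP x y : term_eq x y -> tpi x = tpi y.
Proof. by move=> xy; apply/eqP; rewrite eqmodE; apply/asboolP. Qed.

Let trepr x : term_eq (repr (tpi x)) x.
Proof.
have /eqP := reprK (tpi x); rewrite eqmodE => /asboolP; exact.
Qed.

Let tzero := tpi TZero.
Let topp (u : free_lie) := tpi (TOpp (repr u)).
Let tadd (u v : free_lie) := tpi (TAdd (repr u) (repr v)).
Let tscale (a : K) (u : free_lie) := tpi (TScale a (repr u)).
Let tbr (u v : free_lie) := tpi (TBr (repr u) (repr v)).

Let taddE x y : tadd (tpi x) (tpi y) = tpi (TAdd x y).
Proof. by apply: tpiP; apply: TE_add; exact: trepr. Qed.
Let toppE x : topp (tpi x) = tpi (TOpp x).
Proof. by apply: tpiP; apply: TE_opp; exact: trepr. Qed.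
Let tscaleE a x : tscale a (tpi x) = tpi (TScale a x).
Proof. by apply: tpiP; apply: TE_scale; exact: trepr. Qed.
Let tbrE x y : tbr (tpi x) (tpi y) = tpi (TBr x y).
Proof. by apply: tpiP; apply: TE_br; exact: trepr. Qed.

Let ind (P : free_lie -> Prop) : (forall x, P (tpi x)) -> forall u, P u.
Proof. by move=> Ppi u; rewrite -[u]reprK. Qed.

Let taddA : associative tadd.
Proof.
elim/ind=> x; elim/ind=> y; elim/ind=> z; rewrite !taddE.
exact/tpiP/TE_addA.
Qed.

Let taddC : commutative tadd.
Proof. elim/ind=> x; elim/ind=> y; rewrite !taddE; exact/tpiP/TE_addC. Qed.

Let tadd0 : left_id tzero tadd.
Proof. elim/ind=> x; rewrite taddE; exact/tpiP/TE_add0. Qed.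

Let taddN : left_inverse tzero topp tadd.
Proof. elim/ind=> x; rewrite toppE taddE; exact/tpiP/TE_addN. Qed.

HB.instance Definition _ := GRing.isZmodule.Build free_lie
  taddA taddC tadd0 taddN.

Let addE x y : tpi x + tpi y = tpi (TAdd x y). Proof. exact: taddE. Qed.

Let tscaleA a b u : tscale a (tscale b u) = tscale (a * b) u.
Proof. elim/ind: u => x; rewrite !tscaleE; exact/tpiP/TE_scaleA. Qed.

Let tscale1 : left_id 1 tscale.
Proof. elim/ind=> x; rewrite tscaleE; exact/tpiP/TE_scale1. Qed.

Let tscaleDr : right_distributive tscale +%R.
Proof.
move=> a; elim/ind=> x; elim/ind=> y.
rewrite !(addE, tscaleE); exact/tpiP/TE_scaleDr.
Qed.

Let tscaleDl u : {morph tscale^~ u : a b / a + b}.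
Proof.
move=> a b; elim/ind: u => x.
rewrite !(tscaleE, addE); exact/tpiP/TE_scaleDl.
Qed.

HB.instance Definition _ := GRing.Zmodule_isLmodule.Build K free_lie
  tscaleA tscale1 tscaleDr tscaleDl.

Let scaleE a x : a *: tpi x = tpi (TScale a x). Proof. exact: tscaleE. Qed.

Let tbr_linl a u v w : tbr (a *: u + v) w = a *: tbr u w + tbr v w.
Proof.
elim/ind: u => x; elim/ind: v => y; elim/ind: w => z.
rewrite scaleE addE !tbrE scaleE addE; exact/tpiP/TE_brl.
Qed.

Let tbr_linr a u v w : tbr w (a *: u + v) = a *: tbr w u + tbr w v.
Proof.
elim/ind: u => x; elim/ind: v => y; elim/ind: w => z.
rewrite scaleE addE !tbrE scaleE addE; exact/tpiP/TE_brr.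
Qed.

Let tbr_alt u : tbr u u = 0.
Proof. elim/ind: u => x; rewrite tbrE; exact/tpiP/TE_alt. Qed.

Let tbr_jacobi u v w : tbr u (tbr v w) + tbr v (tbr w u) + tbr w (tbr u v) = 0.
Proof.
elim/ind: u => x; elim/ind: v => y; elim/ind: w => z.
rewrite !tbrE !addE; exact/tpiP/TE_jacobi.
Qed.

HB.instance Definition _ := isLieAlgebra.Build K free_lie
  tbr_linl tbr_linr tbr_alt tbr_jacobi.

(* [free_gen i] is e_(i+1). *)
Definition free_gen (i : nat) : free_lie := tpi (TGen i).

Lemma free_lie_ind (P : free_lie -> Prop) :
    (forall i, P (free_gen i)) -> P 0 ->
    (forall (a : K) x y, P x -> P y -> P (a *: x + y)) ->
    (forall x y, P x -> P y -> P [lie x, y]) ->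
  forall x, P x.
Proof.
move=> Pgen P0 Plin Pbr; elim/ind; elim=> [i||x Px y Py|x Px|a x Px|x Px y Py].
- exact: Pgen.
- exact: P0.
- by rewrite -addE -[tpi x]scale1r; exact: Plin.
- have -> : tpi (TOpp x) = (-1) *: tpi x + 0.
    by rewrite addr0 scaleN1r -[RHS]/(topp (tpi x)) toppE.
  exact: Plin.
- by rewrite -scaleE -[_ *: _]addr0; exact: Plin.
- by rewrite -tbrE; exact: Pbr.
Qed.

Section Universal.
Variables (M : lieAlgType K) (h : nat -> M).

Fixpoint term_eval (t : lie_term) : M :=
  match t with
  | TGen i => h i
  | TZero => 0
  | TAdd x y => term_eval x + term_eval y
  | TOpp x => - term_eval x
  | TScale a x => a *: term_eval x
  | TBr x y => [lie term_eval x, term_eval y]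
  end.

Lemma term_evalP x y : term_eq x y -> term_eval x = term_eval y.
Proof.
elim=> //=; intros; try by congruence.
- exact: addrA.
- exact: addrC.
- exact: add0r.
- exact: addNr.
- exact: scalerA.
- exact: scale1r.
- exact: scalerDr.
- exact: scalerDl.
- exact: lie_linearl.
- exact: lie_linearr.
- exact: lie_alternating.
- exact: lie_jacobi.
Qed.

Theorem free_lie_universal :
  exists! f : free_lie -> M, lie_morphism f /\ forall i, f (free_gen i) = h i.
Proof.
pose f (u : free_lie) := term_eval (repr u).
have fE x : f (tpi x) = term_eval x by exact/term_evalP/trepr.
exists f; split; first split; [split|..].
- move=> a; elim/ind=> x; elim/ind=> y.
  by rewrite scaleE addE !fE.
- by elim/ind=> x; elim/ind=> y; rewrite -[lie_bracket _ _]/(tbr _ _) tbrE !fE.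
- by move=> i; rewrite fE.
- move=> g [[lg bg] geni]; apply/funext; elim/free_lie_ind.
  + by move=> i; rewrite geni fE.
  + have := lg 1 0 0; rewrite scaler0 addr0 scale1r.
    rewrite -[LHS]addr0 => /addrI <-.
    rewrite -[0]/(tpi TZero); exact: fE.
  + move=> a; elim/ind=> x; elim/ind=> y; rewrite lg => <- <-.
    by rewrite scaleE addE !fE.
  + elim/ind=> x; elim/ind=> y; rewrite bg => <- <-.
    by rewrite -[lie_bracket _ _ in LHS]/(tbr _ _) tbrE !fE.
Qed.

End Universal.

Inductive lie_monomial : nat -> free_lie -> Prop :=
| mon_gen i : lie_monomial i.+1 (free_gen i)
| mon_br p q x y : lie_monomial p x -> lie_monomial q y ->
    lie_monomial (p + q) [lie x, y].

Definition weight_part (q : nat) : set free_lie := span (lie_monomial q).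

Definition weight_gt (N : nat) : set free_lie :=
  span [set x | exists2 q, (N < q)%N & weight_part q x].

Lemma weight_gt_submodule N : submodule (weight_gt N).
Proof. exact: span_submodule. Qed.

Lemma weight_gt_mono N q x : (N < q)%N -> lie_monomial q x -> weight_gt N x.
Proof. by move=> Nq mx; apply: sub_span; exists q => //; exact: sub_span. Qed.

Lemma weight_gt_ind (N : nat) (W : set free_lie) : submodule W ->
  (forall q x, (N < q)%N -> lie_monomial q x -> W x) -> weight_gt N `<=` W.
Proof.
move=> sW Wmon; apply: span_min => // x [q Nq]; apply: span_min => // y.
exact: Wmon.
Qed.

Lemma monomial_gt0 q x : lie_monomial q x -> (0 < q)%N.
Proof. by elim=> // *; rewrite addn_gt0; apply/orP; left. Qed.

Lemma weight_gt_sub (N N' : nat) : (N <= N')%N ->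
  weight_gt N' `<=` weight_gt N.
Proof.
move=> le_NN'; apply: weight_gt_ind (@weight_gt_submodule N) _ => q x N'q.
by apply: weight_gt_mono; exact: leq_ltn_trans N'q.
Qed.

Lemma weight_gt_br (N N' : nat) x y :
  weight_gt N x -> weight_gt N' y -> weight_gt (N + N').+1 [lie x, y].
Proof.
have [z0 zlin] := @weight_gt_submodule (N + N').+1.
pose W : set free_lie := [set x | forall y, weight_gt N' y ->
  weight_gt (N + N').+1 [lie x, y] ].
suff WN : weight_gt N `<=` W by move=> /WN; apply.
apply: weight_gt_ind.
  split=> [y' _|a x1 x2 W1 W2 y' y'W]; first by rewrite lie0l.
  by rewrite lie_linearl; apply: zlin; [exact: W1|exact: W2].
move=> p x' Np mx'.
apply: weight_gt_ind.
  split=> [|a x1 x2 W1 W2]; first by rewrite lie0r.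
  by rewrite /= lie_linearr; exact: zlin.
move=> q y' N'q my'; apply: (@weight_gt_mono _ (p + q)); last exact: mon_br.
by rewrite -addnS -addSn leq_add.
Qed.

Lemma weight_gt0 x : weight_gt 0 x.
Proof.
have [z0 zlin] := @weight_gt_submodule 0.
elim/free_lie_ind: x => [i||a x y|x y Wx Wy].
- by apply: (@weight_gt_mono _ i.+1) => //; exact: mon_gen.
- exact: z0.
- exact: zlin.
- by apply: (@weight_gt_sub 0 1%N) => //; exact: (@weight_gt_br 0 0).
Qed.

Lemma weight_gt_bracket N x y : weight_gt N y -> weight_gt N [lie x, y].
Proof.
by move=> Wy; apply: (@weight_gt_sub N N.+1) => //;
   exact: weight_gt_br (weight_gt0 x) Wy.
Qed.

Definition weight_ideal (N : nat) : lie_ideal free_lie :=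
  LieIdeal (@weight_gt_submodule N) (@weight_gt_bracket N).

(* The quotient of the free Lie algebra by its part of weight > N. *)
Definition free_le (N : nat) : lieAlgType K := lie_quot (weight_ideal N).

Definition free_le_pi (N : nat) : free_lie -> free_le N :=
  @lie_pi K free_lie (weight_ideal N).

Definition free_le_proj (N : nat) (x : free_le N.+1) : free_le N :=
  free_le_pi N (repr (x : lie_quot (weight_ideal N.+1))).

Lemma free_le_projE N x : free_le_proj (free_le_pi N.+1 x) = free_le_pi N x.
Proof.
apply/lie_piP; apply: (weight_gt_sub (leqnSn N)).
exact: (@lie_repr _ _ (weight_ideal N.+1)).
Qed.

Lemma free_le_ind N (P : free_le N -> Prop) :
  (forall x, P (free_le_pi N x)) -> forall u, P u.
Proof. by move=> Ppi u; rewrite -[u]lie_piK; exact: Ppi. Qed.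

Lemma free_le_pi_morphism N : lie_morphism (free_le_pi N).
Proof. exact: lie_pi_morphism. Qed.

Lemma free_le_proj_morphism N : lie_morphism (@free_le_proj N).
Proof.
have [lN bN] := free_le_pi_morphism N.
have [lN1 bN1] := free_le_pi_morphism N.+1.
split=> [a| ]; elim/free_le_ind=> x; elim/free_le_ind=> y.
- by rewrite -lN1 !free_le_projE lN.
- by rewrite -bN1 !free_le_projE bN.
Qed.

Lemma free_le_word N (s : seq (free_le N)) :
  (N < size s)%N -> lie_word s = 0.
Proof.
have pi0 := lie_morph0 (free_le_pi_morphism N).
have [_ bpi] := free_le_pi_morphism N.
case: s => // a s; rewrite [size _]/= ltnS => Ns.
have [x Wx ->] :
    exists2 x, weight_gt (size s) x & lie_word (a :: s) = free_le_pi N x.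
  elim: s a {Ns} => [|b s IHs] a.
    elim/free_le_ind: a => x; exists x => //; exact: weight_gt0.
  have [y Wy yE] := IHs b; elim/free_le_ind: a => x.
  exists [lie x, y]; last by rewrite bpi -yE.
  exact: weight_gt_br (weight_gt0 x) Wy.
rewrite -pi0; apply/lie_piP; rewrite subr0.
exact: weight_gt_sub Wx.
Qed.

Lemma free_le_bch_comp N l (x y : free_le N) : (N < l)%N -> bch_comp l x y = 0.
Proof.
move=> Nl; rewrite /bch_comp big1 ?scaler0 // => j _.
rewrite big1 ?scaler0 // => rs /andP[_ /eqP sum_rs].
rewrite free_le_word ?scaler0 // size_flatten /shape -map_comp sumnE big_map.
suff -> : (\sum_(i <- enum 'I_j)
    (size \o (fun i => nseq (rs i).1 x ++ nseq (rs i).2 y)) i = l)%N by [].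
rewrite -[RHS]sum_rs big_enum /=; apply: eq_bigr => i _.
by rewrite size_cat !size_nseq.
Qed.

Lemma free_le_bchS N (x y : free_le N) : bch N.+1 x y = bch N x y.
Proof.
by rewrite /bch big_nat_recr //= free_le_bch_comp // addr0.
Qed.

End FreeLie.

Section Completion.
Variable K : fieldType.

Record free_hat := FreeHat {
  hat_fun :> forall N, free_le K N;
  hat_compat : forall N, free_le_proj (hat_fun N.+1) = hat_fun N }.

Lemma free_hatP (x y : free_hat) : (forall N, x N = y N) -> x = y.
Proof.
case: x y => [x cx] [y cy] /= xy.
have {}xy : x = y by exact: functional_extensionality_dep.
by case: y / xy cy => cy; congr FreeHat; exact: Prop_irrelevance.
Qed.

HB.instance Definition _ := gen_eqMixin free_hat.
HB.instance Definition _ := gen_choiceMixin free_hat.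

Let pM N := free_le_proj_morphism K N.

Let hzero_compat N : free_le_proj (0 : free_le K N.+1) = 0.
Proof. exact: lie_morph0 (pM N). Qed.
Let hopp_compat (x : free_hat) N : free_le_proj (- x N.+1) = - x N.
Proof. by rewrite -scaleN1r (lie_morphZ (pM N)) hat_compat scaleN1r. Qed.
Let hadd_compat (x y : free_hat) N :
  free_le_proj (x N.+1 + y N.+1) = x N + y N.
Proof. by rewrite (lie_morphD (pM N)) !hat_compat. Qed.
Let hscale_compat a (x : free_hat) N : free_le_proj (a *: x N.+1) = a *: x N.
Proof. by rewrite (lie_morphZ (pM N)) hat_compat. Qed.
Let hbr_compat (x y : free_hat) N :
  free_le_proj [lie x N.+1, y N.+1] = [lie x N, y N].
Proof. by have [_ ->] := pM N; rewrite !hat_compat. Qed.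

Let hzero := FreeHat hzero_compat.
Let hopp x := FreeHat (hopp_compat x).
Let hadd x y := FreeHat (hadd_compat x y).
Let hscale a x := FreeHat (hscale_compat a x).
Let hbr x y := FreeHat (hbr_compat x y).

Let haddA : associative hadd.
Proof. by move=> x y z; apply: free_hatP => N /=; exact: addrA. Qed.
Let haddC : commutative hadd.
Proof. by move=> x y; apply: free_hatP => N /=; exact: addrC. Qed.
Let hadd0 : left_id hzero hadd.
Proof. by move=> x; apply: free_hatP => N /=; exact: add0r. Qed.
Let haddN : left_inverse hzero hopp hadd.
Proof. by move=> x; apply: free_hatP => N /=; exact: addNr. Qed.

HB.instance Definition _ := GRing.isZmodule.Build free_hat
  haddA haddC hadd0 haddN.

Let hscaleA a b x : hscale a (hscale b x) = hscale (a * b) x.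
Proof. by apply: free_hatP => N /=; exact: scalerA. Qed.
Let hscale1 : left_id 1 hscale.
Proof. by move=> x; apply: free_hatP => N /=; exact: scale1r. Qed.
Let hscaleDr : right_distributive hscale +%R.
Proof. by move=> a x y; apply: free_hatP => N /=; exact: scalerDr. Qed.
Let hscaleDl x : {morph hscale^~ x : a b / a + b}.
Proof. by move=> a b; apply: free_hatP => N /=; exact: scalerDl. Qed.

HB.instance Definition _ := GRing.Zmodule_isLmodule.Build K free_hat
  hscaleA hscale1 hscaleDr hscaleDl.

Let hbr_linl a x y z : hbr (a *: x + y) z = a *: hbr x z + hbr y z.
Proof. by apply: free_hatP => N /=; exact: lie_linearl. Qed.
Let hbr_linr a x y z : hbr z (a *: x + y) = a *: hbr z x + hbr z y.
Proof. by apply: free_hatP => N /=; exact: lie_linearr. Qed.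
Let hbr_alt x : hbr x x = 0.
Proof. by apply: free_hatP => N /=; exact: lie_alternating. Qed.
Let hbr_jacobi x y z : hbr x (hbr y z) + hbr y (hbr z x) + hbr z (hbr x y) = 0.
Proof. by apply: free_hatP => N /=; exact: lie_jacobi. Qed.

HB.instance Definition _ := isLieAlgebra.Build K free_hat
  hbr_linl hbr_linr hbr_alt hbr_jacobi.

Lemma hat_fun_morphism N : lie_morphism (fun x : free_hat => x N).
Proof. by split. Qed.

(* Partial sums of the Baker-Campbell-Hausdorff series of [free_hat] are
   eventually constant modulo weight > N, from the N-th one on. *)
Lemma hat_bch_compat (x y : free_hat) N :
  free_le_proj (bch N.+1 x y N.+1) = bch N x y N.
Proof.
rewrite hat_compat (lie_morph_bch (hat_fun_morphism N)) free_le_bchS.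
by rewrite -(lie_morph_bch (hat_fun_morphism N)).
Qed.

Definition hat_bch (x y : free_hat) : free_hat := FreeHat (hat_bch_compat x y).

End Completion.

(* The group exp(L) has elements the symbols [Exp x]. *)
Record exp_type (L : Type) := Exp { Log : L }.

Section ExpGroups.
Variable K : fieldType.

(* Group of k-points of exp(free_le N), with its Baker-Campbell-Hausdorff
   product; by [free_le_bch_comp] the sum up to degree N is the whole series. *)
Definition GN (N : nat) := exp_type (free_le K N).

Definition GN_mul (N : nat) (g h : GN N) : GN N :=
  Exp (bch N (Log g) (Log h)).

Definition GN_one (N : nat) : GN N := Exp 0.

Definition GN_proj (N : nat) (g : GN N.+1) : GN N :=
  Exp (free_le_proj (Log g)).

Definition exp_hat := exp_type (free_hat K).

Definition exp_hat_mul (g h : exp_hat) : exp_hat :=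
  Exp (hat_bch (Log g) (Log h)).

(* Inverse limit of the GN over N >= 1; the index n stands for N = n + 1. *)
Record lim_GN := LimGN {
  lim_fun :> forall n, GN n.+1;
  lim_compat : forall n, GN_proj (lim_fun n.+1) = lim_fun n }.

Lemma lim_mul_compat (g h : lim_GN) n :
  GN_proj (GN_mul (g n.+1) (h n.+1)) = GN_mul (g n) (h n).
Proof.
rewrite /GN_proj /GN_mul /= (lie_morph_bch (free_le_proj_morphism K n.+1)).
by rewrite free_le_bchS -(lim_compat g n) -(lim_compat h n).
Qed.

Definition lim_mul (g h : lim_GN) : lim_GN := LimGN (lim_mul_compat g h).

Lemma exp_hat_trunc_compat (g : exp_hat) n :
  GN_proj (Exp (Log g n.+2)) = Exp (Log g n.+1).
Proof. by rewrite /GN_proj /= hat_compat. Qed.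

Definition exp_hat_trunc (g : exp_hat) : lim_GN :=
  LimGN (exp_hat_trunc_compat g).

(* x_N(t) = exp (e_1 t + ... + e_N t^N) *)
Definition xN (N : nat) (t : K) : GN N :=
  Exp (\sum_(m < N) t ^+ m.+1 *: free_le_pi N (free_gen K m)).

(* PhiN N M = x_N(1/M) x_N(1/(M-1)) ... x_N(1) *)
Fixpoint PhiN (N M : nat) : GN N :=
  if M is M'.+1 then GN_mul (xN N M%:R^-1) (PhiN N M') else GN_one N.

End ExpGroups.

Section Regular.
Variable K : fieldType.

Inductive polyfun (V : lmodType K) : (V -> K) -> Prop :=
| polyfun_cst c : polyfun (fun=> c)
| polyfun_lin (l : {linear V -> K^o}) : polyfun l
| polyfun_add f g : polyfun f -> polyfun g -> polyfun (fun v => f v + g v)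
| polyfun_mul f g : polyfun f -> polyfun g -> polyfun (fun v => f v * g v).

(* Algebraic representation of GN on K^d; the underlying variety of GN is the
   affine space [free_le K N]. *)
Definition algebraic_rep (N d : nat) (rho : GN K N -> 'M[K]_d) : Prop :=
  [/\ rho (GN_one K N) = 1%:M,
      forall g h, rho (GN_mul g h) = rho g *m rho h
    & forall i j, polyfun (fun x => rho (Exp x) i j) ].

Definition faithful_rep (N d : nat) (rho : GN K N -> 'M[K]_d) : Prop :=
  algebraic_rep rho /\ injective rho.

Definition regular_GL (d : nat) (f : 'M[K]_d -> K) : Prop :=
  exists p m, polyfun p /\ {in unitmx, forall C, f C = p C / \det C ^+ m}.

Definition closed_in_GL (d : nat) (H : set 'M[K]_d) : Prop :=
  exists2 F : set ('M[K]_d -> K), F `<=` @polyfun _ &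
    H = [set C | C \in unitmx /\ forall f, F f -> f C = 0].

(* [rho] is an isomorphism of varieties from GN onto a closed subset [H] of
   GL_d; regular functions on [H] are restrictions of those on GL_d. *)
Definition closed_embedding_onto (N d : nat) (rho : GN K N -> 'M[K]_d)
    (H : set 'M[K]_d) : Prop :=
  [/\ closed_in_GL H,
      forall i j, polyfun (fun x => rho (Exp x) i j),
      set_bij [set: GN K N] H rho
    & exists2 lg : 'M[K]_d -> free_le K N,
        forall l : {linear free_le K N -> K^o}, regular_GL (fun C => l (lg C))
        & forall g, lg (rho g) = Log g ].

End Regular.

Section SubringGen.
Variables (A : comNzRingType) (S : set A).

Definition is_subring (B : set A) : Prop :=
  [/\ B 1, forall x y, B x -> B y -> B (x - y)
    & forall x y, B x -> B y -> B (x * y) ].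

Definition subring_gen : set A := smallest is_subring S.

Lemma sub_subring_gen : S `<=` subring_gen.
Proof. by move=> x Sx B [_]; apply. Qed.

Definition in_subring_gen : {pred A} := fun x => `[< subring_gen x >].

Fact in_subring_gen_closed : subring_closed in_subring_gen.
Proof.
split=> [|x y /asboolP Sx /asboolP Sy|x y /asboolP Sx /asboolP Sy].
- by apply/asboolP => B [[]].
- apply/asboolP => B BP; case: (BP) => [[_ BB _] _].
  by apply: BB; [exact: Sx|exact: Sy].
- apply/asboolP => B BP; case: (BP) => [[_ _ BM] _].
  by apply: BM; [exact: Sx|exact: Sy].
Qed.

HB.instance Definition _ :=
  GRing.isSubringClosed.Build A in_subring_gen in_subring_gen_closed.

Definition gen_ring : Type := {x : A | in_subring_gen x}.

HB.instance Definition _ := SubChoice.on gen_ring.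
HB.instance Definition _ :=
  [SubChoice_isSubComNzRing of gen_ring by <:].

Definition gen_elt (x : A) (Sx : S x) : gen_ring :=
  exist _ x (introT (asboolP _) (sub_subring_gen Sx)).

End SubringGen.

Section Difference.

Definition difference_ring (R : comNzRingType) (sig : R -> R) : Prop :=
  [/\ zmod_morphism sig, monoid_morphism sig & bijective sig].

Variables (K : fieldType) (phi : K -> K).
Variables (R : comNzRingType) (sig : R -> R) (iota : K -> R).

Definition difference_extension : Prop :=
  [/\ difference_ring phi, difference_ring sig, zmod_morphism iota,
      monoid_morphism iota & forall a, sig (iota a) = iota (phi a)].

Definition sigma_ideal (J : set R) : Prop :=
  [/\ J 0, forall x y, J x -> J y -> J (x + y),
      forall a x, J x -> J (a * x) & forall x, J x -> J (sig x)].

Definition sigma_simple : Prop :=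
  forall J, sigma_ideal J -> J = [set 0] \/ J = setT.

(* [R] is a Picard-Vessiot ring of sigma(Y) = A Y, with fundamental matrix
   [Y]. *)
Definition picard_vessiot (d : nat) (A : 'M[K]_d) (Y : 'M[R]_d) : Prop :=
  [/\ difference_extension,
      sigma_simple,
      map_mx sig Y = map_mx iota A *m Y
    & exists2 delta, \det Y * delta = 1 &
        subring_gen (range iota `|` [set x | exists i j, x = Y i j] `|`
                     [set delta]) = setT ].

Definition sigma_aut (tau : R -> R) : Prop :=
  [/\ zmod_morphism tau, monoid_morphism tau, bijective tau,
      forall x, tau (sig x) = sig (tau x) & forall a, tau (iota a) = iota a].

End Difference.

Section Sequences.
Variable k : closedFieldType.

Definition ks := {fraction {poly k}}.
HB.instance Definition _ := GRing.Field.on ks.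

Definition ks_num (f : ks) : {poly k} := \n_(repr f).
Definition ks_den (f : ks) : {poly k} := \d_(repr f).

Definition ks_poly (p : {poly k}) : ks := tofrac p.
Definition ks_const (c : k) : ks := ks_poly c%:P.
Definition ks_s : ks := ks_poly 'X.

(* f(s) |-> f(s+1) *)
Definition ks_shift (f : ks) : ks :=
  ks_poly (ks_num f \Po ('X + 1)) / ks_poly (ks_den f \Po ('X + 1)).

Definition ev0 : {pred (nat -> k)} :=
  fun u => `[< exists n0, forall n, (n0 <= n)%N -> u n = 0 >].

Fact ev0_idealr : idealr_closed ev0.
Proof.
split=> [||a u v /asboolP[n0 u0] /asboolP[n1 v0]].
- by apply/asboolP; exists 0%N.
- by apply/asboolP => -[n0 /(_ n0 (leqnn _)) /eqP]; rewrite oner_eq0.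
- apply/asboolP; exists (maxn n0 n1) => n; rewrite geq_max => /andP[n0n n1n].
  have -> : (a * u + v) n = a n * u n + v n by [].
  by rewrite u0 // v0 // mulr0 addr0.
Qed.

HB.instance Definition _ := isIdealr.Build (nat -> k) ev0 ev0_idealr.

Definition Seq := {ideal_quot ev0}.
HB.instance Definition _ := GRing.ComNzRing.on Seq.

Definition germ (u : nat -> k) : Seq := \pi_Seq u.

Definition Seq_shift (x : Seq) : Seq := germ (fun M => repr x M.+1).

(* At the finitely many integral poles of f the convention x / 0 = 0 gives a
   junk value, which is irrelevant in Seq. *)
Definition Seq_of_ks (f : ks) : Seq :=
  germ (fun M => (ks_num f).[M%:R] / (ks_den f).[M%:R]).

End Sequences.

Section Systems.
Variables (k : closedFieldType) (N d : nat) (rho : GN k N -> 'M[k]_d).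

(* The polynomial, unique since k is infinite, representing a polynomial
   function. *)
Definition poly_of_fun (f : k -> k) : {poly k} :=
  xget 0 [set p | forall t, p.[t] = f t].

(* rho(x_N(1/(s+1))): t |-> rho(x_N(t)) is a morphism from the affine line to
   GL_d, that is a matrix of polynomials in t, which we evaluate at the
   k(s)-point t = 1/(s+1). *)
Definition system_mx : 'M[ks k]_d :=
  \matrix_(i, j)
    (map_poly (@ks_const k) (poly_of_fun (fun t => rho (xN N t) i j))).[
      (ks_s k + 1)^-1].

Definition sol_entry (i j : 'I_d) : Seq k :=
  germ (fun M => rho (PhiN k N M) i j).

Definition PV_generators : set (Seq k) :=
  range (@Seq_of_ks k) `|` [set x | exists i j, x = sol_entry i j].

(* R_N, the subring of Seq(k) generated over k(s) by the entries of
   rho(Phi_N). *)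
Definition PV_ring := gen_ring PV_generators.
HB.instance Definition _ := GRing.SubComNzRing.on PV_ring.

Lemma PV_base_subproof f : PV_generators (Seq_of_ks f).
Proof. by left; exists f. Qed.

Lemma PV_entry_subproof i j : PV_generators (sol_entry i j).
Proof. by right; exists i, j. Qed.

Definition PV_base (f : ks k) : PV_ring := gen_elt (PV_base_subproof f).

Definition PV_sol : 'M[PV_ring]_d :=
  \matrix_(i, j) gen_elt (PV_entry_subproof i j).

(* The shift of Seq(k) restricted to R_N; the default value [x] of [insubd] is
   not used, see [shift_stable]. *)
Definition PV_shift (x : PV_ring) : PV_ring := insubd x (Seq_shift (val x)).

Definition shift_stable : Prop :=
  forall x : PV_ring, val (PV_shift x) = Seq_shift (val x).

Definition PV_group : set (PV_ring -> PV_ring) := sigma_aut PV_shift PV_base.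

(* The difference Galois group as a group of matrices, acting on the
   fundamental matrix by right multiplication. *)
Definition PV_group_mx : set 'M[k]_d :=
  [set C | exists2 tau, PV_group tau &
    map_mx tau PV_sol = PV_sol *m map_mx (fun c => PV_base (ks_const c)) C].

End Systems.

Arguments PV_base {k N d} rho f.
Arguments PV_shift {k N d} rho x.
Arguments PV_group {k N d} rho _.
Arguments PV_group_mx {k N d} rho _.

(* [tau'], defined on R', restricts to [tau] on R; both are subrings of
   Seq(k). *)
Definition restricts_to (k : closedFieldType) (N N' d d' : nat)
    (rho : GN k N -> 'M[k]_d) (rho' : GN k N' -> 'M[k]_d')
    (tau' : PV_ring rho' -> PV_ring rho') (tau : PV_ring rho -> PV_ring rho) :
  Prop :=
  forall (x : PV_ring rho) (x' : PV_ring rho'),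
    val x = val x' -> val (tau x) = val (tau' x').

Section ProSystem.
Variables (k : closedFieldType) (d : nat -> nat).
Variable rho : forall n, GN k n.+1 -> 'M[k]_(d n).

Definition pro_fun : Type := forall n, PV_ring (@rho n) -> PV_ring (@rho n).

Definition pro_comp (tau tau' : pro_fun) : pro_fun :=
  fun n => tau n \o tau' n.

(* The inverse limit of the difference Galois groups. *)
Definition pro_PV_group : set pro_fun :=
  [set tau | (forall n, PV_group (@rho n) (tau n)) /\
             forall n, restricts_to (tau n.+1) (tau n)].

End ProSystem.

Arguments pro_PV_group {k d} rho _.
Arguments pro_comp {k d} rho tau tau1 _ _ : rename.

Definition group_iso_onto (T U : Type) (mulT : T -> T -> T) (mulU : U -> U -> U)
    (H : set U) (f : T -> U) : Prop :=
  set_bij [set: T] H f /\ {morph f : x y / mulT x y >-> mulU x y}.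

(* Main.v *)
Require Import Defs.
From HB Require Import structures.
From mathcomp Require Import all_boot all_order all_algebra.
From mathcomp Require Import generic_quotient ring_quotient fraction.
From mathcomp Require Import boolp classical_sets functions.
From mathcomp Require Import ring zify.

Set Implicit Arguments.
Unset Strict Implicit.
Unset Printing Implicit Defensive.

Import GRing.Theory.
Local Open Scope ring_scope.
Local Open Scope quotient_scope.
Local Open Scope classical_set_scope.

(** Write [V] for [free_le k N], [G] for the group [GN k N] of the symbols [Exp x]
with [x] in [V], and [Phi M] for [PhiN k N M].

The group and its coordinate ring.  As [rho] is injective and multiplicative,
the product of [G] inherits the group laws from matrices, without any identity
between Baker-Campbell-Hausdorff series.  Along a line, [t |-> rho (Exp (t x))] is a polynomial one-parameter group, hence
[rho (Exp x) = exp (L x)] with [L] linear and [L x] nilpotent of bounded order.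
The logarithm is polynomial on such matrices and [L] is injective, so [Log g]
is a polynomial in the entries of [rho g] ([rho_log]).  Hence [rho] is a closed
embedding, the polynomial functions on [G] are the polynomials in the entries
of [rho], they are stable under translations, and [R_N] is the set of finite
sums of terms [a(s) f(Phi)] with [a] in [k(s)] and [f] polynomial on [G].

The key step ([regular_stable]) is that a nonzero shift-stable [k(s)]-space of
such sums contains 1.  Expand [f (xN t g) = sum_i t^i f_i(g)], with [f_0 = f].
The dilations [e_m |-> a^m e_m] of [V] show that [f_i] has weight smaller by at
least [i] than [f] ([xN_coef_weight]), so that [f] lies in a finite-dimensional
space with a basis in which the maps [f |-> f_i], for [i > 0], are strictly
triangular ([adapted_basis]).  Since [Phi (M + 1) = xN (1 / (M + 1)) Phi M],
the shift acts on the values of this basis along [Phi] by the matrix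
[sum_i (s + 1)^-i U_i].  A triangular argument ([stable_space_const]) then
gives, in each nonzero stable space, a nonzero vector that has coefficients in
[k] and is killed by all the [U_i] with [i > 0]; it uses that a rational
function [b] with [b(s + 1) - b(s) = sum_i c_i / (s + 1)^i] must be constant
with all [c_i] zero ([shift_diff_poles]).  This vector is a polynomial function
[f] with [f (xN t g) = f g] for all [t]; as the [e_m] generate the Lie algebra,
[f] is constant ([invariant_const]).

Applied to the zero space, the key step says that a sum of terms [a(s) f(Phi)]
vanishes only if it vanishes identically on [G].  Therefore
[F(Phi) |-> F(Phi g)] is a well defined automorphism [Theta g] of [R_N] for
every [g] in [G].  Applied to difference ideals, it says that [R_N] is simple.

Conversely, an automorphism maps the fundamental matrix [Y = rho(Phi)] to [Y C],
where [C] is a matrix of germs fixed by the shift, that is of elements of [k].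
Automorphisms preserve the polynomial equations of [rho(G)], so that
[rho(Phi M) C] lies in [rho(G)] for large [M], and so does [C]: every
automorphism is some [Theta g] ([Theta_surj]).  Since [Theta] is compatible
with the projections [G_(N+1) -> G_N], the statements on inverse limits follow
formally. *)

(** * Fractions, integer points, and germs of sequences *)

Section Fractions.
Variable R : idomainType.

(** The operations of the field of fractions are defined on
representatives; this relates them to the numerator and the denominator of the
representative that [ks_num] and [ks_den] read. *)
Lemma fraction_numden (f : {fraction R}) :
  f = tofrac \n_(repr f) / tofrac \d_(repr f).
Proof.
have mulE (x : {ratio R}) :
    FracField.mul (\pi_(FracField.type R) x) (tofrac \d_x) = tofrac \n_x.
  rewrite !piE /FracField.mulf !numden_Ratio ?oner_eq0 //.
  apply/eqmodP; rewrite /= FracField.equivfE.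
  by rewrite mulr1 !numden_Ratio ?oner_eq0 ?denom_ratioP // mulr1 mulrC.
have := mulE (repr f); rewrite reprK => fE.
rewrite -fE -[FracField.mul _ _]/(f * tofrac \d_(repr f)).
by rewrite mulfK // tofrac_eq0 denom_ratioP.
Qed.

Lemma tofrac_div_eq (p q p' q' : R) : q != 0 -> q' != 0 ->
  (tofrac p / tofrac q == tofrac p' / tofrac q') = (p * q' == p' * q).
Proof.
by move=> q0 q'0; rewrite eqr_div ?tofrac_eq0 // -!rmorphM tofrac_eq.
Qed.
End Fractions.

Section NatPoints.
Variables (k : closedFieldType) (char_k : [pchar k] =i pred0).

Lemma natr_inj0 : injective (fun n : nat => n%:R : k).
Proof.
have nat0 n : (n%:R == 0 :> k) = (n == 0%N) by exact: (pcharf0P k).1.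
have le_inj m n : (m <= n)%N -> m%:R = n%:R :> k -> m = n.
  move=> mn /eqP; rewrite eq_sym -subr_eq0 -natrB // nat0 subn_eq0 => nm.
  by apply/eqP; rewrite eqn_leq mn.
move=> m n mn; case/orP: (leq_total m n) => le; first exact: le_inj.
by apply/esym/le_inj.
Qed.

Lemma natSr_neq0 n : n.+1%:R != 0 :> k.
Proof. by apply/eqP => /(natr_inj0 (x2 := 0%N)). Qed.

Lemma poly_nat_eq0 (p : {poly k}) n0 :
  (forall n, (n0 <= n)%N -> p.[n%:R] = 0) -> p = 0.
Proof.
move=> p0; apply: (@roots_geq_poly_eq0 _ p
  [seq (n0 + i)%:R | i <- iota 0 (size p)]).
- apply/allP => _ /mapP[i _ ->]; apply/eqP/p0; exact: leq_addr.
- rewrite map_inj_uniq ?iota_uniq // => i j /natr_inj0 /eqP.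
  by rewrite eqn_add2l => /eqP.
- by rewrite size_map size_iota.
Qed.

(** A polynomial has finitely many roots, and in characteristic 0 each
of them is the image of at most one integer. *)
Lemma poly_nat_neq0 (q : {poly k}) : q != 0 ->
  exists n0, forall n, (n0 <= n)%N -> q.[n%:R] != 0.
Proof.
move=> q0; have [rs qE] := closed_field_poly_normal q.
have [n0 n0P] : exists n0, forall n, (n0 <= n)%N -> n%:R \notin rs.
  elim: rs {qE} => [|a rs [n0 IH]]; first by exists 0%N.
  case: (pselect (exists m : nat, a = m%:R)) => [[m ->]|na].
    exists (maxn n0 m.+1) => n; rewrite geq_max => /andP[n0n mn].
    rewrite inE negb_or IH // andbT; apply/eqP => /natr_inj0 e.
    by rewrite e ltnn in mn.
  exists n0 => n n0n; rewrite inE negb_or IH // andbT; apply/eqP => e.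
  by apply: na; exists n.
exists n0 => n /n0P; apply: contra; rewrite qE hornerZ mulf_eq0.
by rewrite lead_coef_eq0 (negPf q0) /= -[_ == 0]/(root _ _) root_prod_XsubC.
Qed.

Lemma poly_eq_fun (p q : {poly k}) : (forall t, p.[t] = q.[t]) -> p = q.
Proof.
move=> pq; apply/eqP; rewrite -subr_eq0; apply/eqP.
by apply: (@poly_nat_eq0 _ 0%N) => n _; rewrite !hornerE pq subrr.
Qed.

Lemma poly_of_funP (f : k -> k) p : (forall t, p.[t] = f t) -> poly_of_fun f = p.
Proof.
move=> pf; rewrite /poly_of_fun; case: xgetP => [q _ /= qf|/(_ p)//].
by apply: poly_eq_fun => t; rewrite qf pf.
Qed.

Lemma poly_fun_at0 (p : {poly k}) : (forall t, t != 0 -> p.[t] = 0) -> p.[0] = 0.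
Proof.
move=> p0; suff -> : p = 0 by rewrite horner0.
by apply: (@poly_nat_eq0 _ 1%N) => -[//|n] _; apply/p0/natSr_neq0.
Qed.
End NatPoints.

Section Germs.
Variable k : closedFieldType.

Lemma germP (u v : nat -> k) :
  germ u = germ v <-> exists n0, forall n, (n0 <= n)%N -> u n = v n.
Proof.
have -> : germ u = germ v <-> u - v \in (@ev0 k).
  rewrite Quotient.idealrBE; split; last by move/eqP.
  by move=> e; apply/eqP.
split=> [/asboolP[n0 uv]|[n0 uv]].
  by exists n0 => n /uv /eqP; rewrite subr_eq0 => /eqP.
by apply/asboolP; exists n0 => n /uv e; rewrite -[LHS]/(u n - v n) e subrr.
Qed.

Lemma germ_ind (P : Seq k -> Prop) : (forall u, P (germ u)) -> forall x, P x.
Proof. by move=> Pg x; rewrite -[x]reprK; exact: Pg. Qed.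

Lemma germD (u v : nat -> k) : germ u + germ v = germ (fun n => u n + v n).
Proof. by rewrite /germ -pi_addr. Qed.

Lemma germN (u : nat -> k) : - germ u = germ (fun n => - u n).
Proof. by rewrite /germ -pi_oppr. Qed.

Lemma germB (u v : nat -> k) : germ u - germ v = germ (fun n => u n - v n).
Proof. by rewrite germN germD. Qed.

Lemma germM (u v : nat -> k) : germ u * germ v = germ (fun n => u n * v n).
Proof. by rewrite /germ -pi_mulr. Qed.

Lemma germ1 : germ (fun=> 1) = 1 :> Seq k.
Proof. by rewrite -pi_oner. Qed.

Lemma germ0 : germ (fun=> 0) = 0 :> Seq k.
Proof. by rewrite -pi_zeror. Qed.

Lemma germ_sum I (r : seq I) (P : pred I) (F : I -> nat -> k) :
  \sum_(i <- r | P i) germ (F i) = germ (fun n => \sum_(i <- r | P i) F i n).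
Proof.
elim: r => [|i r IH].
  by rewrite big_nil -germ0; apply/germP; exists 0%N => n _; rewrite big_nil.
rewrite big_cons IH; case: (boolP (P i)) => Pi; [rewrite germD|];
by apply/germP; exists 0%N => n _; rewrite big_cons ?Pi ?(negPf Pi).
Qed.

Lemma Seq_shift_germ (u : nat -> k) : Seq_shift (germ u) = germ (fun n => u n.+1).
Proof.
apply/germP; have /germP[n0 n0P] : germ (repr (germ u)) = germ u by exact: reprK.
by exists n0 => n nn0; apply: n0P; exact: leqW.
Qed.

Lemma Seq_shift_zmod : zmod_morphism (@Seq_shift k).
Proof.
by elim/germ_ind => u; elim/germ_ind => v; rewrite germB !Seq_shift_germ germB.
Qed.

Lemma Seq_shift_monoid : monoid_morphism (@Seq_shift k).
Proof.
split; first by rewrite -germ1 Seq_shift_germ.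
by elim/germ_ind => u; elim/germ_ind => v; rewrite germM !Seq_shift_germ germM.
Qed.

Definition Seq_unshift (x : Seq k) : Seq k := germ (fun n => repr x n.-1).

Lemma Seq_unshift_germ (u : nat -> k) :
  Seq_unshift (germ u) = germ (fun n => u n.-1).
Proof.
apply/germP; have /germP[n0 n0P] : germ (repr (germ u)) = germ u by exact: reprK.
by exists n0.+1 => -[//|n] nn0; apply: n0P.
Qed.

Lemma Seq_shiftK : cancel (@Seq_shift k) Seq_unshift.
Proof.
elim/germ_ind=> u; rewrite Seq_shift_germ Seq_unshift_germ.
by apply/germP; exists 1%N; case.
Qed.

Lemma Seq_unshiftK : cancel Seq_unshift (@Seq_shift k).
Proof.
by elim/germ_ind=> u; rewrite Seq_unshift_germ Seq_shift_germ.
Qed.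

(** The constants of [Seq k] are those of [k]. This is what makes an
automorphism act on the fundamental matrix by a matrix over [k]. *)
Lemma Seq_shift_fix (x : Seq k) : Seq_shift x = x -> exists c, x = germ (fun=> c).
Proof.
elim/germ_ind: x => u; rewrite Seq_shift_germ => /germP[n0 n0P].
exists (u n0); apply/germP; exists n0 => n /subnK <-.
elim: (n - n0)%N => // m <-; rewrite addSn; apply: n0P; exact: leq_addl.
Qed.
End Germs.

(** * Evaluation and shift of rational functions *)

Section RationalFunctions.
Variables (k : closedFieldType) (char_k : [pchar k] =i pred0).
Local Notation F := (@ks_poly k).

Lemma ks_fracE (f : ks k) : exists p q, q != 0 /\ f = F p / F q.
Proof.
exists (ks_num f), (ks_den f); split; first exact: denom_ratioP.
exact: fraction_numden.
Qed.

Lemma ks_num_den (p q : {poly k}) : q != 0 ->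
  ks_num (F p / F q) * q = p * ks_den (F p / F q).
Proof.
move=> q0; set f := _ / _; apply/eqP.
rewrite -tofrac_div_eq ?denom_ratioP //; apply/eqP; rewrite -fraction_numden.
by [].
Qed.

(** Evaluation is defined with the chosen representative; any other one
gives the same value wherever both denominators are nonzero. *)
Lemma Seq_of_ksE (p q : {poly k}) : q != 0 ->
  Seq_of_ks (F p / F q) = germ (fun M => p.[M%:R] / q.[M%:R]).
Proof.
move=> q0; have pq := ks_num_den p q0; set f := _ / _ in pq *.
have d0 : ks_den f != 0 by exact: denom_ratioP.
have [n0 n0P] := poly_nat_neq0 char_k (mulf_neq0 q0 d0).
apply/germP; exists n0 => n /n0P; rewrite hornerM mulf_eq0 negb_or.
move=> /andP[qn dn]; apply/eqP; rewrite eqr_div // -!hornerM pq.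
by rewrite mulrC.
Qed.

Lemma Seq_of_ks_poly p : Seq_of_ks (F p) = germ (fun M => p.[M%:R]).
Proof.
have -> : F p = F p / F 1 by rewrite /ks_poly rmorph1 divr1.
rewrite Seq_of_ksE ?oner_eq0 //; apply/germP; exists 0%N => n _.
by rewrite hornerC divr1.
Qed.

Lemma Seq_of_ks_const (c : k) : Seq_of_ks (ks_const c) = germ (fun=> c).
Proof.
by rewrite /ks_const Seq_of_ks_poly; apply/germP; exists 0%N => n _; rewrite hornerC.
Qed.

Lemma ks_fracB p q p' q' : q != 0 -> q' != 0 ->
  F p / F q - F p' / F q' = F (p * q' - p' * q) / F (q * q').
Proof.
by move=> q0 q'0; rewrite -mulNr addf_div ?tofrac_eq0 // mulNr -!rmorphM -rmorphB.
Qed.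

Lemma ks_fracM p q p' q' :
  (F p / F q) * (F p' / F q') = F (p * p') / F (q * q').
Proof. by rewrite mulf_div -!rmorphM. Qed.

Lemma Seq_of_ks_zmod : zmod_morphism (@Seq_of_ks k).
Proof.
move=> a b; have [p [q [q0 ->]]] := ks_fracE a; have [p' [q' [q'0 ->]]] := ks_fracE b.
rewrite ks_fracB // !Seq_of_ksE ?mulf_neq0 // germB.
have [n0 n0P] := poly_nat_neq0 char_k (mulf_neq0 q0 q'0).
apply/germP; exists n0 => n /n0P; rewrite hornerM mulf_eq0 negb_or.
move=> /andP[qn q'n]; rewrite hornerD hornerN !hornerM.
by rewrite -[in RHS]mulNr addf_div // mulNr.
Qed.

Lemma Seq_of_ks_monoid : monoid_morphism (@Seq_of_ks k).
Proof.
split.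
  have -> : 1 = ks_const 1 :> ks k by rewrite /ks_const /ks_poly !rmorph1.
  by rewrite Seq_of_ks_const germ1.
move=> a b; have [p [q [q0 ->]]] := ks_fracE a; have [p' [q' [q'0 ->]]] := ks_fracE b.
rewrite ks_fracM !Seq_of_ksE ?mulf_neq0 // germM.
by apply/germP; exists 0%N => n _; rewrite !hornerM mulf_div.
Qed.

Lemma ks_const_zmod : zmod_morphism (@ks_const k).
Proof. by move=> a b; rewrite /ks_const /ks_poly !rmorphB. Qed.

Lemma ks_const_monoid : monoid_morphism (@ks_const k).
Proof. by split=> [|a b]; rewrite /ks_const /ks_poly ?rmorph1 ?rmorphM. Qed.

Lemma comp_XaddC_eq0 (p : {poly k}) c : (p \Po ('X + c%:P) == 0) = (p == 0).
Proof. by rewrite comp_poly_eq0 // size_XaddC. Qed.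

Lemma ks_shiftE (p q : {poly k}) : q != 0 ->
  ks_shift (F p / F q) = F (p \Po ('X + 1)) / F (q \Po ('X + 1)).
Proof.
move=> q0; have pq := ks_num_den p q0; rewrite /ks_shift.
have d0 : ks_den (F p / F q) != 0 by exact: denom_ratioP.
apply/eqP; rewrite tofrac_div_eq ?comp_XaddC_eq0 //.
by rewrite -!comp_polyM pq.
Qed.

Lemma ks_shift_poly p : ks_shift (F p) = F (p \Po ('X + 1)).
Proof.
have -> : F p = F p / F 1 by rewrite /ks_poly rmorph1 divr1.
by rewrite ks_shiftE ?oner_eq0 // comp_polyC /ks_poly rmorph1 divr1.
Qed.

Lemma ks_shift_const (c : k) : ks_shift (ks_const c) = ks_const c.
Proof. by rewrite /ks_const ks_shift_poly comp_polyC. Qed.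

Lemma ks_shift_zmod : zmod_morphism (@ks_shift k).
Proof.
move=> a b; have [p [q [q0 ->]]] := ks_fracE a; have [p' [q' [q'0 ->]]] := ks_fracE b.
rewrite ks_fracB // !ks_shiftE ?mulf_neq0 // ks_fracB ?comp_XaddC_eq0 //.
by rewrite comp_polyB !comp_polyM.
Qed.

Lemma ks_shift_monoid : monoid_morphism (@ks_shift k).
Proof.
split.
  have -> : 1 = ks_const 1 :> ks k by rewrite /ks_const /ks_poly !rmorph1.
  exact: ks_shift_const.
move=> a b; have [p [q [q0 ->]]] := ks_fracE a; have [p' [q' [q'0 ->]]] := ks_fracE b.
by rewrite ks_fracM !ks_shiftE ?mulf_neq0 // ks_fracM !comp_polyM.
Qed.

Lemma ks_shift_bij : bijective (@ks_shift k).
Proof.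
have XK (p : {poly k}) : p \Po ('X + 1) \Po ('X - 1) = p.
  exact: (comp_polyXaddC_K p 1).
have XK' (p : {poly k}) : p \Po ('X - 1) \Po ('X + 1) = p.
  have := comp_polyXaddC_K p (-1); rewrite polyCN opprK; exact.
pose unshift (f : ks k) : ks k :=
  F (ks_num f \Po ('X - 1)) / F (ks_den f \Po ('X - 1)).
have cXB (p : {poly k}) : (p \Po ('X - 1) == 0) = (p == 0).
  by rewrite comp_poly_eq0 // size_XsubC.
exists unshift => a; have [p [q [q0 ->]]] := ks_fracE a.
  have q'0 : q \Po ('X + 1) != 0 by rewrite comp_XaddC_eq0.
  have pq := ks_num_den (p \Po ('X + 1)) q'0.
  rewrite ks_shiftE // /unshift; set b := _ / _ in pq *.
  have {}pq : (ks_num b \Po ('X - 1)) * q = p * (ks_den b \Po ('X - 1)).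
    rewrite -{1}[q]XK -comp_polyM pq.
    by rewrite comp_polyM XK.
  by apply/eqP; rewrite tofrac_div_eq ?cXB ?denom_ratioP // pq.
have pq := ks_num_den p q0; rewrite /unshift ks_shiftE ?cXB ?denom_ratioP //.
rewrite !XK'; apply/eqP; rewrite tofrac_div_eq ?denom_ratioP //.
by rewrite pq.
Qed.

Lemma Seq_of_ks_shift (a : ks k) : Seq_of_ks (ks_shift a) = Seq_shift (Seq_of_ks a).
Proof.
have [p [q [q0 ->]]] := ks_fracE a.
rewrite ks_shiftE // !Seq_of_ksE ?comp_XaddC_eq0 // Seq_shift_germ.
by apply/germP; exists 0%N => n _; rewrite !horner_comp !hornerE -natr1.
Qed.

End RationalFunctions.

HB.instance Definition _ (k : closedFieldType) :=
  GRing.isZmodMorphism.Build k (ks k) (@ks_const k) (@ks_const_zmod k).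
HB.instance Definition _ (k : closedFieldType) :=
  GRing.isMonoidMorphism.Build k (ks k) (@ks_const k) (@ks_const_monoid k).
HB.instance Definition _ (k : closedFieldType) :=
  GRing.isZmodMorphism.Build (ks k) (ks k) (@ks_shift k) (@ks_shift_zmod k).
HB.instance Definition _ (k : closedFieldType) :=
  GRing.isMonoidMorphism.Build (ks k) (ks k) (@ks_shift k) (@ks_shift_monoid k).
HB.instance Definition _ (k : closedFieldType) :=
  GRing.isZmodMorphism.Build (Seq k) (Seq k) (@Seq_shift k) (@Seq_shift_zmod k).
HB.instance Definition _ (k : closedFieldType) :=
  GRing.isMonoidMorphism.Build (Seq k) (Seq k) (@Seq_shift k) (@Seq_shift_monoid k).

(** * Differences of rational functions *)

Section Poles.
Variables (k : closedFieldType) (char_k : [pchar k] =i pred0).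
Local Notation F := (@ks_poly k).

Lemma ks_frac_coprime (f : ks k) :
  exists p q, [/\ q != 0, coprimep p q & f = F p / F q].
Proof.
have [p [q [q0 ->]]] := ks_fracE f.
have g0 : gcdp p q != 0 by rewrite gcdp_eq0 negb_and q0 orbT.
exists (p %/ gcdp p q)%R, (q %/ gcdp p q)%R; split.
- by rewrite dvdp_div_eq0 ?dvdp_gcdr.
- by apply: coprimep_div_gcd; rewrite q0 orbT.
- apply/eqP; rewrite tofrac_div_eq // ?dvdp_div_eq0 ?dvdp_gcdr //.
  have := divpK (dvdp_gcdl p q); have := divpK (dvdp_gcdr p q).
  set g := gcdp p q; set P := p %/ g; set Q := q %/ g => qE pE.
  by rewrite -[X in X * Q]pE -[X in _ == _ * X]qE mulrAC mulrA.
Qed.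

(** The hypothesis says that the difference of [p / q] and its
shift has no pole outside [-1]. If [a] is a root of [q], it is a pole of
[p / q], which the shift of [p / q] has to cancel unless [a = -1]; so [a + 1] is
a root of [q] too. Likewise [a - 1] is a root unless [a = 0]. As [q] has
finitely many roots, [a] would be both [-i-1] and [j] for naturals [i] and
[j]. *)
Lemma shift_denominator_const (p q C : {poly k}) n : q != 0 -> coprimep p q ->
  ((p \Po ('X + 1)) * q - p * (q \Po ('X + 1))) * ('X + 1) ^+ n =
    C * ((q \Po ('X + 1)) * q) ->
  size q = 1%N.
Proof.
move=> q0 cpq eqC.
have p_neq0 a : q.[a] = 0 -> p.[a] != 0.
  by move=> qa; apply: (coprimep_root (p := q)); [rewrite coprimep_sym|exact/eqP].
have X1E a : ('X + 1 : {poly k}).[a] = a + 1 by rewrite !hornerE.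
have up a : q.[a] = 0 -> q.[a + 1] = 0 \/ a + 1 = 0.
  move=> qa; have := congr1 (horner^~ a) eqC.
  rewrite !(X1E, horner_exp, hornerM, hornerD, hornerN, horner_comp) qa !mulr0 sub0r => /eqP.
  rewrite mulf_eq0 oppr_eq0 mulf_eq0 (negPf (p_neq0 _ qa)) expf_eq0 /=.
  by case/orP=> [/eqP|/andP[_ /eqP]]; [left|right].
have down a : q.[a] = 0 -> q.[a - 1] = 0 \/ a = 0.
  move=> qa; have := congr1 (horner^~ (a - 1)) eqC.
  rewrite !(X1E, horner_exp, hornerM, hornerD, hornerN, horner_comp) subrK qa mulr0 mul0r mulr0 subr0.
  move=> /eqP; rewrite !mulf_eq0 (negPf (p_neq0 _ qa)) expf_eq0 /=.
  by case/orP=> [/eqP|/andP[_ /eqP]]; [left|right].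
apply/eqP; apply: contraT => /closed_rootP[a /eqP qa].
have [[i ai]|noi] := pselect (exists i : nat, a + i%:R + 1 = 0); last first.
  have qi i : (q \Po ('X + a%:P)).[i%:R] = 0.
    rewrite horner_comp !hornerE addrC; elim: i => [|i IH]; first by rewrite addr0.
    rewrite -natr1 addrA; have [//|ai] := up _ IH.
    by case: noi; exists i.
  have /eqP := poly_nat_eq0 char_k (n0 := 0) (fun i _ => qi i).
  by rewrite comp_XaddC_eq0 (negPf q0).
have [[j aj]|noj] := pselect (exists j : nat, a - j%:R = 0); last first.
  have qi j : (q \Po (a%:P - 'X)).[j%:R] = 0.
    rewrite horner_comp !hornerE; elim: j => [|j IH]; first by rewrite subr0.
    rewrite -natr1 opprD addrA; have [//|aj] := down _ IH.
    by case: noj; exists j.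
  have /eqP := poly_nat_eq0 char_k (n0 := 0) (fun j _ => qi j).
  by rewrite comp_poly_eq0 ?(negPf q0) // -opprB size_polyN size_XsubC.
move: ai; rewrite (subr0_eq aj) -natrD natr1 => /eqP.
by rewrite (negPf (natSr_neq0 char_k _)).
Qed.

Lemma shift_poly_fixed (p : {poly k}) : p \Po ('X + 1) = p -> p = (p`_0)%:P.
Proof.
move=> pS; apply/eqP; rewrite -subr_eq0; apply/eqP.
apply: (@poly_nat_eq0 _ char_k _ 0%N) => n _.
rewrite hornerD hornerN hornerC -horner_coef0; apply/eqP; rewrite subr_eq0.
elim: n => // n /eqP <-; rewrite -[in X in _ == X]pS horner_comp !hornerE.
by rewrite natr1.
Qed.

(** Polar parts at [s = -1] are never differences of rational
functions. This is the only place where transcendence enters: for one [i] at a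
time it says that the harmonic sums [1 + 2^-i + ... + M^-i] are not rational in
[M]. *)
Lemma shift_diff_poles (b : ks k) n (c : nat -> k) :
  ks_shift b - b =
    \sum_(1 <= i < n) ks_const (c i) * (ks_s k + 1)^-1 ^+ i ->
  (forall i, (0 < i < n)%N -> c i = 0) /\ exists b0, b = ks_const b0.
Proof.
pose C0 : {poly k} := \sum_(1 <= i < n) c i *: 'X^(n - i).
pose C := C0 \Po ('X + 1).
have X1n0 m : ('X + 1 : {poly k}) ^+ m != 0.
  by rewrite expf_neq0 // -size_poly_gt0 size_XaddC.
have -> : \sum_(1 <= i < n) ks_const (c i) * (ks_s k + 1)^-1 ^+ i =
    F C / F (('X + 1) ^+ n).
  apply/esym/(canLR (mulfK _)); first by rewrite tofrac_eq0.
  rewrite mulr_suml /C /C0 raddf_sum /ks_poly rmorph_sum.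
  rewrite !big_nat; apply: eq_bigr => i /andP[i0 ni].
  have -> : ks_s k + 1 = F ('X + 1) by rewrite /ks_s /ks_poly rmorphD rmorph1.
  rewrite /= comp_polyZ comp_Xn_poly -mul_polyC rmorphM /ks_const -!mulrA; congr (_ * _).
  rewrite /ks_poly -{2}(subnK (ltnW ni)) exprD rmorphM mulrCA -[LHS]mulr1; congr (_ * _).
  rewrite rmorphXn -exprMn mulVf ?expr1n // tofrac_eq0.
  by have := X1n0 1%N; rewrite expr1.
have [p [q [q0 cpq ->]]] := ks_frac_coprime b.
rewrite ks_shiftE // ks_fracB ?comp_XaddC_eq0 // => /eqP.
rewrite tofrac_div_eq ?mulf_neq0 ?comp_XaddC_eq0 // => /eqP eqC.
have /eqP/size_poly1P[a a0 qE] := shift_denominator_const q0 cpq eqC.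
have aP0 : a%:P != 0 :> {poly k} by rewrite polyC_eq0.
have {}eqC : (p \Po ('X + 1) - p) * ('X + 1) ^+ n = C * a%:P.
  apply: (mulfI aP0); move: eqC; rewrite qE comp_polyC -mulrBl => eqC.
  by rewrite mulrA [_ * (_ - _)]mulrC eqC; ring.
have sC : (size C <= n)%N.
  rewrite size_comp_poly2 ?size_XaddC // /C0.
  apply: (leq_trans (size_sum _ _ _)); rewrite big_nat; elim/big_ind: _ => //.
    by move=> x y xn yn; rewrite geq_max xn.
  move=> i /andP[i0 ni]; apply: (leq_trans (size_scale_leq _ _)).
  by rewrite size_polyXn ltn_subrL i0 (leq_trans i0 (ltnW ni)).
have pS : p \Po ('X + 1) - p = 0.
  apply/eqP; apply: contraT => p0; have := congr1 (fun r : {poly k} => size r) eqC.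
  rewrite size_mul // mulrC size_Cmul //.
  have -> : size (('X + 1 : {poly k}) ^+ n) = n.+1.
    have -> : 'X + 1 = 'X - (-1)%:P :> {poly k} by rewrite polyCN opprK.
    exact: size_exp_XsubC.
  rewrite addnS /= => sE; move: sC; rewrite -sE -[leqRHS]add0n leq_add2r.
  by rewrite leqn0 size_poly_eq0 (negPf p0).
split; last first.
  have /shift_poly_fixed pE := subr0_eq pS.
  by exists (p`_0 / a); rewrite fmorph_div qE {1}pE.
move=> i /andP[i0 ni]; move: eqC; rewrite pS mul0r => /esym/eqP.
rewrite mulf_eq0 (negPf aP0) orbF /C comp_XaddC_eq0 => /eqP/(congr1 (fun r : {poly k} => r`_(n - i))).
rewrite coef0 /C0 coef_sum (bigD1_seq i) ?mem_index_iota ?i0 ?iota_uniq //=.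
rewrite coefZ coefXn eqxx mulr1 big1_seq ?addr0 // => j /andP[ji].
rewrite mem_index_iota => /andP[j0 jn]; rewrite coefZ coefXn.
by rewrite eqn_sub2lE ?(ltnW ni) ?(ltnW jn) // eq_sym (negPf ji) mulr0.
Qed.
End Poles.

(** * Shift-stable spaces of a triangular system *)

Section TriangularSystems.
Variables (k : closedFieldType) (char_k : [pchar k] =i pred0).
Variables (r n : nat) (U : nat -> 'M[k]_r).
Hypotheses (n0 : (0 < n)%N) (U0 : U 0%N = 1%:M).
Hypothesis Utri : forall i (j l : 'I_r), (0 < i)%N -> (l <= j)%N -> U i j l = 0.

Local Notation t := ((ks_s k + 1)^-1).

(** If a column [y] of sequences satisfies
[y(M + 1) = sum_i (M + 1)^-i U_i y(M)] and [a] is a row of rational functions,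
the shift of [a y] is [(shift of a) triangular_mx y]. *)
Definition triangular_mx : 'M[ks k]_r :=
  \sum_(i < n) t ^+ i *: map_mx (@ks_const k) (U i).

Lemma mul_triangular_mx (a : 'rV[ks k]_r) j :
  (a *m triangular_mx) 0 j =
  a 0 j + \sum_(1 <= i < n) t ^+ i * \sum_l a 0 l * ks_const (U i l j).
Proof.
rewrite /triangular_mx mulmx_sumr summxE -(big_mkord predT
  (fun i => (a *m (t ^+ i *: map_mx (@ks_const k) (U i))) 0 j)) big_ltn //.
congr (_ + _).
  by rewrite expr0 scale1r U0 map_mx1 mulmx1.
apply: eq_bigr => i _; rewrite -scalemxAr mxE; congr (_ * _).
by rewrite mxE; apply: eq_bigr => l _; rewrite mxE.
Qed.

(** By induction on the column: when the earlier entries of [a] are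
constants, the equation for the entry of index [j] reads
[a_j(s + 1) - a_j(s) = - sum_i (s + 1)^-i (c U_i)_j]. *)
Lemma fixed_vector_const (a : 'rV[ks k]_r) :
  map_mx (@ks_shift k) a *m triangular_mx = a ->
  exists c : 'rV[k]_r, a = map_mx (@ks_const k) c /\
    forall i, (0 < i < n)%N -> c *m U i = 0.
Proof.
move=> fix_a; pose c : 'rV[k]_r := \row_j xget 0 [set x | a 0 j = ks_const x].
suff cP j : a 0 j = ks_const (c 0 j) /\
    forall i, (0 < i < n)%N -> (c *m U i) 0 j = 0.
  exists c; split=> [|i ni]; apply/rowP => j; first by rewrite mxE; case: (cP j).
  by rewrite [RHS]mxE; case: (cP j) => _ ->.
have [m] := ubnP (nat_of_ord j); elim: m j => // m IH j jm.
have cl (l : 'I_r) : (l < j)%N -> a 0 l = ks_const (c 0 l).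
  by move=> lj; case: (IH l (leq_trans lj jm)).
have eqj : ks_shift (a 0 j) - a 0 j =
    \sum_(1 <= i < n) ks_const (- (c *m U i) 0 j) * t ^+ i.
  rewrite -{2}fix_a mul_triangular_mx mxE opprD addrA subrr add0r -sumrN.
  rewrite !big_nat; apply: eq_bigr => i /andP[i0 _].
  rewrite rmorphN mulNr mulrC; congr (- (_ * _)).
  rewrite [in RHS]mxE rmorph_sum; apply: eq_bigr => l _; rewrite rmorphM mxE.
  have [lj|jl] := ltnP l j; first by rewrite cl // ks_shift_const.
  by rewrite (Utri i0 jl) rmorph0 !mulr0.
have [c0 [b0 b0E]] := shift_diff_poles char_k eqj.
split=> [|i ni]; last by apply/eqP; rewrite -oppr_eq0 c0.
rewrite mxE; case: xgetP => [x _ //|/(_ b0) /=].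
by rewrite b0E.
Qed.

(** A vector of [J] whose first nonzero entry is 1 and stands as far
to the right as possible is fixed by the action: its image minus itself lies in
[J] and starts further to the right, so it is zero. *)
Lemma stable_space_const (J : set 'rV[ks k]_r) : submodule J ->
    (forall a, J a -> J (map_mx (@ks_shift k) a *m triangular_mx)) ->
    (exists2 a, J a & a != 0) ->
  exists c : 'rV[k]_r, [/\ c != 0, J (map_mx (@ks_const k) c)
    & forall i, (0 < i < n)%N -> c *m U i = 0].
Proof.
move=> [J0 Jlin] JS [a Ja a0].
have Z (b : 'rV[ks k]_r) x : J b -> J (x *: b).
  by move=> Jb; rewrite -[_ *: _]addr0; exact: Jlin.
suff H m b : J b -> b != 0 -> (forall j : 'I_r, (j + m < r)%N -> b 0 j = 0) ->
    exists c : 'rV[k]_r, [/\ c != 0, J (map_mx (@ks_const k) c)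
    & forall i, (0 < i < n)%N -> c *m U i = 0].
  by apply: (H r a) => // j; rewrite ltnNge leq_addl.
(* At most the last [m] entries of [a] are nonzero. *)
elim: m b {a Ja a0} => [|m IH] a Ja a0 lead_a.
  case/eqP: a0; apply/rowP => j; rewrite mxE; apply: lead_a.
  by rewrite addn0.
have [rm|mr] := leqP r m.
  by apply: (IH a) => // j; rewrite ltnNge (leq_trans rm (leq_addl _ _)).
have mr' : (r - m.+1 < r)%N by rewrite ltn_subrL (leq_trans _ mr).
pose j0 := Ordinal mr'; have [aj0|aj0] := eqVneq (a 0 j0) 0.
  apply: (IH a) => // j jm.
  have [->//|/eqP jE] := eqVneq j j0; apply: lead_a.
  have {}jE : nat_of_ord j <> (r - m.+1)%N by move=> e; apply/jE/val_inj.
  by lia.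
pose b := (a 0 j0)^-1 *: a; have Jb : J b by exact: Z.
have b_eq0 (j : 'I_r) : (j < r - m.+1)%N -> b 0 j = 0.
  by move=> jj0; rewrite mxE (lead_a j) ?mulr0 //; lia.
have bj0 : b 0 j0 = 1 by rewrite mxE mulVf.
pose e := (-1) *: b + map_mx (@ks_shift k) b *m triangular_mx.
have Je : J e by apply: Jlin => //; exact: JS.
have e_eq0 (j : 'I_r) : (j <= r - m.+1)%N -> e 0 j = 0.
  move=> jj0; rewrite mxE mul_triangular_mx big_nat big1 => [|i /andP[i0 _]].
    rewrite addr0 !mxE -[_ * a 0 j]/(_ * a 0 j) mulN1r.
    have -> : (a 0 j0)^-1 * a 0 j = b 0 j by rewrite mxE.
    move: jj0; rewrite leq_eqVlt => /orP[/eqP jE|/b_eq0->].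
      by rewrite (_ : j = j0) ?bj0 ?rmorph1 ?addNr //; exact: val_inj.
    by rewrite rmorph0 oppr0 addr0.
  rewrite big1 ?mulr0 // => l _; have [lj|jl] := ltnP l j.
    by rewrite mxE b_eq0 ?(leq_trans lj jj0) // rmorph0 mul0r.
  by rewrite (Utri i0 jl) rmorph0 mulr0.
have [e0|e0] := eqVneq e 0; last first.
  by apply: (IH e) => // j jm; apply: e_eq0; lia.
have [c [bE cU]] : exists c : 'rV[k]_r, b = map_mx (@ks_const k) c /\
    forall i, (0 < i < n)%N -> c *m U i = 0.
  apply: fixed_vector_const; apply/eqP; rewrite -subr_eq0; apply/eqP.
  by rewrite -e0 /e scaleN1r addrC.
exists c; split=> //; last by rewrite -bE.
apply: contra_neq a0 => c0; move/rowP/(_ j0): bE.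
by rewrite c0 bj0 !mxE rmorph0 => /eqP; rewrite oner_eq0.
Qed.
End TriangularSystems.

(** * Polynomial functions *)

Section PolynomialFunctions.
Variable k : closedFieldType.
Implicit Types V W : lmodType k.

Lemma polyfun_linear V (f : V -> k) :
  (forall a x y, f (a *: x + y) = a * f x + f y) -> polyfun f.
Proof.
move=> lin_f; pose M := GRing.isLinear.Build k V k^o _ f lin_f.
pose F : {linear V -> k^o} := HB.pack f M.
exact: (polyfun_lin F).
Qed.

Lemma polyfun_ext V (f g : V -> k) : (forall v, f v = g v) -> polyfun f -> polyfun g.
Proof. by move=> /funext->. Qed.

Lemma polyfunZ V a (f : V -> k) : polyfun f -> polyfun (fun v => a * f v).
Proof. by apply: polyfun_mul; exact: polyfun_cst. Qed.

Lemma polyfunB V (f g : V -> k) :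
  polyfun f -> polyfun g -> polyfun (fun v => f v - g v).
Proof.
move=> fP /(polyfunZ (-1)) gP; apply: polyfun_ext (polyfun_add fP gP) => v.
by rewrite mulN1r.
Qed.

Lemma polyfun_sum V I (r : seq I) (P : pred I) (F : I -> V -> k) :
  (forall i, P i -> polyfun (F i)) -> polyfun (fun v => \sum_(i <- r | P i) F i v).
Proof.
move=> FP; elim: r => [|i r IH].
  by apply: polyfun_ext (polyfun_cst _ 0) => v; rewrite big_nil.
have [Pi|nPi] := boolP (P i); last first.
  by apply: polyfun_ext IH => v; rewrite big_cons (negPf nPi).
by apply: polyfun_ext (polyfun_add (FP _ Pi) IH) => v; rewrite big_cons Pi.
Qed.

Lemma polyfun_comp V W (phi : V -> W) (f : W -> k) :
  (forall l : {linear W -> k^o}, polyfun (l \o phi)) -> polyfun f ->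
  polyfun (f \o phi).
Proof.
move=> phiP; elim=> [c|l|g h _ IHg _ IHh|g h _ IHg _ IHh].
- exact: polyfun_cst.
- exact: phiP.
- exact: polyfun_add IHg IHh.
- exact: polyfun_mul IHg IHh.
Qed.

Lemma polyfun_comp_linear V W (phi : V -> W) (f : W -> k) :
  (forall a x y, phi (a *: x + y) = a *: phi x + phi y) -> polyfun f ->
  polyfun (f \o phi).
Proof.
move=> lin; apply: polyfun_comp => l; apply: polyfun_linear => a x y /=.
by rewrite lin linearP.
Qed.

Lemma linear_entries d (l : {linear 'M[k]_d -> k^o}) (C : 'M[k]_d) :
  l C = \sum_i \sum_j C i j * l (delta_mx i j).
Proof.
rewrite {1}[C]matrix_sum_delta linear_sum; apply: eq_bigr => i _.
by rewrite linear_sum; apply: eq_bigr => j _; rewrite linearZ.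
Qed.

Lemma polyfun_comp_mx V d (phi : V -> 'M[k]_d) (f : 'M[k]_d -> k) :
  (forall i j, polyfun (fun v => phi v i j)) -> polyfun f -> polyfun (f \o phi).
Proof.
move=> phiP; apply: polyfun_comp => l.
apply: (@polyfun_ext _ (fun v => \sum_i \sum_j phi v i j * l (delta_mx i j))).
  by move=> v /=; rewrite [in RHS]linear_entries.
apply: polyfun_sum => i _; apply: polyfun_sum => j _.
by apply: polyfun_mul => //; exact: polyfun_cst.
Qed.

Lemma polyfun_entry d (i j : 'I_d) : polyfun (fun C : 'M[k]_d => C i j).
Proof. by apply: polyfun_linear => a x y; rewrite !mxE. Qed.

Lemma polyfun_mulmx V d (phi psi : V -> 'M[k]_d) :
    (forall i j, polyfun (fun v => phi v i j)) ->
    (forall i j, polyfun (fun v => psi v i j)) ->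
  forall i j, polyfun (fun v => (phi v *m psi v) i j).
Proof.
move=> phiP psiP i j.
apply: (@polyfun_ext _ (fun v => \sum_l phi v i l * psi v l j)).
  by move=> v; rewrite mxE.
by apply: polyfun_sum => l _; exact: polyfun_mul.
Qed.

Definition poly_curve V (c : k -> V) : Prop :=
  forall l : {linear V -> k^o}, exists p : {poly k}, forall t, p.[t] = l (c t).

Lemma polyfun_curve V (c : k -> V) (f : V -> k) : poly_curve c -> polyfun f ->
  exists p : {poly k}, forall t, p.[t] = f (c t).
Proof.
move=> cP; elim=> [a|l|g h _ [p pE] _ [q qE]|g h _ [p pE] _ [q qE]].
- by exists a%:P => t; rewrite hornerC.
- exact: cP.
- by exists (p + q) => t; rewrite hornerD pE qE.
- by exists (p * q) => t; rewrite hornerM pE qE.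
Qed.

Lemma poly_curve_sum V n (e : nat -> k -> k) (x : nat -> V) :
  (forall i, exists p : {poly k}, forall t, p.[t] = e i t) ->
  poly_curve (fun t => \sum_(i < n) e i t *: x i).
Proof.
move=> eP l; exists (\sum_(i < n) l (x i) *: projT1 (cid (eP i))) => t.
rewrite horner_sum linear_sum; apply: eq_bigr => i _.
by rewrite hornerZ linearZ /=; case: cid => p /= ->; rewrite mulrC.
Qed.

(** The degree in [t] is bounded uniformly in [v], so that the function
of [t] and [v] is a single polynomial in [t] over the polynomial functions. *)
Definition poly_family V (f : k -> V -> k) : Prop :=
  exists q : V -> {poly k}, [/\ forall i, polyfun (fun v => (q v)`_i),
    exists n, forall v, (size (q v) <= n)%N & forall t v, (q v).[t] = f t v].

Lemma poly_family_cst V (f : V -> k) : polyfun f -> poly_family (fun=> f).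
Proof.
move=> fP; exists (fun v => (f v)%:P); split=> [i||t v]; last by rewrite hornerC.
  case: i => [|i]; first by apply: polyfun_ext fP => v; rewrite coefC.
  by apply: polyfun_ext (polyfun_cst _ 0) => v; rewrite coefC.
by exists 1%N => v; exact: size_polyC_leq1.
Qed.

Lemma poly_family_poly V (p : {poly k}) : @poly_family V (fun t _ => p.[t]).
Proof.
exists (fun=> p); split=> // [i|]; first exact: polyfun_cst.
by exists (size p).
Qed.

Lemma poly_familyD V (f g : k -> V -> k) : poly_family f -> poly_family g ->
  poly_family (fun t v => f t v + g t v).
Proof.
move=> [p [pP [m pm] pE]] [q [qP [n qn] qE]].
exists (fun v => p v + q v); split=> [i||t v]; last by rewrite hornerD pE qE.
  by apply: polyfun_ext (polyfun_add (pP i) (qP i)) => v; rewrite coefD.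
exists (maxn m n) => v; apply: leq_trans (size_polyD _ _) _.
by rewrite geq_max !leq_max pm qn orbT.
Qed.

Lemma poly_familyM V (f g : k -> V -> k) : poly_family f -> poly_family g ->
  poly_family (fun t v => f t v * g t v).
Proof.
move=> [p [pP [m pm] pE]] [q [qP [n qn] qE]].
exists (fun v => p v * q v); split=> [i||t v]; last by rewrite hornerM pE qE.
  apply: (@polyfun_ext _ (fun v => \sum_(j < i.+1) (p v)`_j * (q v)`_(i - j))).
    by move=> v; rewrite coefM.
  by apply: polyfun_sum => j _; exact: polyfun_mul.
exists (m + n)%N => v; apply: leq_trans (size_polyMleq _ _) _.
by apply: leq_trans (leq_pred _) _; exact: leq_add.
Qed.

Lemma poly_family_ext V (f g : k -> V -> k) : (forall t v, f t v = g t v) ->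
  poly_family f -> poly_family g.
Proof. by move=> fg [p [? ? pE]]; exists p; split=> // t v; rewrite pE. Qed.

Lemma poly_family_sum V I (r : seq I) (F : I -> k -> V -> k) :
  (forall i, poly_family (F i)) -> poly_family (fun t v => \sum_(i <- r) F i t v).
Proof.
move=> FP; elim: r => [|i r IH].
  by apply: poly_family_ext (poly_family_cst (polyfun_cst _ 0)) => t v; rewrite big_nil.
by apply: poly_family_ext (poly_familyD (FP i) IH) => t v; rewrite big_cons.
Qed.

(** The coefficient of [t] is the differential of [f] at 0, hence
linear. *)
Lemma polyfun_line V (f : V -> k) : polyfun f ->
  exists q : V -> {poly k}, [/\ forall v t, (q v).[t] = f (t *: v),
    exists n, forall v, (size (q v) <= n)%N &
    forall a x y, (q (a *: x + y))`_1 = a * (q x)`_1 + (q y)`_1].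
Proof.
elim=> [c|l|g h _ [p [pE [m pm] plin]] _ [q [qE [n qn] qlin]]
  |g h _ [p [pE [m pm] plin]] _ [q [qE [n qn] qlin]]].
- exists (fun=> c%:P); split=> [v t||a x y].
  + by rewrite hornerC.
  + by exists 1%N => v; exact: size_polyC_leq1.
  + by rewrite !coefC /= mulr0 addr0.
- exists (fun v => (l v : k) *: 'X); split=> [v t||a x y].
  + by rewrite hornerZ hornerX linearZ mulrC.
  + by exists 2%N => v; rewrite (leq_trans (size_scale_leq _ _)) // size_polyX.
  + by rewrite !coefZ coefX /= !mulr1 linearP.
- exists (fun v => p v + q v); split=> [v t||a x y].
  + by rewrite hornerD pE qE.
  + exists (maxn m n) => v; apply: leq_trans (size_polyD _ _) _.
    by rewrite geq_max !leq_max pm qn orbT.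
  + by rewrite !coefD plin qlin; ring.
- have p0 v : (p v)`_0 = g 0 by rewrite -horner_coef0 pE scale0r.
  have q0 v : (q v)`_0 = h 0 by rewrite -horner_coef0 qE scale0r.
  exists (fun v => p v * q v); split=> [v t||a x y].
  + by rewrite hornerM pE qE.
  + exists (m + n)%N => v; apply: leq_trans (size_polyMleq _ _) _.
    by apply: leq_trans (leq_pred _) _; exact: leq_add.
  + by rewrite !coefM !big_ord_recl !big_ord0 /= !subn0 !p0 !q0 plin qlin; ring.
Qed.
End PolynomialFunctions.

(** * The Baker-Campbell-Hausdorff series in degrees one and two *)

Section LowOrderBCH.
Variables (k : fieldType) (char_k : [pchar k] =i pred0) (L : lieAlgType k).
Implicit Types x y : L.

Lemma lie_wordZ (c : k) (s : seq L) :
  lie_word (map ( *:%R c) s) = c ^+ size s *: lie_word s.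
Proof.
elim: s => [|a [|b s] IH] //; first by rewrite scaler0.
rewrite -[LHS]/[lie c *: a, lie_word (map ( *:%R c) (b :: s))] IH.
by rewrite lieZl lieZr scalerA -exprS.
Qed.

Lemma bch_letters l j (rs : {ffun 'I_j -> 'I_l.+1 * 'I_l.+1}) x y :
  (\sum_i ((rs i).1 + (rs i).2) = l)%N ->
  size (flatten [seq nseq (rs i).1 x ++ nseq (rs i).2 y | i <- enum 'I_j]) = l.
Proof.
move=> sum_rs; rewrite size_flatten /shape -map_comp sumnE big_map.
rewrite -[RHS]sum_rs big_enum /=; apply: eq_bigr => i _.
by rewrite size_cat !size_nseq.
Qed.

Lemma bch_compZ l (c : k) x y :
  bch_comp l (c *: x) (c *: y) = c ^+ l *: bch_comp l x y.
Proof.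
have scaleC (a b : k) (v : L) : a *: (b *: v) = b *: (a *: v).
  by rewrite !scalerA mulrC.
rewrite /bch_comp [RHS]scaleC; congr (_ *: _); rewrite scaler_sumr.
apply: eq_bigr => j _; rewrite [RHS]scaleC; congr (_ *: _); rewrite scaler_sumr.
apply: eq_bigr => rs /andP[_ /eqP sum_rs]; rewrite [RHS]scaleC; congr (_ *: _).
rewrite -[X in c ^+ X](bch_letters x y sum_rs) -lie_wordZ map_flatten -[in RHS]map_comp.
by congr (lie_word (flatten _)); apply: eq_map => i /=; rewrite map_cat !map_nseq.
Qed.

(** The innermost bracket is a bracket of two multiples of [x]. *)
Lemma lie_word_line x (s : seq L) : (1 < size s)%N ->
  (forall z, z \in s -> exists c, z = c *: x) -> lie_word s = 0.
Proof.
elim: s => [|a [|b [|c s]] IH] //= _ line.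
  have [ca ->] := line a (mem_head _ _).
  have [|cb ->] := line b; first by rewrite !inE eqxx orbT.
  by rewrite lieZl lieZr lie_alternating !scaler0.
rewrite -[X in [lie _, X]]/(lie_word [:: b, c & s]) IH ?lie0r // => z zs.
by apply: line; rewrite inE zs orbT.
Qed.

Lemma bch_comp_line l x (a b : k) : (1 < l)%N -> bch_comp l (a *: x) (b *: x) = 0.
Proof.
move=> l1; rewrite /bch_comp big1 ?scaler0 // => j _.
rewrite big1 ?scaler0 // => rs /andP[_ /eqP sum_rs].
rewrite (@lie_word_line x) ?scaler0 ?bch_letters // => z /flattenP[s /mapP[i _ ->]].
by rewrite mem_cat !mem_nseq => /orP[/andP[_ /eqP->]|/andP[_ /eqP->]];
  [exists a|exists b].
Qed.

Lemma sum_ffun1 (T : finType) (P : pred {ffun 'I_1 -> T}) (F : {ffun 'I_1 -> T} -> L) :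
  \sum_(f | P f) F f = \sum_(p | P [ffun=> p]) F [ffun=> p].
Proof.
apply: (reindex (fun p : T => [ffun=> p] : {ffun 'I_1 -> T})).
exists (fun f : {ffun 'I_1 -> T} => f ord0) => [p _|f _].
  by rewrite ffunE.
by apply/ffunP => i; rewrite ffunE [i]ord1.
Qed.

Definition bch_inner l j x y : L :=
  \sum_(rs : {ffun 'I_j -> 'I_l.+1 * 'I_l.+1} |
          [forall i, (0 < (rs i).1 + (rs i).2)%N] &&
          (\sum_i ((rs i).1 + (rs i).2) == l)%N)
      (\prod_i (((rs i).1)`! * ((rs i).2)`!)%N%:R)^-1 *:
      lie_word (flatten
        [seq nseq (rs i).1 x ++ nseq (rs i).2 y | i <- enum 'I_j]).

Lemma bch_inner1 l x y : (0 < l)%N ->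
  bch_inner l 1 x y = \sum_(a < l.+1) \sum_(b < l.+1)
    if (a + b == l)%N then ((a`! * b`!)%N%:R)^-1 *:
      lie_word (nseq a x ++ nseq b y) else 0.
Proof.
move=> l0; rewrite /bch_inner sum_ffun1 pair_bigA big_mkcond.
apply: eq_bigr => -[a b] _; have -> : enum 'I_1 = [:: ord0] by rewrite enum_ordSl enum_ord0.
rewrite !big_ord1 /= !ffunE /= cats0; congr (if _ then _ else _).
have [e|] := eqVneq (a + b)%N l; last by rewrite andbF.
by rewrite andbT; apply/forallP => i; rewrite ffunE /= e.
Qed.

Lemma bch_comp1 x y : bch_comp 1 x y = x + y.
Proof.
rewrite /bch_comp invr1 scale1r big_nat1 expr0 divr1 scale1r -/(bch_inner 1 1 x y).
rewrite bch_inner1 // !big_ord_recl !big_ord0 /=.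
by rewrite /bump /= invr1 !scale1r !add0r !addr0 addrC.
Qed.

(** In degree 2 both blocks have exactly one letter, so that exchanging
the blocks changes the sign of the bracket and nothing else. *)
Lemma bch_inner22 x y : bch_inner 2 2 x y = 0.
Proof.
pose P (rs : {ffun 'I_2 -> 'I_3 * 'I_3}) := [forall i, (0 < (rs i).1 + (rs i).2)%N] &&
  (\sum_i ((rs i).1 + (rs i).2) == 2)%N.
pose F (rs : {ffun 'I_2 -> 'I_3 * 'I_3}) :=
  (\prod_i (((rs i).1)`! * ((rs i).2)`!)%N%:R : k)^-1 *:
      lie_word (flatten
        [seq nseq (rs i).1 x ++ nseq (rs i).2 y | i <- enum 'I_2]).
rewrite -[LHS]/(\sum_(rs | P rs) F rs).
pose h (rs : {ffun 'I_2 -> 'I_3 * 'I_3}) := [ffun i => rs (rev_ord i)].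
have hK : involutive h by move=> rs; apply/ffunP => i; rewrite !ffunE rev_ordK.
have enum2 : enum 'I_2 = [:: ord0; ord_max].
  by apply: (inj_map val_inj); rewrite val_enum_ord.
have r0 : rev_ord ord0 = ord_max :> 'I_2 by exact: val_inj.
have r1 : rev_ord ord_max = ord0 :> 'I_2 by exact: val_inj.
have Ph rs : P (h rs) = P rs.
  rewrite /P !big_ord_recl !big_ord0 !addn0 !ffunE.
  have -> : lift ord0 ord0 = ord_max :> 'I_2 by exact: val_inj.
  rewrite r0 r1 [in X in _ && X]addnC; congr (_ && _).
  by apply/forallP/forallP => H i; have := H (rev_ord i); rewrite ?ffunE ?rev_ordK.
have block rs i : P rs -> exists z, nseq (rs i).1 x ++ nseq (rs i).2 y = [:: z].
  move=> /andP[/forallP pos /eqP]; rewrite !big_ord_recl !big_ord0 addn0.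
  have -> : lift ord0 ord0 = ord_max :> 'I_2 by exact: val_inj.
  move=> sum2; have ri : ((rs i).1 + (rs i).2 = 1)%N.
    have := pos ord0; have := pos ord_max; move: sum2.
    have [->|->] : i = ord0 \/ i = ord_max; last by lia.
    - case: i => -[|[|//]] ?; [left|right]; exact: val_inj.
    - by lia.
  case: (rs i) ri => -[[|[|a]] ?] [[|[|b]] ?] //= _; [by exists y|by exists x].
have Fh rs : P rs -> F (h rs) = - F rs.
  move=> Prs; have [z0 e0] := block rs ord0 Prs; have [z1 e1] := block rs ord_max Prs.
  rewrite /F !enum2 /= !ffunE r0 r1 !cats0 e0 e1 /= lieC scalerN; congr (- (_^-1 *: _)).
  rewrite !big_ord_recl !big_ord0 !ffunE.
  have -> : lift ord0 ord0 = ord_max :> 'I_2 by exact: val_inj.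
  by rewrite r0 r1 !mulr1 mulrC.
set S := \sum_(_ | _) _; have SN : S = - S.
  rewrite {1}/S (reindex_inj (inv_inj hK)) /= -sumrN.
  by rewrite (eq_bigl _ _ Ph); apply: eq_bigr => rs; exact: Fh.
apply/eqP; have : S + S == 0 by rewrite {1}SN addNr.
have two0 : 2%:R != 0 :> k by rewrite ((pcharf0P k).1 char_k).
by rewrite -mulr2n -scaler_nat scaler_eq0 (negPf two0).
Qed.

Lemma bch_comp2 x y : bch_comp 2 x y = 2%:R^-1 *: [lie x, y].
Proof.
have two0 : 2%:R != 0 :> k by rewrite ((pcharf0P k).1 char_k).
rewrite /bch_comp big_ltn // big_nat1 -/(bch_inner 2 1 x y) -/(bch_inner 2 2 x y).
rewrite bch_inner22 scaler0 addr0 expr0 divr1 scale1r bch_inner1 //.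
rewrite !big_ord_recl !big_ord0 /=.
by rewrite /bump /= !lie_alternating !scaler0 !add0r !addr0 invr1 scale1r.
Qed.

Lemma bch_line N x (a b : k) : (0 < N)%N -> bch N (a *: x) (b *: x) = (a + b) *: x.
Proof.
move=> N0; rewrite /bch big_ltn // bch_comp1 -scalerDl big_nat big1 ?addr0 //.
by move=> l /andP[l1 _]; exact: bch_comp_line.
Qed.
End LowOrderBCH.

(** * The logarithm of a unipotent matrix is polynomial *)

Section PolynomialLogarithm.
Variable k : fieldType.

(** Truncated inversion of [e - 1], where [e] is a series with the same
first two terms as the exponential. As [(e - 1)^j] is [X^j] up to higher terms,
all the multiples of [X^j] are polynomials in [e] modulo [X^D], by descending
induction on [j]. *)
Lemma comp_inverse_mod (s : {poly k}) D :
  exists q r, q \Po (1 + 'X * (1 + 'X * s)) = 'X + 'X^D * r.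
Proof.
set e := 1 + _.
have powE j : exists w, (1 + 'X * s) ^+ j = 1 + 'X * w.
  elim: j => [|j [w IH]]; first by exists 0; rewrite mulr0 addr0.
  by exists (w + s + 'X * s * w); rewrite exprS IH; ring.
suff H m j u : (D <= j + m)%N -> exists q r, q \Po e = 'X^j * u + 'X^D * r.
  by have [q [r qE]] := H D 1%N 1 (leq_addl _ _); exists q, r; rewrite qE mulr1.
elim: m j u => [|m IH] j u.
  rewrite addn0 => Dj; exists 0, (- ('X^(j - D) * u)).
  by rewrite comp_poly0 mulrN mulrA -exprD subnKC // subrr.
rewrite addnS -addSn => Dm; have [w wE] := powE j.
elim/poly_ind: u => [|u c _].
  by exists 0, 0; rewrite comp_poly0 !mulr0 addr0.
have [q1 [r1 q1E]] := IH j.+1 u Dm; have [q2 [r2 q2E]] := IH j.+1 w Dm.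
exists (q1 + c%:P * (('X - 1) ^+ j - q2)), (r1 - c%:P * r2).
rewrite comp_polyD comp_polyM comp_polyB comp_polyC q1E q2E.
rewrite rmorphXn /= comp_polyB comp_polyX comp_polyC /e addrC addrA.
have -> : 1 + 'X * (1 + 'X * s) - 1 = 'X * (1 + 'X * s) by rewrite addrC addKr.
by rewrite exprMn wE exprS; ring.
Qed.

Lemma horner_mx_comp n (A : 'M[k]_n.+1) (p q : {poly k}) :
  horner_mx A (p \Po q) = horner_mx (horner_mx A q) p.
Proof.
elim/poly_ind: p => [|p c IH]; first by rewrite comp_poly0 !rmorph0.
by rewrite comp_poly_MXaddC !rmorphD !rmorphM /= IH horner_mx_X !horner_mx_C.
Qed.
End PolynomialLogarithm.

Section MatrixLogarithm.
Variable k : closedFieldType.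

Lemma polyfun_horner_mx n (p : {poly k}) i j :
  polyfun (fun C : 'M[k]_n.+1 => horner_mx C p i j).
Proof.
elim/poly_ind: p i j => [|p c IH] i j.
  by apply: polyfun_ext (polyfun_cst _ 0) => C; rewrite rmorph0 mxE.
apply: (@polyfun_ext _ _ (fun C => (horner_mx C p *m C) i j + c%:M i j)).
  by move=> C; rewrite rmorphD rmorphM /= horner_mx_X horner_mx_C [in RHS]mxE.
apply: polyfun_add (polyfun_cst _ _); apply: polyfun_mulmx => // i' j'.
exact: polyfun_entry.
Qed.

(** [Q] is the polynomial of [comp_inverse_mod]. The exponent is [D.+2]
because the truncated exponential has to start with [1 + A]. *)
Lemma matrix_log d D : exists Q : 'M[k]_d -> 'M[k]_d,
  (forall i j, polyfun (fun C => Q C i j)) /\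
  forall A : 'M[k]_d, A ^+ D.+2 = 0 ->
    Q (\sum_(i < D.+2) (i`!)%:R^-1 *: A ^+ i) = A.
Proof.
case: d => [|d].
  exists id; split=> [[]//|A _]; by apply/matrixP => -[].
pose s : {poly k} := \sum_(i < D) ((i.+2)`!)%:R^-1 *: 'X^i.
have [q [r qE]] := comp_inverse_mod s D.+2.
exists (fun C => horner_mx C q); split=> [i j|A AD]; first exact: polyfun_horner_mx.
have -> : \sum_(i < D.+2) (i`!)%:R^-1 *: A ^+ i =
    horner_mx A (1 + 'X * (1 + 'X * s)).
  rewrite !big_ord_recl /= !invr1 !scale1r expr0 expr1.
  rewrite mulrDr mulr1 !rmorphD rmorph1 !rmorphM /= horner_mx_X; congr (_ + (_ + _)).
  rewrite mulrA -[_ * A]expr2 rmorph_sum mulr_sumr; apply: eq_bigr => i _.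
  rewrite /= linearZ rmorphXn /= horner_mx_X -scalerAr -exprD.
  by rewrite /bump.
rewrite -horner_mx_comp qE rmorphD rmorphM rmorphXn /= horner_mx_X AD mul0r.
by rewrite addr0.
Qed.

End MatrixLogarithm.

(** * Faithful representations are closed embeddings *)

(** [V] does not come with a basis. The inverse is built from finitely
many vectors of [V] whose images have maximal rank, and hence span the image of
[L]. *)
Lemma linear_left_inverse (k : fieldType) (V : lmodType k) d (L : V -> 'M[k]_d) :
    (forall a x y, L (a *: x + y) = a *: L x + L y) -> injective L ->
  exists G : 'M[k]_d -> V,
    (forall a A B, G (a *: A + B) = a *: G A + G B) /\ cancel L G.
Proof.
move=> Llin Linj.
have L0 : L 0 = 0.
  by have := Llin 1 0 0; rewrite scaler0 addr0 scale1r -[LHS]addr0 => /addrI.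
have Lsum n (c : 'I_n -> k) (v : 'I_n -> V) :
    L (\sum_i c i *: v i) = \sum_i c i *: L (v i).
  elim: n c v => [|n IH] c v; first by rewrite !big_ord0.
  by rewrite !big_ord_recl Llin IH.
pose B n (v : 'I_n -> V) : 'M[k]_(n, d * d) := \matrix_i mxvec (L (v i)).
pose P m := `[< exists n (v : 'I_n -> V), \rank (B n v) = m >].
have P0 : exists m, P m.
  by exists (\rank (B 0%N (fun=> 0))); apply/asboolP; exists 0%N, (fun=> 0).
have Pb m : P m -> (m <= d * d)%N.
  by move=> /asboolP[n [v <-]]; exact: rank_leq_col.
case: (ex_maxnP P0 Pb) => m /asboolP[n [v rv]] maxm.
have LB x : (mxvec (L x) <= B n v)%MS.
  pose v' (i : 'I_n.+1) := if unlift ord0 i is Some j then v j else x.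
  have sBB' : (B n v <= B n.+1 v')%MS.
    apply/row_subP => i; rewrite rowK.
    have -> : v i = v' (lift ord0 i) by rewrite /v' liftK.
    by rewrite -(rowK (fun i => mxvec (L (v' i)))); exact: row_sub.
  have rB' : (\rank (B n.+1 v') <= \rank (B n v))%N.
    by rewrite rv maxm //; apply/asboolP; exists n.+1, v'.
  have sB'B : (B n.+1 v' <= B n v)%MS.
    by rewrite -(geq_leqif (mxrank_leqif_sup sBB')).
  apply: submx_trans sB'B.
  have -> : x = v' ord0 by rewrite /v' unlift_none.
  by rewrite -(rowK (fun i => mxvec (L (v' i)))); exact: row_sub.
exists (fun C => \sum_i (mxvec C *m pinvmx (B n v)) 0 i *: v i); split.
  move=> a C D; rewrite scaler_sumr -big_split; apply: eq_bigr => i _ /=.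
  by rewrite linearP /= mulmxDl -scalemxAl !mxE scalerDl scalerA.
move=> x; apply: Linj; apply: (can_inj mxvecK); rewrite Lsum linear_sum /=.
rewrite -[RHS](mulmxKpV (LB x)); set c := _ *m pinvmx _.
rewrite [RHS]mulmx_sum_row; apply: eq_bigr => i _.
by rewrite linearZ /= rowK.
Qed.

Section FaithfulRepresentation.
Variables (k : closedFieldType) (char_k : [pchar k] =i pred0).
Variables (N d : nat) (N_gt0 : (0 < N)%N).
Variables (rho : GN k N -> 'M[k]_d) (rhoP : faithful_rep rho).
Local Notation V := (free_le k N).

Let rho1 : rho (GN_one k N) = 1%:M. Proof. by case: rhoP => -[]. Qed.
Let rhoM g h : rho (GN_mul g h) = rho g *m rho h. Proof. by case: rhoP => -[]. Qed.
Let rho_poly i j : polyfun (fun x => rho (Exp x) i j).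
Proof. by case: rhoP => -[]. Qed.
Let rho_inj : injective rho. Proof. by case: rhoP. Qed.

(** Inherited from matrices through the injective [rho]. *)
Lemma GN_mulA : associative (@GN_mul k N).
Proof. by move=> g h l; apply: rho_inj; rewrite !rhoM mulmxA. Qed.

Lemma GN_mul1 : left_id (GN_one k N) (@GN_mul k N).
Proof. by move=> g; apply: rho_inj; rewrite rhoM rho1 mul1mx. Qed.

Lemma GN_mulr1 : right_id (GN_one k N) (@GN_mul k N).
Proof. by move=> g; apply: rho_inj; rewrite rhoM rho1 mulmx1. Qed.

Definition GN_inv (g : GN k N) : GN k N := Exp (- Log g).

Lemma GN_mulV g : GN_mul g (GN_inv g) = GN_one k N.
Proof.
rewrite /GN_mul /GN_inv /= -[X in bch _ X _]scale1r -scaleN1r bch_line //.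
by rewrite subrr scale0r.
Qed.

Lemma GN_mulVr g : GN_mul (GN_inv g) g = GN_one k N.
Proof.
rewrite /GN_mul /GN_inv /= -[X in bch _ _ X]scale1r -scaleN1r bch_line //.
by rewrite addNr scale0r.
Qed.

(** Let [B_i] be the coefficient of [t^i] in [rho (Exp (t v))]. Comparing the
coefficients of [s] in [rho (Exp ((s + t) v)) = rho (Exp (s v)) rho (Exp (t v))]
gives [B_1 B_i = (i + 1) B_(i+1)], so that [B_i = B_1^i / i!]. Linearity of
[B_1] in [v] comes from [polyfun_line], and the uniform bound on the degree
makes [B_1] nilpotent. *)
Lemma rho_exp : exists (L : V -> 'M[k]_d) (D : nat),
  (forall a x y, L (a *: x + y) = a *: L x + L y) /\
  forall x, L x ^+ D.+2 = 0 /\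
    rho (Exp x) = \sum_(i < D.+2) (i`!)%:R^-1 *: L x ^+ i.
Proof.
pose R (ab : 'I_d * 'I_d) (q : V -> {poly k}) :=
  [/\ forall v t, (q v).[t] = rho (Exp (t *: v)) ab.1 ab.2,
    exists n, forall v, (size (q v) <= n)%N &
    forall a x y, (q (a *: x + y))`_1 = a * (q x)`_1 + (q y)`_1].
have [Q QP] : {Q & forall ab, R ab (Q ab)}.
  by apply: choice => ab; exact: polyfun_line (rho_poly ab.1 ab.2).
have [S SP] : {S : 'I_d * 'I_d -> nat & forall ab v, (size (Q ab v) <= S ab)%N}.
  by apply: (choice (P := fun ab s => forall v, (size (Q ab v) <= s)%N)) => ab; case: (QP ab).
pose D := (\sum_ab S ab)%N.
have sQ ab v : (size (Q ab v) <= D)%N.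
  by apply: leq_trans (SP ab v) _; rewrite /D (bigD1 ab) //= leq_addr.
pose B i v : 'M[k]_d := \matrix_(a, b) (Q (a, b) v)`_i.
have QE a b v t : (Q (a, b) v).[t] = rho (Exp (t *: v)) a b by case: (QP (a, b)).
have Qadd a b v s t : (Q (a, b) v).[s + t] =
    \sum_c (Q (a, c) v).[s] * (Q (c, b) v).[t].
  rewrite QE -[Exp _]/(Exp ((s + t) *: v) : GN k N).
  have -> : Exp ((s + t) *: v) = GN_mul (Exp (s *: v)) (Exp (t *: v)) :> GN k N.
    by rewrite /GN_mul bch_line.
  by rewrite rhoM mxE; apply: eq_bigr => c _; rewrite !QE.
have Qderiv a b v : (Q (a, b) v)^`() = \sum_c (Q (a, c) v)`_1 *: Q (c, b) v.
  apply: (poly_eq_fun char_k) => t.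
  have : Q (a, b) v \Po ('X + t%:P) = \sum_c (Q (c, b) v).[t] *: Q (a, c) v.
    apply: (poly_eq_fun char_k) => s.
    rewrite horner_comp !hornerE Qadd horner_sum; apply: eq_bigr => c _.
    by rewrite hornerZ mulrC.
  move=> /(congr1 (fun p => p^`().[0])).
  rewrite deriv_comp derivD derivX derivC addr0 mulr1 horner_comp !hornerE => ->.
  rewrite raddf_sum !horner_sum; apply: eq_bigr => c _.
  by rewrite /= derivZ !hornerZ horner_coef0 coef_deriv mulr1n mulrC.
have B0 v : B 0%N v = 1%:M.
  by rewrite -rho1; apply/matrixP => a b; rewrite mxE -horner_coef0 QE scale0r.
have BS i v : B 1%N v *m B i v = i.+1%:R *: B i.+1 v.
  apply/matrixP => a b; rewrite !mxE mulr_natl -coef_deriv Qderiv coef_sum.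
  by apply: eq_bigr => c _; rewrite !mxE coefZ.
have BX i v : B i v = (i`!)%:R^-1 *: B 1%N v ^+ i.
  elim: i => [|i IH]; first by rewrite B0 invr1 scale1r expr0.
  have Si0 := natSr_neq0 char_k i.
  apply: (scalerI Si0); rewrite -BS {1}IH -scalemxAr scalerA factS natrM.
  by rewrite invfM mulrA mulfV // mul1r exprS.
exists (B 1%N), D; split.
  by move=> a x y; apply/matrixP => i j; rewrite !mxE; case: (QP (i, j)).
move=> v; split.
  have fact0 : (D.+2)`!%:R != 0 :> k.
    by rewrite ((pcharf0P k).1 char_k) -lt0n fact_gt0.
  apply: (scalerI (invr_neq0 fact0)); rewrite -BX scaler0.
  apply/matrixP => a b; rewrite !mxE nth_default //.
  by apply: leq_trans (sQ _ _) _; rewrite leqW.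
apply/matrixP => a b; rewrite -[v in LHS]scale1r -QE.
rewrite (horner_coef_wide (n := D.+2)) ?(leq_trans (sQ _ _)) ?leqW // summxE.
by apply: eq_bigr => i _; rewrite expr1n mulr1 -BX mxE.
Qed.

(** Take the polynomial logarithm followed by a left inverse of the
differential [L] of [rho], which is injective as [rho] is. *)
Lemma rho_log : exists lg : 'M[k]_d -> V,
  (forall f, polyfun f -> polyfun (f \o lg)) /\ forall g, lg (rho g) = Log g.
Proof.
have [L [D [Llin LP]]] := rho_exp.
have Linj : injective L.
  move=> x y Lxy; have Lz : L (x - y) = 0.
    by rewrite addrC -scaleN1r Llin Lxy scaleN1r addNr.
  have L0 : L 0 = 0.
    by have := Llin 1 0 0; rewrite scaler0 addr0 scale1r -[LHS]addr0 => /addrI.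
  have : rho (Exp (x - y)) = rho (Exp 0) by rewrite !(LP _).2 Lz L0.
  by move/rho_inj => [/subr0_eq].
have [G [Glin GK]] := linear_left_inverse Llin Linj.
have [Q [Qpoly QE]] := matrix_log k d D.
exists (G \o Q); split=> [f fP|[x]]; last first.
  by have [LD rE] := LP x; rewrite /= rE QE // GK.
rewrite -[f \o _]/((f \o G) \o Q).
by apply: polyfun_comp_mx => //; exact: polyfun_comp_linear.
Qed.

(** Every polynomial function is a polynomial in the entries of [rho].
Through it the translates of polynomial functions are seen to be polynomial
without expanding the Baker-Campbell-Hausdorff product. *)
Lemma polyfun_factor (f : V -> k) : polyfun f ->
  exists2 p : 'M[k]_d -> k, polyfun p & forall g, f (Log g) = p (rho g).
Proof.
have [lg [lgP lgE]] := rho_log.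
by move=> fP; exists (f \o lg); [exact: lgP|move=> g /=; rewrite lgE].
Qed.

Lemma polyfun_mul_right (f : V -> k) h : polyfun f ->
  polyfun (fun x : V => f (Log (GN_mul (Exp x) h))).
Proof.
move=> /polyfun_factor[p pP pE].
apply: (@polyfun_ext _ _ (fun x : V => p (rho (Exp x) *m rho h))).
  by move=> x; rewrite pE rhoM.
apply: (polyfun_comp_mx (phi := fun x : V => rho (Exp x) *m rho h)) pP.
by apply: polyfun_mulmx => // i j; exact: polyfun_cst.
Qed.

Lemma poly_family_mul_left (c : k -> V) (f : V -> k) : poly_curve c -> polyfun f ->
  poly_family (fun t x => f (Log (GN_mul (Exp (c t)) (Exp x)))).
Proof.
move=> cP /polyfun_factor[p pP pE].
apply: (@poly_family_ext _ _ (fun t x => p (rho (Exp (c t)) *m rho (Exp x)))).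
  by move=> t x; rewrite pE rhoM.
have entry i j : poly_family (fun t x => (rho (Exp (c t)) *m rho (Exp x)) i j).
  apply: (@poly_family_ext _ _ (fun t x => \sum_l rho (Exp (c t)) i l * rho (Exp x) l j)).
    by move=> t x; rewrite mxE.
  apply: poly_family_sum => l; apply: poly_familyM; last exact: poly_family_cst.
  have [q qE] := polyfun_curve cP (rho_poly i l).
  by apply: poly_family_ext (poly_family_poly _ q) => t x; rewrite qE.
elim: {pE} pP => [a|l|g h _ IHg _ IHh|g h _ IHg _ IHh].
- exact/poly_family_cst/polyfun_cst.
- apply: (@poly_family_ext _ _ (fun t x => \sum_i \sum_j
      (rho (Exp (c t)) *m rho (Exp x)) i j * l (delta_mx i j))).
    by move=> t x; rewrite [in RHS]linear_entries.
  apply: poly_family_sum => i; apply: poly_family_sum => j.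
  by apply: poly_familyM => //; exact/poly_family_cst/polyfun_cst.
- exact: poly_familyD.
- exact: poly_familyM.
Qed.

End FaithfulRepresentation.

(** * Functions invariant under the curve xN *)

Section Invariants.
Variables (k : closedFieldType) (char_k : [pchar k] =i pred0).
Variables (N d : nat) (N_gt0 : (0 < N)%N).
Variables (rho : GN k N -> 'M[k]_d) (rhoP : faithful_rep rho).
Local Notation V := (free_le k N).

Let pi_morph := free_le_pi_morphism k N.

Lemma xN_curve : poly_curve (fun t => Log (xN N t : GN k N)).
Proof.
apply: (@poly_curve_sum k V N (fun m t => t ^+ m.+1)
  (fun m => free_le_pi N (free_gen k m))) => m.
by exists 'X^(m.+1) => t; rewrite hornerXn.
Qed.

Lemma free_le_generated (W : set V) : submodule W ->
    (forall x y, W x -> W y -> W [lie x, y]) ->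
    (forall m, (m < N)%N -> W (free_le_pi N (free_gen k m))) ->
  forall x, W x.
Proof.
move=> [W0 Wlin] Wbr Wgen; elim/free_le_ind; elim/free_lie_ind.
- move=> m; have [mN|Nm] := ltnP m N; first exact: Wgen.
  suff -> : free_le_pi N (free_gen k m) = 0 by [].
  rewrite -(lie_morph0 pi_morph); apply/lie_piP; rewrite subr0.
  by apply: (@weight_gt_mono _ _ m.+1) => //; exact: mon_gen.
- by rewrite (lie_morph0 pi_morph).
- by move=> a x y Wx Wy; case: pi_morph => -> _; exact: Wlin.
- by move=> x y Wx Wy; case: pi_morph => _ ->; exact: Wbr.
Qed.

Section ClosedSubspace.
Variable W : set V.
Hypothesis W_limit : forall c, poly_curve c ->
  (forall t, t != 0 -> W (c t)) -> W (c 0).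

Lemma curve_at0 n (e : nat -> V) : (0 < n)%N ->
  (forall t, t != 0 -> W (\sum_(m < n) t ^+ m *: e m)) -> W (e 0%N).
Proof.
case: n => // n _ We.
have -> : e 0%N = \sum_(m < n.+1) 0 ^+ m *: e m.
  rewrite big_ord_recl expr0 scale1r big1 ?addr0 // => m _.
  by rewrite expr0n scale0r.
apply: (W_limit (c := fun t => \sum_(m < n.+1) t ^+ m *: e m)) => //.
by apply: (@poly_curve_sum k V n.+1 (fun m t => t ^+ m) e) => m; exists 'X^m => t; rewrite hornerXn.
Qed.

(** The limit at [t = 0] gives the constant coefficient; subtract it,
divide by [t], and repeat. *)
Lemma curve_coefs : submodule W -> forall n (e : nat -> V),
    (forall t, t != 0 -> W (\sum_(m < n) t ^+ m *: e m)) ->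
  forall m, (m < n)%N -> W (e m).
Proof.
move=> [W0 Wlin]; elim=> // n IH e We.
have We0 : W (e 0%N) by exact: curve_at0 We.
case=> // m; rewrite ltnS => mn; apply: (IH (fun m => e m.+1)) mn => t t0.
have -> : \sum_(i < n) t ^+ i *: e i.+1 =
    t^-1 *: ((-1) *: e 0%N + \sum_(i < n.+1) t ^+ i *: e i) + 0.
  rewrite big_ord_recl expr0 scale1r scaleN1r addKr addr0 scaler_sumr.
  by apply: eq_bigr => i _; rewrite scalerA exprS mulKf.
by apply: (Wlin _ _ _ _ W0); apply: Wlin => //; exact: We.
Qed.
End ClosedSubspace.

(** The [x] such that left translation by [Exp x] preserves [f] form a
Zariski closed set [W] that is stable under [bch]. It is stable under scalars,
because integer multiples are powers and the integers are Zariski dense. The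
coefficients of [bch (t x) (t y)] as a polynomial in [t] then show that [W] is
a Lie subalgebra, and those of the logarithm of [xN t] that it contains the
generators. *)
Lemma invariant_const (f : V -> k) : polyfun f ->
    (forall t x, f (Log (GN_mul (xN N t) (Exp x))) = f x) ->
  forall x, f x = f 0.
Proof.
move=> fP f_inv.
pose W : set V := [set x | forall v, f (Log (GN_mul (Exp x) (Exp v))) = f v].
have one_r x : GN_mul (Exp x) (Exp 0) = Exp x :> GN k N.
  exact: (GN_mulr1 rhoP).
have one_l x : GN_mul (Exp 0) (Exp x) = Exp x :> GN k N.
  exact: (GN_mul1 rhoP).
have W_limit c : poly_curve c -> (forall t, t != 0 -> W (c t)) -> W (c 0).
  move=> cP Wc v.
  have [q [_ _ qE]] := poly_family_mul_left char_k N_gt0 rhoP cP fP.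
  apply/eqP; rewrite -qE -subr_eq0; apply/eqP.
  have := poly_fun_at0 char_k (p := q v - (f v)%:P); rewrite !hornerE; apply=> t t0.
  by rewrite !hornerE qE Wc ?subrr.
have WM x y : W x -> W y -> W (bch N x y).
  move=> Wx Wy v; rewrite -[Exp (bch N x y)]/(GN_mul (Exp x) (Exp y)).
  rewrite -(GN_mulA rhoP); have := Wx (Log (GN_mul (Exp y) (Exp v))).
  by case: (GN_mul (Exp y) (Exp v)) (Wy v) => z /= <- ->.
have W0 : W 0 by move=> v; rewrite one_l.
have WZ x (a : k) : W x -> W (a *: x).
  move=> Wx v; have Wn n : W (n%:R *: x).
    elim: n => [|n IH]; first by rewrite scale0r.
    by rewrite -natr1 -(bch_line x _ _ N_gt0) scale1r; exact: WM.
  have cP : poly_curve (fun t => t *: x).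
    move=> l; exists ((l x : k) *: 'X) => t.
    by rewrite hornerZ hornerX linearZ mulrC.
  have [q [_ _ qE]] := poly_family_mul_left char_k N_gt0 rhoP cP fP.
  rewrite -qE; suff -> : q v = (f v)%:P by rewrite hornerC.
  apply/eqP; rewrite -subr_eq0; apply/eqP.
  apply: (poly_nat_eq0 char_k (n0 := 0)) => n _.
  by rewrite !hornerE qE Wn subrr.
have W_bch x y t : W x -> W y -> t != 0 ->
    W (\sum_(l < N) t ^+ l *: bch_comp l.+1 x y).
  move=> Wx Wy t0.
  have -> : \sum_(l < N) t ^+ l *: bch_comp l.+1 x y =
      t^-1 *: bch N (t *: x) (t *: y).
    rewrite /bch big_add1 /= big_mkord scaler_sumr; apply: eq_bigr => l _.
    by rewrite bch_compZ [in RHS]scalerA exprS mulKf.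
  exact: WZ (WM _ _ (WZ _ t Wx) (WZ _ t Wy)).
have WD x y : W x -> W y -> W (x + y).
  move=> Wx Wy; rewrite -bch_comp1.
  apply: (curve_at0 W_limit N_gt0 (e := fun l => bch_comp l.+1 x y)) => t t0.
  exact: W_bch.
have Wlin : submodule W.
  by split=> [|a x y Wx Wy]; [exact: W0|exact: WD _ _ (WZ _ a Wx) Wy].
have Wall : forall x, W x.
  apply: (free_le_generated Wlin) => [x y Wx Wy|].
    have [N1|N1] := ltnP 1 N; last first.
      have -> : [lie x, y] = 0 by rewrite -[LHS]/(lie_word [:: x; y]) free_le_word.
      exact: W0.
    have two0 : 2%:R != 0 :> k by rewrite ((pcharf0P k).1 char_k).
    have -> : [lie x, y] = 2%:R *: bch_comp 2 x y.
      by rewrite (bch_comp2 char_k) scalerA mulfV // scale1r.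
    apply: WZ.
    apply: (curve_coefs W_limit Wlin (n := N)
      (e := fun l => bch_comp l.+1 x y) _ N1) => t t0.
    exact: W_bch.
  apply: (curve_coefs W_limit Wlin (e := fun m => free_le_pi N (free_gen k m))) => t t0.
  have Wx : W (Log (xN N t : GN k N)) by move=> v; rewrite -[RHS](f_inv t).
  have -> : \sum_(m < N) t ^+ m *: free_le_pi N (free_gen k m) =
      t^-1 *: Log (xN N t : GN k N).
    by rewrite scaler_sumr; apply: eq_bigr => m _; rewrite scalerA exprS mulKf.
  exact: WZ.
by move=> x; have := Wall x 0; rewrite one_r.
Qed.
End Invariants.

(** * Weights and dilations *)

Section Dilation.
Variable k : fieldType.

(** The grading of the free Lie algebra enters the argument through these
automorphisms, which also act on polynomial functions. *)
Definition dilation (a : k) : free_lie k -> free_lie k :=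
  projT1 (cid (free_lie_universal (fun i => a ^+ i.+1 *: free_gen k i))).

Lemma dilation_morphism a : lie_morphism (dilation a).
Proof. by rewrite /dilation; case: cid => f [[]]. Qed.

Lemma dilation_gen a i : dilation a (free_gen k i) = a ^+ i.+1 *: free_gen k i.
Proof. by rewrite /dilation; case: cid => f [[]]. Qed.

Lemma dilation_monomial a q x : lie_monomial q x -> dilation a x = a ^+ q *: x.
Proof.
elim=> [i|p q' y z _ IHy _ IHz]; first exact: dilation_gen.
by case: (dilation_morphism a) => _ ->; rewrite IHy IHz lieZl lieZr scalerA exprD.
Qed.

Lemma dilation_weight_gt a N x : weight_gt N x -> weight_gt N (dilation a x).
Proof.
have dM := dilation_morphism a; have [z0 zlin] := @weight_gt_submodule k N.
move: x; apply: weight_gt_ind; first split.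
- by rewrite /= (lie_morph0 dM).
- by move=> c x y Wx Wy; case: dM => /= -> _; exact: zlin.
move=> q x Nq mx; rewrite /= (dilation_monomial a mx) -[_ *: _]addr0.
by apply: (zlin) => //; exact: weight_gt_mono mx.
Qed.

Variable N : nat.
Let pi_morph := free_le_pi_morphism k N.

Definition dilation_le (a : k) (u : free_le k N) : free_le k N :=
  free_le_pi N (dilation a (repr (u : lie_quot (weight_ideal k N)))).

Lemma dilation_leE a x : dilation_le a (free_le_pi N x) = free_le_pi N (dilation a x).
Proof.
apply/lie_piP; have dM := dilation_morphism a.
rewrite -scaleN1r addrC; case: (dM) => <- _; rewrite scaleN1r addrC.
apply: dilation_weight_gt; exact: (@lie_repr _ _ (weight_ideal k N)).
Qed.

Lemma dilation_le_morphism a : lie_morphism (dilation_le a).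
Proof.
have [dlin dbr] := dilation_morphism a; have [plin pbr] := pi_morph.
split=> [c| ]; elim/free_le_ind => x; elim/free_le_ind => y.
  by rewrite -plin !dilation_leE dlin plin.
by rewrite -pbr !dilation_leE dbr pbr.
Qed.

Lemma dilation_le1 u : dilation_le 1 u = u.
Proof.
elim/free_le_ind: u => x; rewrite dilation_leE; congr (free_le_pi _ _).
have dM := dilation_morphism 1; elim/free_lie_ind: x => [i||a x y IHx IHy|x y IHx IHy].
- by rewrite dilation_gen expr1n scale1r.
- exact: lie_morph0 dM.
- by case: dM => -> _; rewrite IHx IHy.
- by case: dM => _ ->; rewrite IHx IHy.
Qed.

Lemma dilation_xN a t :
  dilation_le a (Log (xN N t : GN k N)) = Log (xN N (a * t) : GN k N).
Proof.
rewrite /= (lie_morph_sum (dilation_le_morphism a)); apply: eq_bigr => m _.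
rewrite (lie_morphZ (dilation_le_morphism a)) dilation_leE dilation_gen.
by rewrite (lie_morphZ pi_morph) scalerA exprMn mulrC.
Qed.

Lemma dilation_mul a (g h : GN k N) :
  Exp (dilation_le a (Log (GN_mul g h))) =
  GN_mul (Exp (dilation_le a (Log g))) (Exp (dilation_le a (Log h))) :> GN k N.
Proof. by congr Exp; exact: (lie_morph_bch (dilation_le_morphism a)). Qed.

(** Along every orbit of the dilations, [f] is a polynomial of degree less
than [w] in the parameter; so 0 is the only function with [weight_le 0]. *)
Definition weight_le (w : nat) (f : free_le k N -> k) : Prop :=
  forall x, exists2 p : {poly k}, (size p <= w)%N &
    forall a, p.[a] = f (dilation_le a x).

Lemma weight_le_mono w w' f : (w <= w')%N -> weight_le w f -> weight_le w' f.
Proof. by move=> ww' fw x; case: (fw x) => p /leq_trans pw pE; exists p; rewrite ?pw. Qed.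

Lemma weight_le0 f x : weight_le 0 f -> f x = 0.
Proof.
move=> /(_ x)[p]; rewrite leqn0 size_poly_eq0 => /eqP-> pE.
by rewrite -[x]dilation_le1 -pE horner0.
Qed.

Lemma polyfun_weight (f : free_le k N -> k) : polyfun f -> exists w, weight_le w f.
Proof.
elim=> [c|l|g h _ [v gv] _ [w hw]|g h _ [v gv] _ [w hw]].
- by exists 1%N => x; exists c%:P => [|a]; rewrite ?size_polyC_leq1 ?hornerC.
- exists N.+1; elim/free_le_ind => x.
  suff: [set x | exists2 p : {poly k}, (size p <= N.+1)%N &
      forall a, p.[a] = l (dilation_le a (free_le_pi N x))] x by [].
  move: x (weight_gt0 x); apply: weight_gt_ind.
    split=> [|c x y [p ps pE] [q qs qE]].
      exists 0; rewrite ?size_poly0 // => a.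
      rewrite horner0 (lie_morph0 pi_morph).
      by rewrite (lie_morph0 (dilation_le_morphism a)) linear0.
    exists (c *: p + q) => [|a].
      rewrite (leq_trans (size_polyD _ _)) // geq_max qs andbT.
      by rewrite (leq_trans (size_scale_leq _ _)).
    rewrite hornerD hornerZ pE qE; case: pi_morph => -> _.
    by case: (dilation_le_morphism a) => -> _; rewrite linearP.
  move=> q x _ mx; have [qN|Nq] := leqP q N; last first.
    exists 0; rewrite ?size_poly0 // => a.
    have -> : free_le_pi N x = 0.
      rewrite -(lie_morph0 pi_morph); apply/lie_piP; rewrite subr0.
      exact: weight_gt_mono mx.
    by rewrite horner0 (lie_morph0 (dilation_le_morphism a)) linear0.
  exists ((l (free_le_pi N x) : k) *: 'X^q) => [|a].
    by rewrite (leq_trans (size_scale_leq _ _)) // size_polyXn.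
  rewrite dilation_leE (dilation_monomial a mx) (lie_morphZ pi_morph) linearZ.
  by rewrite hornerZ hornerXn mulrC.
- exists (maxn v w) => x; have [p pv pE] := gv x; have [q qw qE] := hw x.
  exists (p + q) => [|a]; last by rewrite hornerD pE qE.
  by rewrite (leq_trans (size_polyD _ _)) // geq_max !leq_max pv qw orbT.
- exists (v + w)%N => x; have [p pv pE] := gv x; have [q qw qE] := hw x.
  exists (p * q) => [|a]; last by rewrite hornerM pE qE.
  apply: leq_trans (size_polyMleq _ _) _.
  by apply: leq_trans (leq_pred _) _; exact: leq_add.
Qed.
End Dilation.

(** * Left translation by the curve xN *)

Section LeftTranslation.
Variables (k : closedFieldType) (char_k : [pchar k] =i pred0).
Variables (N d : nat) (N_gt0 : (0 < N)%N).
Variables (rho : GN k N -> 'M[k]_d) (rhoP : faithful_rep rho).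
Local Notation V := (free_le k N).

(** The right-invariant differential operator given by the coefficient of [t^i]
in [exp (e_1 t + ... + e_N t^N)]. *)
Definition xN_coef (i : nat) (f : V -> k) (x : V) : k :=
  (poly_of_fun (fun t => f (Log (GN_mul (xN N t) (Exp x)))))`_i.

Lemma xN_coefP (f : V -> k) : polyfun f ->
  [/\ forall i, polyfun (xN_coef i f),
      forall x, xN_coef 0 f x = f x
    & exists n, (forall i x, (n <= i)%N -> xN_coef i f x = 0) /\ forall m t x, (n <= m)%N ->
        f (Log (GN_mul (xN N t) (Exp x))) = \sum_(i < m) t ^+ i * xN_coef i f x].
Proof.
move=> fP; have [q [qP [n qn] qE]] :=
  poly_family_mul_left char_k N_gt0 rhoP (@xN_curve k N) fP.
have tE i x : xN_coef i f x = (q x)`_i.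
  by rewrite /xN_coef (poly_of_funP char_k (p := q x)).
split=> [i|x|].
- by apply: polyfun_ext (qP i) => x.
- rewrite tE -horner_coef0 qE.
  have -> : Exp (Log (xN N 0 : GN k N)) = GN_one k N.
    by congr Exp; rewrite /= big1 // => m _; rewrite expr0n scale0r.
  by rewrite (GN_mul1 rhoP).
exists n; split=> [i x ni|m t x nm].
  by rewrite tE nth_default // (leq_trans (qn x)).
rewrite -[LHS]/(f (Log (GN_mul (Exp (Log (xN N t : GN k N))) (Exp x)))) -qE.
rewrite (horner_coef_wide (n := m)) ?(leq_trans (qn x)) //.
by apply: eq_bigr => i _; rewrite tE mulrC.
Qed.

(** As the dilation by [a] maps [xN t] to [xN (a t)], the function
[f (xN t x)] dilated by [a] is [sum_m (a t)^m f_m] dilated by [a]. It has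
degree less than [w] in [a] for every [t], so each term does, and its factor
[a^m] lowers the weight that is left for [f_m]. *)
Lemma xN_coef_weight i w f : polyfun f -> weight_le w f -> weight_le (w - i) (xN_coef i f).
Proof.
move=> fP fw x; have [Dpoly _ [n [D_eq0 DE]]] := xN_coefP fP.
have [P PP] : {P : nat -> {poly k} & forall j a, (P j).[a] = xN_coef j f (dilation_le a x)}.
  apply: (choice (P := fun j (p : {poly k}) => forall a, p.[a] = xN_coef j f (dilation_le a x))).
  by move=> j; have [wj /(_ x)[p _ pE]] := polyfun_weight (Dpoly j); exists p.
exists (P i) => //; apply/leq_sizeP => j; rewrite leq_subLR => wij.
have [ni|i_n] := leqP n i.
  suff -> : P i = 0 by rewrite coef0.
  by apply: (poly_eq_fun char_k) => a; rewrite PP D_eq0 // horner0.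
have sum0 t : \sum_(m < n) ('X^m * P m)`_(i + j) * t ^+ m = 0.
  have [R Rw RE] := fw (Log (GN_mul (xN N t) (Exp x))).
  have -> : \sum_(m < n) ('X^m * P m)`_(i + j) * t ^+ m = R`_(i + j).
    have -> : R = \sum_(m < n) t ^+ m *: ('X^m * P m).
      apply: (poly_eq_fun char_k) => a.
      have := dilation_mul a (xN N t) (Exp x) => -[dE].
      rewrite RE dE -[bch _ _ _]/(Log (GN_mul
        (Exp (dilation_le a (Log (xN N t : GN k N)))) (Exp (dilation_le a x)))).
      rewrite dilation_xN -[Exp (Log _)]/(xN N (a * t) : GN k N) (DE n) // horner_sum.
      apply: eq_bigr => m _; rewrite hornerZ hornerM hornerXn PP exprMn.
      by rewrite -mulrA mulrCA.
    by rewrite coef_sum; apply: eq_bigr => m _; rewrite coefZ mulrC.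
  by rewrite nth_default // (leq_trans Rw).
have : \poly_(m < n) ('X^m * P m)`_(i + j) = 0.
  by apply: (poly_eq_fun char_k) => t; rewrite horner_poly sum0 horner0.
move=> /(congr1 (fun p : {poly k} => p`_i)); rewrite coef_poly i_n coef0.
by rewrite coefXnM ltnNge leq_addr addKn.
Qed.

End LeftTranslation.

(** * Finite families of functions on which translation is triangular *)

Section Spans.
Variables (k : fieldType) (T : Type).
Implicit Types (f g : T -> k) (s : seq (T -> k)).

Fixpoint in_span s g : Prop :=
  if s is f :: s' then
    exists a h, in_span s' h /\ forall x, g x = a * f x + h x
  else forall x, g x = 0.

Fixpoint fun_free s : Prop :=
  if s is f :: s' then ~ in_span s' f /\ fun_free s' else True.

Lemma in_span_ext s f g : (forall x, f x = g x) -> in_span s f -> in_span s g.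
Proof. by move=> /funext->. Qed.

Lemma in_span0 s : in_span s (fun=> 0).
Proof.
elim: s => //= f s IH; exists 0, (fun=> 0); split=> // x.
by rewrite mul0r addr0.
Qed.

Lemma in_span_lin s a f g : in_span s f -> in_span s g ->
  in_span s (fun x => a * f x + g x).
Proof.
elim: s f g => [|e s IH] f g /=; first by move=> f0 g0 x; rewrite f0 g0 mulr0 addr0.
move=> [b [f' [sf' fE]]] [c [g' [sg' gE]]].
exists (a * b + c), (fun x => a * f' x + g' x); split; first exact: IH.
by move=> x; rewrite fE gE; ring.
Qed.

Lemma in_span_cons f s g : in_span s g -> in_span (f :: s) g.
Proof. by move=> sg; exists 0, g; split=> // x; rewrite mul0r add0r. Qed.

Lemma in_span_head f s : in_span (f :: s) f.
Proof.
exists 1, (fun=> 0); split; first exact: in_span0.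
by move=> x; rewrite mul1r addr0.
Qed.

Lemma in_span_catl s s' g : in_span s g -> in_span (s ++ s') g.
Proof.
elim: s g => [|f s IH] g /=; last first.
  by move=> [a [h [/IH sh gE]]]; exists a, h.
by move=> g0; apply: in_span_ext (in_span0 s') => x; rewrite g0.
Qed.

Lemma in_span_catr s s' g : in_span s' g -> in_span (s ++ s') g.
Proof. by elim: s => // f s IH /IH; exact: in_span_cons. Qed.

Lemma in_spanP s g : in_span s g <-> exists c : nat -> k,
  forall x, g x = \sum_(j < size s) c j * nth (fun=> 0) s j x.
Proof.
elim: s g => [|f s IH] g /=.
  split=> [g0|[c gE] x]; last by rewrite gE big_ord0.
  by exists (fun=> 0) => x; rewrite g0 big_ord0.
split=> [[a [h [/IH[c hE] gE]]]|[c gE]].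
  exists (fun j => if j is j'.+1 then c j' else a) => x.
  by rewrite big_ord_recl gE hE.
exists (c 0%N), (fun x => \sum_(j < size s) c j.+1 * nth (fun=> 0) s j x).
split; first by apply/IH; exists (fun j => c j.+1).
by move=> x; rewrite gE big_ord_recl.
Qed.

Lemma fun_free_coef s (c : nat -> k) : fun_free s ->
    (forall x, \sum_(j < size s) c j * nth (fun=> 0) s j x = 0) ->
  forall j, (j < size s)%N -> c j = 0.
Proof.
elim: s c => [|f s IH] c //= [nf fs] c0.
have c00 : c 0%N = 0.
  apply/eqP; apply: contra_notT nf => c00.
  apply/in_spanP; exists (fun j => - (c 0%N)^-1 * c j.+1) => x.
  have /eqP := c0 x; rewrite big_ord_recl /= addr_eq0 => /eqP fE.
  rewrite -[LHS](mulKf c00) fE mulrN -mulNr mulr_sumr.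
  by apply: eq_bigr => j _; rewrite mulrA.
case=> [|j] //; rewrite ltnS; apply: (IH (fun j => c j.+1)) => // x.
by have := c0 x; rewrite big_ord_recl /= c00 mul0r add0r.
Qed.

Variables (D : nat -> (T -> k) -> T -> k) (P : (T -> k) -> Prop).

(** The operators [D i], [i > 0], map each member of the family to a
combination of the later ones. Stated by recursion on the list, this is stable
under concatenation and under removal of redundant members. *)
Fixpoint triangular s : Prop :=
  if s is f :: s' then
    [/\ P f, forall i, (0 < i)%N -> in_span s' (D i f) & triangular s']
  else True.

Lemma triangular_cat s s' : triangular s -> triangular s' -> triangular (s ++ s').
Proof.
elim: s => //= f s IH [Pf Df ts] ts'; split=> // [i i0|]; last exact: IH.
exact/in_span_catl/Df.
Qed.

Lemma triangular_gather n (F : nat -> T -> k) :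
    (forall i, (i < n)%N -> exists2 s, triangular s & in_span s (F i)) ->
  exists2 s, triangular s & forall i, (i < n)%N -> in_span s (F i).
Proof.
elim: n => [|n IH] FP; first by exists [::].
have [s ts sF] := IH (fun i ni => FP i (leqW ni)).
have [s' ts' s'F] := FP n (leqnn _).
exists (s ++ s'); first exact: triangular_cat.
move=> i; rewrite ltnS leq_eqVlt => /orP[/eqP->|/sF]; first exact: in_span_catr.
exact: in_span_catl.
Qed.

(** Dropping a function that is in the span of the later ones changes no
span, so triangularity survives. *)
Lemma triangular_prune s : triangular s -> exists s', [/\ triangular s', fun_free s'
  & forall g, in_span s g -> in_span s' g].
Proof.
elim: s => [|f s IH] /=; first by exists [::].
move=> [Pf Df /IH[s' [ts' fs' ss']]].
have [sf|nsf] := pselect (in_span s' f).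
  exists s'; split=> // g [a [h [/ss' sh gE]]].
  by apply: in_span_ext (in_span_lin a sf sh) => x.
exists (f :: s'); split=> //=; first by split=> // i i0; exact/ss'/Df.
by move=> g [a [h [/ss' sh gE]]]; exists a, h.
Qed.

Lemma triangular_nth s j : triangular s -> (j < size s)%N ->
  P (nth (fun=> 0) s j) /\
  forall i, (0 < i)%N -> exists c : nat -> k, (forall l, (l <= j)%N -> c l = 0) /\
    forall x, D i (nth (fun=> 0) s j) x =
      \sum_(l < size s) c l * nth (fun=> 0) s l x.
Proof.
elim: s j => [|f s IH] //= [|j] [Pf Df ts].
  move=> _; split=> // i /Df /in_spanP[c cE].
  exists (fun l => if l is l'.+1 then c l' else 0); split=> [[]//|x].
  by rewrite big_ord_recl mul0r add0r /= cE.
rewrite ltnS => /(IH _ ts)[Pj Dj]; split=> // i /Dj[c [c0 cE]].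
exists (fun l => if l is l'.+1 then c l' else 0); split=> [[|l]//|x]; first exact: c0.
by rewrite big_ord_recl mul0r add0r /= cE.
Qed.
End Spans.

Section AdaptedBasis.
Variables (k : closedFieldType) (char_k : [pchar k] =i pred0).
Variables (N d : nat) (N_gt0 : (0 < N)%N).
Variables (rho : GN k N -> 'M[k]_d) (rhoP : faithful_rep rho).
Local Notation V := (free_le k N).

(** By induction on the weight: put [f] in front of families for its
finitely many nonzero coefficients, which have smaller weight. *)
Lemma polyfun_triangular w (f : V -> k) : polyfun f -> weight_le w f ->
  exists2 s, triangular (@xN_coef k N) (@polyfun k V) s & in_span s f.
Proof.
elim: w f => [|w IH] f fP fw.
  by exists [::] => //= x; exact: weight_le0.
have [Dpoly _ [n [D_eq0 _]]] := xN_coefP char_k N_gt0 rhoP fP.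
have [s ts sD] : exists2 s, triangular (@xN_coef k N) (@polyfun k V) s &
    forall i, (i < n)%N -> in_span s (xN_coef i.+1 f).
  apply: triangular_gather => i _; apply: IH => //.
  apply: weight_le_mono (xN_coef_weight char_k N_gt0 rhoP i.+1 fP fw).
  by rewrite subSS leq_subr.
exists (f :: s); last exact: in_span_head.
split=> // -[//|i] _; have [ni|/sD//] := leqP n i.
by apply: in_span_ext (in_span0 s) => x; rewrite D_eq0 // leqW.
Qed.

(** Concatenate and prune the families of [polyfun_triangular]. Freeness
is what will turn a nonzero row of coefficients into a nonzero function. *)
Theorem adapted_basis n (F : nat -> V -> k) : (forall i, polyfun (F i)) ->
  exists r (y : 'I_r -> V -> k) (U : nat -> 'M[k]_r) m,
  [/\ [/\ forall j, polyfun (y j), (0 < m)%N, U 0%N = 1%:M &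
      forall i (j l : 'I_r), (0 < i)%N -> (l <= j)%N -> U i j l = 0],
    forall t x j, y j (Log (GN_mul (xN N t) (Exp x))) =
      \sum_(i < m) t ^+ i * \sum_l U i j l * y l x,
    forall c : 'rV[k]_r, (forall x, \sum_j c 0 j * y j x = 0) -> c = 0
  & forall i, (i < n)%N -> exists c : 'I_r -> k, forall x, F i x = \sum_j c j * y j x].
Proof.
move=> FP; have [s0 ts0 s0F] : exists2 s, triangular (@xN_coef k N) (@polyfun k V) s &
    forall i, (i < n)%N -> in_span s (F i).
  apply: triangular_gather => i _; have [w fw] := polyfun_weight (FP i).
  exact: polyfun_triangular fw.
have [s [ts fs ss]] := triangular_prune ts0.
pose r := size s; pose y (j : 'I_r) := nth (fun=> 0) s j.
have yP j : polyfun (y j) by case: (triangular_nth ts (ltn_ord j)).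
have [U0 U0P] : {U0 : nat * 'I_r -> nat -> k & forall ij : nat * 'I_r, (0 < ij.1)%N ->
   (forall l, (l <= ij.2)%N -> U0 ij l = 0) /\
   forall x, xN_coef ij.1 (y ij.2) x = \sum_(l < r) U0 ij l * y l x}.
  apply: (choice (P := fun (ij : nat * 'I_r) (c : nat -> k) => (0 < ij.1)%N ->
   (forall l, (l <= ij.2)%N -> c l = 0) /\
   forall x, xN_coef ij.1 (y ij.2) x = \sum_(l < r) c l * y l x)) => -[i j] /=.
  case: (posnP i) => [->|i0]; first by exists (fun=> 0).
  by have [_ /(_ i i0)[c cP]] := triangular_nth ts (ltn_ord j); exists c.
have [m0 m0P] : {m0 : 'I_r -> nat & forall j m t x, (m0 j <= m)%N ->
    y j (Log (GN_mul (xN N t) (Exp x))) = \sum_(i < m) t ^+ i * xN_coef i (y j) x}.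
  apply: (choice (P := fun j m0 => forall m t x, (m0 <= m)%N ->
    y j (Log (GN_mul (xN N t) (Exp x))) = \sum_(i < m) t ^+ i * xN_coef i (y j) x)).
  by move=> j; have [_ _ [m [_ mE]]] := xN_coefP char_k N_gt0 rhoP (yP j); exists m.
pose U (i : nat) : 'M[k]_r := if i is 0 then 1%:M else \matrix_(j, l) U0 (i, j) l.
exists r, y, U, (\sum_j m0 j).+1; split.
- split=> // -[//|i] j l _ lj; rewrite mxE.
  by case: (U0P (i.+1, j) isT) => ->.
- move=> t x j; rewrite (m0P j (\sum_j m0 j).+1); last first.
    by rewrite (bigD1 j) //= leqW // leq_addr.
  apply: eq_bigr => i _; congr (_ * _).
  case: {i}(nat_of_ord i) => [|i] /=.
    have [_ -> _] := xN_coefP char_k N_gt0 rhoP (yP j).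
    rewrite (bigD1 j) //= mxE eqxx mul1r big1 ?addr0 // => l lj.
    by rewrite mxE eq_sym (negPf lj) mul0r.
  have [_ ->] := U0P (i.+1, j) isT.
  by apply: eq_bigr => l _; rewrite mxE.
- move=> c c0; apply/rowP => j; rewrite mxE.
  have := fun_free_coef (c := fun l => if (insub l : option 'I_r) is Some l' then c 0 l' else 0) fs.
  move=> /(_ _ j (ltn_ord j)); rewrite valK; apply=> x.
  by rewrite -[RHS](c0 x); apply: eq_bigr => l _; rewrite valK.
- move=> i /s0F /ss /in_spanP[c cE]; exists (fun j : 'I_r => c j) => x.
  exact: cE.
Qed.

(** A row killed by all the [U_i], [i > 0], gives a function
invariant under left translation by [xN], so [invariant_const] applies. *)
Lemma fixed_combination_const r (y : 'I_r -> V -> k) (U : nat -> 'M[k]_r) m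
    (c : 'rV[k]_r) : (forall j, polyfun (y j)) -> (0 < m)%N -> U 0%N = 1%:M ->
    (forall t x j, y j (Log (GN_mul (xN N t) (Exp x))) =
      \sum_(i < m) t ^+ i * \sum_l U i j l * y l x) ->
    (forall i, (0 < i < m)%N -> c *m U i = 0) ->
  forall x, \sum_j c 0 j * y j x = \sum_j c 0 j * y j 0.
Proof.
move=> yP m0 U0 yE cU; apply: (invariant_const char_k N_gt0 rhoP).
  by apply: polyfun_sum => j _; exact: polyfunZ.
move=> t x; under eq_bigr => j _ do rewrite yE mulr_sumr.
rewrite exchange_big /=.
transitivity (\sum_(i < m) t ^+ i * \sum_l (c *m U i) 0 l * y l x).
  apply: eq_bigr => i _; under eq_bigr => j _ do rewrite mulrCA.
  rewrite -mulr_sumr; congr (_ * _).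
  under eq_bigr => j _ do rewrite mulr_sumr.
  rewrite exchange_big; apply: eq_bigr => l _ /=.
  by rewrite mxE mulr_suml; apply: eq_bigr => j _; rewrite mulrA.
case: m m0 cU {yE} => // m _ cU; rewrite big_ord_recl expr0 mul1r U0 mulmx1.
rewrite [X in _ + X]big1 ?addr0 // => i _.
have -> : c *m U (lift ord0 i) = 0 by apply: cU; rewrite /= ltnS ltn_ord.
by rewrite big1 ?mulr0 // => l _; rewrite mxE mul0r.
Qed.
End AdaptedBasis.

(** * Sequences of values of polynomial functions along PhiN *)

Section RegularSequences.
Variables (k : closedFieldType) (char_k : [pchar k] =i pred0).

Fact Seq_of_ks_rmorphism :
  {f : {rmorphism ks k -> Seq k} | forall a, f a = Seq_of_ks a}.
Proof.
pose F : {rmorphism ks k -> Seq k} := HB.pack (@Seq_of_ks k)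
    (GRing.isZmodMorphism.Build _ _ _ (Seq_of_ks_zmod char_k))
    (GRing.isMonoidMorphism.Build _ _ _ (Seq_of_ks_monoid char_k)).
by exists F.
Qed.

(** [Seq_of_ks] packed as a ring morphism. That it is one needs
characteristic 0, so it cannot be registered once and for all. *)
Definition ks_seq : {rmorphism ks k -> Seq k} := sval Seq_of_ks_rmorphism.

Lemma ks_seqE a : ks_seq a = Seq_of_ks a.
Proof. exact: (svalP Seq_of_ks_rmorphism). Qed.

Lemma ks_seq_const c : ks_seq (ks_const c) = germ (fun=> c).
Proof. by rewrite ks_seqE Seq_of_ks_const. Qed.

Lemma ks_seq_s : ks_seq (ks_s k) = germ (fun M => M%:R).
Proof. by rewrite ks_seqE Seq_of_ks_poly //; apply/germP; exists 0%N => n _; rewrite hornerX. Qed.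

Lemma ks_seqV (a : ks k) (u : nat -> k) : a != 0 ->
  ks_seq a = germ u -> ks_seq a^-1 = germ (fun M => (u M)^-1).
Proof.
move=> a0 aE; have a1 : ks_seq a * ks_seq a^-1 = 1 by rewrite -rmorphM mulfV // rmorph1.
elim/germ_ind: (ks_seq a^-1) a1 => v; rewrite aE germM -germ1 => /germP[n0 uv].
apply/germP; exists n0 => n /uv uv1.
have un0 : u n != 0 by apply/eqP => e; move/eqP: uv1; rewrite e mul0r eq_sym oner_eq0.
by apply: (mulfI un0); rewrite uv1 mulfV.
Qed.

Lemma ks_seqX (a : ks k) (u : nat -> k) i :
  ks_seq a = germ u -> ks_seq (a ^+ i) = germ (fun M => u M ^+ i).
Proof.
move=> aE; elim: i => [|i IH]; first by rewrite expr0 rmorph1 -germ1.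
by rewrite exprS rmorphM IH aE germM; congr germ; apply/funext => M; rewrite exprS.
Qed.

Lemma ks_s1_neq0 : ks_s k + 1 != 0.
Proof.
have -> : ks_s k + 1 = ks_poly ('X + 1) by rewrite /ks_s /ks_poly rmorphD rmorph1.
by rewrite tofrac_eq0 -size_poly_gt0 size_XaddC.
Qed.

Lemma ks_s_neq0 : ks_s k != 0.
Proof. by rewrite tofrac_eq0 polyX_eq0. Qed.

Lemma ks_seq_sV i : ks_seq ((ks_s k)^-1 ^+ i) = germ (fun M => M%:R^-1 ^+ i).
Proof. by apply: ks_seqX; apply: ks_seqV ks_s_neq0 _; exact: ks_seq_s. Qed.

Lemma ks_seq_s1V i : ks_seq ((ks_s k + 1)^-1 ^+ i) = germ (fun M => M.+1%:R^-1 ^+ i).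
Proof.
apply: ks_seqX; apply: ks_seqV ks_s1_neq0 _.
rewrite rmorphD rmorph1 ks_seq_s -germ1 germD; congr germ; apply/funext => M.
by rewrite natr1.
Qed.

Variables (N d : nat) (N_gt0 : (0 < N)%N).
Variables (rho : GN k N -> 'M[k]_d) (rhoP : faithful_rep rho).
Local Notation V := (free_le k N).
Local Notation one := (GN_one k N).

(** The right factor [g] is kept as a variable, because the automorphisms of
the Picard-Vessiot ring act through it. *)
Definition Phi_germ (g : GN k N) (f : V -> k) : Seq k :=
  germ (fun M => f (Log (GN_mul (PhiN k N M) g))).

(** [Psi g] is the value at [Phi g] of an element of [k(s)] tensored with the
coordinate ring of the group, the same for all [g]. *)
Definition regular (Psi : GN k N -> Seq k) : Prop :=
  exists n (a : nat -> ks k) (F : nat -> V -> k), (forall i, polyfun (F i)) /\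
    forall g, Psi g = \sum_(i < n) ks_seq (a i) * Phi_germ g (F i).

Lemma regular_ext Psi Psi' : (forall g, Psi g = Psi' g) -> regular Psi -> regular Psi'.
Proof. by move=> /funext->. Qed.

Lemma regular_term a f : polyfun f -> regular (fun g => ks_seq a * Phi_germ g f).
Proof.
by move=> fP; exists 1%N, (fun=> a), (fun=> f); split=> // g; rewrite big_ord1.
Qed.

Lemma regular_Phi_germ f : polyfun f -> regular (Phi_germ^~ f).
Proof.
by move=> /(regular_term 1); apply: regular_ext => g; rewrite rmorph1 mul1r.
Qed.

Lemma regular_cst a : regular (fun=> ks_seq a).
Proof.
apply: regular_ext (regular_term a (polyfun_cst _ 1)) => g.
by rewrite /Phi_germ germ1 mulr1.
Qed.

Lemma regularD Psi Psi' : regular Psi -> regular Psi' ->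
  regular (fun g => Psi g + Psi' g).
Proof.
move=> [m [a [F [FP E]]]] [n [b [G [GP E']]]].
exists (m + n)%N, (fun i => if (i < m)%N then a i else b (i - m)%N),
  (fun i => if (i < m)%N then F i else G (i - m)%N).
split=> [i|g]; first by case: ifP.
rewrite big_split_ord E E'; congr (_ + _); apply: eq_bigr => i _ /=.
  by rewrite ltn_ord.
by rewrite ltnNge leq_addr /= addKn.
Qed.

Lemma regular_sum n (Psi : nat -> GN k N -> Seq k) : (forall i, regular (Psi i)) ->
  regular (fun g => \sum_(i < n) Psi i g).
Proof.
move=> PsiP; elim: n => [|n IH].
  by apply: regular_ext (regular_cst 0) => g; rewrite big_ord0 rmorph0.
by apply: regular_ext (regularD IH (PsiP n)) => g; rewrite big_ord_recr.
Qed.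

Lemma Phi_germM g f h : Phi_germ g f * Phi_germ g h = Phi_germ g (fun x => f x * h x).
Proof. exact: germM. Qed.

Lemma regularM Psi Psi' : regular Psi -> regular Psi' ->
  regular (fun g => Psi g * Psi' g).
Proof.
move=> [m [a [F [FP E]]]] [n [b [G [GP E']]]].
apply: (@regular_ext (fun g => \sum_(i < m) \sum_(j < n)
    ks_seq (a i * b j) * Phi_germ g (fun x => F i x * G j x))).
  move=> g; rewrite E E' mulr_suml; apply: eq_bigr => i _; rewrite mulr_sumr.
  by apply: eq_bigr => j _; rewrite -Phi_germM rmorphM mulrACA.
apply: (@regular_sum _ (fun i g => \sum_(j < n)
    ks_seq (a i * b j) * Phi_germ g (fun x => F i x * G j x))) => i.
apply: (@regular_sum _ (fun j g => ks_seq (a i * b j) * Phi_germ g (fun x => F i x * G j x))).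
by move=> j; apply: regular_term; exact: polyfun_mul.
Qed.

Lemma regularB Psi Psi' : regular Psi -> regular Psi' ->
  regular (fun g => Psi g - Psi' g).
Proof.
move=> P /(regularM (regular_cst (-1))) P'.
by apply: regular_ext (regularD P P') => g; rewrite rmorphN1 mulN1r.
Qed.

Lemma Phi_germ_right g h f :
  Phi_germ (GN_mul g h) f = Phi_germ g (fun x => f (Log (GN_mul (Exp x) h))).
Proof.
apply/germP; exists 0%N => M _.
rewrite (GN_mulA rhoP (PhiN k N M) g h).
by case: (GN_mul (PhiN k N M) g).
Qed.

Lemma regular_right h Psi : regular Psi -> regular (fun g => Psi (GN_mul g h)).
Proof.
move=> [n [a [F [FP E]]]].
exists n, a, (fun i (x : V) => F i (Log (GN_mul (Exp x) h))).
split=> [i|g]; first exact: (polyfun_mul_right char_k N_gt0 rhoP).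
by rewrite E; apply: eq_bigr => i _; rewrite Phi_germ_right.
Qed.

(** The common pattern of the shift, where the curve is the logarithm
of [xN] and [a = 1 / (s + 1)], and of its inverse, where the curve is the
opposite one and [a = 1 / s]. *)
Lemma Phi_germ_translate c (C : nat -> V -> k) f n (u : nat -> k) (a : ks k) g
    (Phi' : nat -> GN k N) :
    (forall t x, f (Log (GN_mul (Exp (c t)) (Exp x))) = \sum_(i < n) t ^+ i * C i x) ->
    (forall i, ks_seq (a ^+ i) = germ (fun M => u M ^+ i)) ->
    (exists M0, forall M, (M0 <= M)%N ->
       Phi' M = GN_mul (Exp (c (u M))) (PhiN k N M)) ->
  germ (fun M => f (Log (GN_mul (Phi' M) g))) =
    \sum_(i < n) ks_seq (a ^+ i) * Phi_germ g (C i).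
Proof.
move=> fE aE [M0 PhiE].
under eq_bigr => i _ do rewrite aE germM.
rewrite germ_sum; apply/germP; exists M0 => M /PhiE->.
rewrite -(GN_mulA rhoP); case: (GN_mul (PhiN k N M) g) => x /=.
exact: fE.
Qed.

Lemma Phi_germ_shift f g m (C : nat -> V -> k) :
    (forall t x, f (Log (GN_mul (xN N t) (Exp x))) = \sum_(i < m) t ^+ i * C i x) ->
  Seq_shift (Phi_germ g f) =
    \sum_(i < m) ks_seq ((ks_s k + 1)^-1 ^+ i) * Phi_germ g (C i).
Proof.
move=> fE; rewrite /Phi_germ Seq_shift_germ.
apply: (@Phi_germ_translate (fun t => Log (xN N t : GN k N)) C f m
  (fun M => M.+1%:R^-1) ((ks_s k + 1)^-1) g (fun M => PhiN k N M.+1) fE ks_seq_s1V).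
by exists 0%N.
Qed.

Lemma regular_shift Psi : regular Psi -> regular (fun g => Seq_shift (Psi g)).
Proof.
move=> [n [a [F [FP E]]]].
apply: (@regular_ext (fun g => \sum_(i < n) ks_seq (ks_shift (a i)) * Seq_shift (Phi_germ g (F i)))).
  move=> g; rewrite E rmorph_sum; apply: eq_bigr => i _.
  by rewrite [in RHS]rmorphM /= ?ks_seqE Seq_of_ks_shift.
apply: (@regular_sum _ (fun i g => ks_seq (ks_shift (a i)) * Seq_shift (Phi_germ g (F i)))) => i.
apply: regularM; first exact: regular_cst.
have [DP _ [m [_ mE]]] := xN_coefP char_k N_gt0 rhoP (FP i).
apply: (@regular_ext (fun g => \sum_(j < m) ks_seq ((ks_s k + 1)^-1 ^+ j) * Phi_germ g (xN_coef j (F i)))).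
  by move=> g; rewrite (@Phi_germ_shift _ _ m (fun j => xN_coef j (F i))) // => t x; exact: mE.
apply: (@regular_sum _ (fun j g => ks_seq ((ks_s k + 1)^-1 ^+ j) * Phi_germ g (xN_coef j (F i)))) => j.
exact: regular_term.
Qed.

Lemma regular_unshift Psi : regular Psi -> regular (fun g => Seq_unshift (Psi g)).
Proof.
move=> [n [a [F [FP E]]]].
have [b bE] : {b : nat -> ks k & forall i, ks_shift (b i) = a i}.
  apply: (choice (P := fun i b => ks_shift b = a i)) => i.
  by have [h _ hK] := ks_shift_bij k; exists (h (a i)).
apply: (@regular_ext (fun g => \sum_(i < n) ks_seq (b i) *
    germ (fun M => F i (Log (GN_mul (PhiN k N M.-1) g))))).
  move=> g; apply: (can_inj (@Seq_shiftK k)); rewrite Seq_unshiftK E rmorph_sum.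
  apply: eq_bigr => i _; rewrite rmorphM /= Seq_shift_germ; congr (_ * _).
  by rewrite ?ks_seqE -Seq_of_ks_shift // bE.
apply: (@regular_sum _ (fun i g => ks_seq (b i) *
    germ (fun M => F i (Log (GN_mul (PhiN k N M.-1) g))))) => i.
apply: regularM; first exact: regular_cst.
have cP : poly_curve (fun t => - Log (xN N t : GN k N)).
  move=> l; have [p pE] := xN_curve l; exists (- p) => t.
  by rewrite hornerN pE linearN.
have [q [qP [m qm] qE]] := poly_family_mul_left char_k N_gt0 rhoP cP (FP i).
apply: (@regular_ext (fun g => \sum_(j < m) ks_seq ((ks_s k)^-1 ^+ j) * Phi_germ g (fun x => (q x)`_j))).
  move=> g; apply/esym; apply: (@Phi_germ_translate (fun t => - Log (xN N t : GN k N))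
    (fun j x => (q x)`_j) (F i) m (fun M => M%:R^-1) (ks_s k)^-1 g
    (fun M => PhiN k N M.-1)) => [t x|j|].
  - rewrite -qE (horner_coef_wide _ (qm x)).
    by apply: eq_bigr => j _; rewrite mulrC.
  - exact: ks_seq_sV.
  exists 1%N => -[//|M] _ /=; rewrite (GN_mulA rhoP).
  have -> : GN_mul (Exp (- Log (xN N M.+1%:R^-1 : GN k N))) (xN N M.+1%:R^-1) = one.
    exact: (GN_mulVr N_gt0).
  by rewrite (GN_mul1 rhoP).
apply: (@regular_sum _ (fun j g => ks_seq ((ks_s k)^-1 ^+ j) * Phi_germ g (fun x => (q x)`_j))) => j.
exact: regular_term.
Qed.

(** Expand [Psi] on an adapted basis. The rows of rational functions whose
value along [Phi] lies in [J] form a space to which [stable_space_const]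
applies; the constant row that it provides defines an invariant function, hence
a nonzero constant in [J]. *)
Theorem regular_stable (J : set (Seq k)) Psi :
    J 0 -> (forall x y, J x -> J y -> J (x + y)) ->
    (forall a x, J x -> J (ks_seq a * x)) -> (forall x, J x -> J (Seq_shift x)) ->
    regular Psi -> J (Psi one) ->
  (forall g, Psi g = 0) \/ J 1.
Proof.
move=> J0 JD JZ JS [n [a [F [FP E]]]] JPsi.
have [r [y [U [m [[yP m0 U0 Utri] yE yfree Fy]]]]] :=
  adapted_basis char_k N_gt0 rhoP n FP.
have [c cE] : {c : nat -> 'I_r -> k & forall i, (i < n)%N ->
    forall x, F i x = \sum_j c i j * y j x}.
  apply: (choice (P := fun i (c : 'I_r -> k) => (i < n)%N ->
    forall x, F i x = \sum_j c j * y j x)) => i.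
  by case: (ltnP i n) => [/Fy[c cE]|_]; [exists c|exists (fun=> 0)].
pose vec (b : 'rV[ks k]_r) g := \sum_j ks_seq (b 0 j) * Phi_germ g (y j).
pose b : 'rV[ks k]_r := \row_j \sum_(i < n) a i * ks_const (c i j).
have PsiE g : Psi g = vec b g.
  rewrite E /vec; under [RHS]eq_bigr => j _ do rewrite mxE rmorph_sum mulr_suml.
  rewrite exchange_big; apply: eq_bigr => i _ /=.
  under eq_bigr => j _ do rewrite rmorphM -mulrA.
  rewrite -mulr_sumr; congr (_ * _).
  under eq_bigr => j _ do rewrite ks_seq_const germM.
  rewrite germ_sum; congr germ; apply/funext => M; exact: cE.
have [b0|bn0] := eqVneq b 0.
  left=> g; rewrite PsiE /vec big1 // => j _.
  by rewrite b0 mxE rmorph0 mul0r.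
right; pose J' : set 'rV[ks k]_r := [set e | J (vec e one)].
have J'lin : submodule J'.
  split=> [|x u v Ju Jv]; rewrite /J' /=.
    by rewrite /vec big1 // => j _; rewrite mxE rmorph0 mul0r.
  have -> : vec (x *: u + v) one = ks_seq x * vec u one + vec v one.
    rewrite /vec mulr_sumr -big_split; apply: eq_bigr => j _ /=.
    by rewrite !mxE rmorphD rmorphM mulrDl mulrA.
  exact/JD/Jv/JZ.
have J'S e : J' e -> J' (map_mx (@ks_shift k) e *m triangular_mx m U).
  rewrite /J' /= => /JS; suff -> : Seq_shift (vec e one) =
    vec (map_mx (@ks_shift k) e *m triangular_mx m U) one by [].
  rewrite /vec rmorph_sum /=.
  transitivity (\sum_j \sum_(i < m) \sum_l ks_seq (ks_shift (e 0 j) *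
      ((ks_s k + 1)^-1 ^+ i * ks_const (U i j l))) * Phi_germ one (y l)).
    apply: eq_bigr => j _; rewrite [in LHS]rmorphM /= ?ks_seqE -Seq_of_ks_shift // -?ks_seqE.
    rewrite (@Phi_germ_shift (y j) one m (fun i x => \sum_l U i j l * y l x)
      (fun t x => yE t x j)).
    rewrite mulr_sumr; apply: eq_bigr => i _.
    move: (ks_shift (e 0 j)) => S.
    under [RHS]eq_bigr => l _ do rewrite !rmorphM -!mulrA.
    rewrite -!mulr_sumr; congr (_ * (_ * _)).
    under [RHS]eq_bigr => l _ do rewrite ks_seq_const germM.
    by rewrite germ_sum.
  rewrite (eq_bigr _ (fun j _ => exchange_big _ _ _ _ _ _)) exchange_big /=.
  apply: eq_bigr => l _.
  under eq_bigr => j _ do rewrite -mulr_suml -rmorph_sum -mulr_sumr.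
  rewrite -mulr_suml -rmorph_sum; congr (ks_seq _ * _).
  rewrite mxE; apply: eq_bigr => j _; rewrite mxE; congr (_ * _).
  rewrite /triangular_mx summxE; apply: eq_bigr => i _.
  by rewrite !mxE.
have J'b : J' b by rewrite /J' /= -PsiE.
have [e [e0 Je eU]] := stable_space_const char_k m0 U0 Utri J'lin J'S
  (ex_intro2 _ _ b J'b bn0).
have e_const := fixed_combination_const char_k N_gt0 rhoP yP m0 U0 yE eU.
set q := \sum_j e 0 j * y j 0 in e_const.
have q0 : q != 0.
  by apply: contra_neq e0 => q0; apply: yfree => x; rewrite e_const.
have vecE : vec (map_mx (@ks_const k) e) one = ks_seq (ks_const q).
  rewrite /vec; under eq_bigr => j _ do rewrite mxE ks_seq_const germM.
  by rewrite germ_sum ks_seq_const; congr germ; apply/funext => M; rewrite e_const.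
move: Je; rewrite /J' /= vecE => /(JZ (ks_const q^-1)).
by rewrite -rmorphM -(rmorphM (@ks_const k)) mulVf // !rmorph1.
Qed.

(** The entries of [rho(Phi)] satisfy no algebraic relation over [k(s)]
besides those satisfied on the whole group. *)
Lemma regular_rigid Psi : regular Psi -> Psi one = 0 -> forall g, Psi g = 0.
Proof.
move=> PsiP Psi0.
have [//|/eqP] : (forall g, Psi g = 0) \/ [set (0 : Seq k)] 1; last first.
  by rewrite oner_eq0.
apply: regular_stable PsiP Psi0 => [//|x y -> ->|a x ->|x ->].
- by rewrite /= addr0.
- by rewrite /= mulr0.
- by rewrite /= rmorph0.
Qed.

Lemma regular_eq Psi Psi' : regular Psi -> regular Psi' -> Psi one = Psi' one ->
  forall g, Psi g = Psi' g.
Proof.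
move=> P P' e g; apply: subr0_eq; apply: (regular_rigid (regularB P P')).
by rewrite e subrr.
Qed.

End RegularSequences.

(** * The Picard-Vessiot ring and its automorphisms Theta *)

Section PicardVessiotRing.
Variables (k : closedFieldType) (char_k : [pchar k] =i pred0).
Variables (N d : nat) (N_gt0 : (0 < N)%N).
Variables (rho : GN k N -> 'M[k]_d) (rhoP : faithful_rep rho).
Local Notation V := (free_le k N).
Local Notation one := (GN_one k N).
Local Notation ks_seq := (ks_seq char_k).
Local Notation regular := (@regular k char_k N).
Local Notation PV := (PV_ring rho).
Local Notation base := (PV_base rho).
Local Notation Y := (PV_sol rho).

Let rhoM g h : rho (GN_mul g h) = rho g *m rho h. Proof. by case: rhoP => -[]. Qed.
Let rho_poly i j : polyfun (fun x => rho (Exp x) i j).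
Proof. by case: rhoP => -[]. Qed.

Lemma PV_valB (x y : PV) : val (x - y) = val x - val y. Proof. exact: rmorphB. Qed.
Lemma PV_valD (x y : PV) : val (x + y) = val x + val y. Proof. exact: rmorphD. Qed.
Lemma PV_valM (x y : PV) : val (x * y) = val x * val y. Proof. exact: rmorphM. Qed.
Lemma PV_val1 : val (1 : PV) = 1. Proof. exact: rmorph1. Qed.
Lemma PV_val0 : val (0 : PV) = 0. Proof. exact: rmorph0. Qed.
Lemma PV_val_sum I (r : seq I) (F : I -> PV) :
  val (\sum_(i <- r) F i) = \sum_(i <- r) val (F i).
Proof. exact: rmorph_sum. Qed.

Lemma PV_val_base a : val (base a) = ks_seq a. Proof. by rewrite ks_seqE. Qed.

Lemma PV_val_sol i j : val (Y i j) = Phi_germ one (fun x => rho (Exp x) i j).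
Proof.
rewrite mxE /= /sol_entry /Phi_germ; congr germ; apply/funext => M.
by rewrite (GN_mulr1 rhoP); case: (PhiN k N M).
Qed.

Lemma mem_base a : ks_seq a \in in_subring_gen (PV_generators rho).
Proof. by rewrite -PV_val_base; exact: valP. Qed.

(** By [polyfun_factor] the values of polynomial functions along [Phi] are
polynomials in the entries of the fundamental matrix. *)
Lemma mem_Phi_germ (f : V -> k) : polyfun f -> Phi_germ one f \in in_subring_gen (PV_generators rho).
Proof.
move=> /(polyfun_factor char_k N_gt0 rhoP)[p pP pE].
have evE (q : 'M[k]_d -> k) : Phi_germ one (fun x => q (rho (Exp x))) =
    germ (fun M => q (rho (PhiN k N M))).
  congr germ; apply/funext => M; rewrite (GN_mulr1 rhoP).
  by case: (PhiN k N M).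
have -> : Phi_germ one f = germ (fun M => p (rho (PhiN k N M))).
  by rewrite -evE; congr germ; apply/funext => M; rewrite pE.
elim: {pE} pP => [c|l|g h _ IHg _ IHh|g h _ IHg _ IHh].
- by rewrite -(ks_seq_const char_k); exact: mem_base.
- have -> : @germ k (fun M => l (rho (PhiN k N M))) =
      \sum_i \sum_j val (Y i j) * ks_seq (ks_const (l (delta_mx i j))).
    transitivity (\sum_i \sum_j germ (fun M => rho (PhiN k N M) i j * l (delta_mx i j))).
      rewrite (eq_bigr _ (fun i _ => germ_sum _ _ _)) germ_sum.
      by apply/germP; exists 0%N => M _; rewrite linear_entries.
    apply: eq_bigr => i _; apply: eq_bigr => j _.
    by rewrite ks_seq_const PV_val_sol (evE (fun C => C i j)) germM.
  apply: rpred_sum => i _; apply: rpred_sum => j _.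
  by apply: rpredM; [exact: valP|exact: mem_base].
- by rewrite -germD; exact: rpredD.
- by rewrite -germM; exact: rpredM.
Qed.

Lemma mem_regular Psi g : regular Psi -> Psi g \in in_subring_gen (PV_generators rho).
Proof.
move=> /(regular_right N_gt0 rhoP g)[n [a [F [FP /(_ one)]]]].
rewrite (GN_mul1 rhoP) => ->; apply: rpred_sum => i _.
by apply: rpredM; [exact: mem_base|exact: mem_Phi_germ].
Qed.

Definition PV_of_regular Psi (PsiP : regular Psi) g : PV := exist _ (Psi g) (mem_regular g PsiP).

(** Immediate from the definition of the ring; used as its induction
principle. *)
Lemma PV_generated (B : set PV) : is_subring B -> (forall a, B (base a)) ->
  (forall i j, B (Y i j)) -> forall x, B x.
Proof.
move=> [B1 BB BM] Bbase BY x.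
pose B' := [set y : Seq k | exists2 z, B z & val z = y].
suff : B' (val x) by move=> [z Bz /val_inj <-].
have /asboolP := valP x; apply; split.
  split=> [|_ _ [z Bz <-] [w Bw <-]|_ _ [z Bz <-] [w Bw <-]].
  - by exists 1; rewrite ?PV_val1.
  - by exists (z - w); [exact: BB|rewrite PV_valB].
  - by exists (z * w); [exact: BM|rewrite PV_valM].
move=> _ [[a _ <-]|[i [j ->]]]; first by exists (base a).
by exists (Y i j) => //; rewrite mxE.
Qed.

Lemma PV_regular (x : PV) : exists Psi, regular Psi /\ Psi one = val x.
Proof.
move: x; apply: PV_generated.
- split=> [|x y [P [PP P1]] [Q [QP Q1]]|x y [P [PP P1]] [Q [QP Q1]]].
  + exists (fun=> ks_seq 1); split; first exact: regular_cst.
    by rewrite rmorph1 PV_val1.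
  + by exists (fun g => P g - Q g); rewrite PV_valB -P1 -Q1; split; [exact: regularB|].
  + by exists (fun g => P g * Q g); rewrite PV_valM -P1 -Q1; split; [exact: regularM|].
- move=> a; exists (fun=> ks_seq a); split; first exact: regular_cst.
  by rewrite PV_val_base.
- move=> i j; exists (fun g => Phi_germ g (fun x => rho (Exp x) i j)).
  by split; [exact: regular_Phi_germ|rewrite PV_val_sol].
Qed.

(** The automorphism [F(Phi) |-> F(Phi g)], defined through an arbitrary choice
of [F]; [ThetaE] shows that the choice does not matter. *)
Definition Theta (g : GN k N) (x : PV) : PV := insubd x (projT1 (cid (PV_regular x)) g).

Lemma ThetaE g (x : PV) Psi : regular Psi -> Psi one = val x -> val (Theta g x) = Psi g.
Proof.
move=> PsiP Psi1; rewrite /Theta; case: cid => Q /= [QP Q1].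
rewrite val_insubd; have -> : in_subring_gen (PV_generators rho) (Q g).
  exact: mem_regular.
by apply: (regular_eq N_gt0 rhoP) => //; rewrite Psi1.
Qed.

Lemma PV_shiftE : shift_stable rho.
Proof.
move=> x; rewrite /PV_shift val_insubd.
have [Psi [PsiP <-]] := PV_regular x.
have -> // : in_subring_gen (PV_generators rho) (Seq_shift (Psi one)).
exact: mem_regular (regular_shift N_gt0 rhoP PsiP).
Qed.

Lemma Theta_zmod g : zmod_morphism (Theta g).
Proof.
move=> x y; apply: val_inj; rewrite PV_valB.
have [P [PP P1]] := PV_regular x; have [Q [QP Q1]] := PV_regular y.
rewrite (ThetaE g PP P1) (ThetaE g QP Q1).
by rewrite (ThetaE g (regularB PP QP)) // PV_valB P1 Q1.
Qed.

Lemma Theta_monoid g : monoid_morphism (Theta g).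
Proof.
split=> [|x y]; apply: val_inj.
  rewrite (ThetaE g (regular_cst char_k _ 1)) ?rmorph1 ?PV_val1 //.
rewrite PV_valM; have [P [PP P1]] := PV_regular x; have [Q [QP Q1]] := PV_regular y.
rewrite (ThetaE g PP P1) (ThetaE g QP Q1).
by rewrite (ThetaE g (regularM PP QP)) // PV_valM P1 Q1.
Qed.

Lemma Theta_base g a : Theta g (base a) = base a.
Proof.
by apply: val_inj; rewrite (ThetaE g (regular_cst char_k _ a)) PV_val_base.
Qed.

Lemma Theta_shift g x : Theta g (PV_shift rho x) = PV_shift rho (Theta g x).
Proof.
apply: val_inj; rewrite PV_shiftE; have [P [PP P1]] := PV_regular x.
rewrite (ThetaE g PP P1) (ThetaE g (regular_shift N_gt0 rhoP PP)) //.
by rewrite PV_shiftE P1.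
Qed.

(** The order of the factors is kept, since right multiplication by [h] is
applied inside the function to which [Theta g] is then applied. *)
Lemma Theta_mul g h x : Theta (GN_mul g h) x = Theta g (Theta h x).
Proof.
apply: val_inj; have [P [PP P1]] := PV_regular x.
rewrite (ThetaE _ PP P1) (ThetaE g (regular_right N_gt0 rhoP h PP)) //.
by rewrite (GN_mul1 rhoP) (ThetaE h PP P1).
Qed.

Lemma Theta_one x : Theta one x = x.
Proof.
by apply: val_inj; have [P [PP P1]] := PV_regular x; rewrite (ThetaE _ PP P1).
Qed.

Lemma Theta_sol g : map_mx (Theta g) Y = Y *m map_mx (fun c => base (ks_const c)) (rho g).
Proof.
apply/matrixP => i j; rewrite mxE [in RHS]mxE; apply: val_inj.
rewrite (ThetaE g (regular_Phi_germ char_k (rho_poly i j))) ?PV_val_sol // PV_val_sum.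
under eq_bigr => l _ do rewrite PV_valM PV_val_sol mxE PV_val_base ks_seq_const germM.
rewrite germ_sum; congr germ; apply/funext => M; rewrite (GN_mulr1 rhoP).
rewrite -[Exp _]/(GN_mul (PhiN k N M) g) rhoM mxE.
by case: (PhiN k N M).
Qed.

Lemma Theta_aut g : PV_group rho (Theta g).
Proof.
split.
- exact: Theta_zmod.
- exact: Theta_monoid.
- by exists (Theta (GN_inv g)) => x; rewrite -Theta_mul ?GN_mulV ?GN_mulVr ?Theta_one.
- exact: Theta_shift.
- exact: Theta_base.
Qed.

Lemma PV_shift_zmod : zmod_morphism (PV_shift rho).
Proof.
by move=> x y; apply: val_inj; rewrite PV_valB !PV_shiftE PV_valB; exact: Seq_shift_zmod.
Qed.

Lemma PV_shift_monoid : monoid_morphism (PV_shift rho).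
Proof.
split=> [|x y]; apply: val_inj; first by rewrite PV_shiftE PV_val1 rmorph1.
by rewrite PV_valM !PV_shiftE PV_valM rmorphM.
Qed.

Lemma PV_shift_bij : bijective (PV_shift rho).
Proof.
have unshift_mem (x : PV) : Seq_unshift (val x) \in in_subring_gen (PV_generators rho).
  have [Psi [PsiP <-]] := PV_regular x.
  exact: mem_regular (regular_unshift N_gt0 rhoP PsiP).
pose unshift (x : PV) : PV := exist _ (Seq_unshift (val x)) (unshift_mem x).
exists unshift => x; apply: val_inj.
  by rewrite /= PV_shiftE Seq_shiftK.
by rewrite PV_shiftE /= Seq_unshiftK.
Qed.

Lemma base_zmod : zmod_morphism base.
Proof. by move=> a b; apply: val_inj; rewrite PV_valB !PV_val_base rmorphB. Qed.

Lemma base_monoid : monoid_morphism base.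
Proof.
by split=> [|a b]; apply: val_inj; rewrite ?PV_val1 ?PV_valM !PV_val_base ?rmorph1 ?rmorphM.
Qed.

Lemma base_shift a : PV_shift rho (base a) = base (ks_shift a).
Proof. by apply: val_inj; rewrite PV_shiftE !PV_val_base !ks_seqE Seq_of_ks_shift. Qed.

Lemma PV_difference_extension :
  difference_extension (@ks_shift k) (PV_shift rho) base.
Proof.
split.
- by split; [exact: ks_shift_zmod|exact: ks_shift_monoid|exact: ks_shift_bij].
- by split; [exact: PV_shift_zmod|exact: PV_shift_monoid|exact: PV_shift_bij].
- exact: base_zmod.
- exact: base_monoid.
- exact: base_shift.
Qed.

Lemma PV_simple : sigma_simple (PV_shift rho).
Proof.
move=> J [J0 JD JM JS].
have [[x Jx xn0]|J_eq0] := pselect (exists2 x, J x & x <> 0); last first.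
  left; apply/seteqP; split=> [x Jx|x ->//].
  by apply: contrapT => xn0; apply: J_eq0; exists x.
right; pose J' := [set y : Seq k | exists2 z, J z & val z = y].
have [Psi [PsiP Psi1]] := PV_regular x.
have [Psi0|[z Jz z1]] : (forall g, Psi g = 0) \/ J' 1.
- apply: (regular_stable N_gt0 rhoP) PsiP _.
  + by exists 0; rewrite ?PV_val0.
  + by move=> _ _ [z Jz <-] [w Jw <-]; exists (z + w); [exact: JD|rewrite PV_valD].
  + move=> a _ [z Jz <-]; exists (base a * z); first exact: JM.
    by rewrite PV_valM PV_val_base.
  + by move=> _ [z Jz <-]; exists (PV_shift rho z); [exact: JS|rewrite PV_shiftE].
  + by exists x.
- by case: xn0; apply: val_inj; rewrite -Psi1 Psi0 PV_val0.
apply/seteqP; split=> // y _; rewrite -[y]mulr1.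
suff <- : z = 1 by exact: JM.
by apply: val_inj; rewrite z1 PV_val1.
Qed.

Lemma ks_seq_system_mx i j :
  ks_seq (system_mx rho i j) = germ (fun M => rho (xN N M.+1%:R^-1) i j).
Proof.
have [p pE] := polyfun_curve (@xN_curve k N) (rho_poly i j).
rewrite mxE (poly_of_funP char_k (p := p)) //.
rewrite (horner_coef_wide _ (size_poly _ _)) rmorph_sum.
under eq_bigr => l _ do rewrite rmorphM coef_map /= ks_seq_const ks_seq_s1V germM.
rewrite germ_sum; congr germ; apply/funext => M.
rewrite -[RHS]pE horner_coef /=; exact: eq_bigr.
Qed.

End PicardVessiotRing.

(** * The difference Galois group *)

Section GaloisGroup.
Variables (k : closedFieldType) (char_k : [pchar k] =i pred0).
Variables (N d : nat) (N_gt0 : (0 < N)%N).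
Variables (rho : GN k N -> 'M[k]_d) (rhoP : faithful_rep rho).
Local Notation V := (free_le k N).
Local Notation one := (GN_one k N).
Local Notation ks_seq := (ks_seq char_k).
Local Notation PV := (PV_ring rho).
Local Notation base := (PV_base rho).
Local Notation Y := (PV_sol rho).
Local Notation Phi := (PhiN k N).
Local Notation Theta := (Theta char_k rhoP).

Let rho1 : rho one = 1%:M. Proof. by case: rhoP => -[]. Qed.
Let rhoM g h : rho (GN_mul g h) = rho g *m rho h. Proof. by case: rhoP => -[]. Qed.
Let rho_poly i j : polyfun (fun x => rho (Exp x) i j).
Proof. by case: rhoP => -[]. Qed.
Let rho_inj : injective rho. Proof. by case: rhoP. Qed.

Lemma PV_val_solE i j : val (Y i j) = germ (fun M => rho (Phi M) i j).
Proof. by rewrite mxE. Qed.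

Lemma PV_equation : map_mx (PV_shift rho) Y = map_mx base (system_mx rho) *m Y.
Proof.
apply/matrixP => i j; rewrite mxE [in RHS]mxE; apply: val_inj.
rewrite (PV_shiftE char_k N_gt0 rhoP) PV_val_solE Seq_shift_germ PV_val_sum.
transitivity (\sum_l germ (fun M => rho (xN N M.+1%:R^-1) i l * rho (Phi M) l j)).
  rewrite germ_sum; apply/germP; exists 0%N => M _.
  by rewrite -[PhiN k N M.+1]/(GN_mul (xN N M.+1%:R^-1) (Phi M)) rhoM mxE.
apply: eq_bigr => l _; rewrite PV_valM PV_val_solE [map_mx _ _ _ _]mxE.
by rewrite (PV_val_base char_k) (ks_seq_system_mx char_k rhoP) germM.
Qed.

Fact rho_inv_poly i j : polyfun (fun x : V => rho (Exp (- x)) i j).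
Proof.
apply: (polyfun_comp_linear (phi := fun x : V => - x)) (rho_poly i j) => a x y.
by rewrite opprD scalerN.
Qed.

(** The values of [rho (g^-1)], which are polynomial in [g]. Having the
inverse matrix over the ring spares the computation of the determinant. *)
Definition PV_sol_inv : 'M[PV]_d := \matrix_(i, j)
  PV_of_regular N_gt0 rhoP (regular_Phi_germ char_k (rho_inv_poly i j)) one.

Lemma PV_val_sol_inv i j : val (PV_sol_inv i j) = germ (fun M => rho (GN_inv (Phi M)) i j).
Proof.
rewrite mxE; apply/germP; exists 0%N => M _.
by rewrite (GN_mulr1 rhoP (Phi M)).
Qed.

Lemma PV_sol_mulV : Y *m PV_sol_inv = 1%:M.
Proof.
apply/matrixP => i j; rewrite mxE; apply: val_inj; rewrite PV_val_sum.
under eq_bigr => l _ do rewrite PV_valM PV_val_solE PV_val_sol_inv germM.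
rewrite germ_sum; transitivity (@germ k (fun M => (1%:M : 'M[k]_d) i j)).
  apply/germP; exists 0%N => M _.
  by rewrite -rho1 -(GN_mulV N_gt0 (Phi M)) rhoM mxE.
by rewrite !mxE; case: (i == j); rewrite ?germ1 ?germ0 ?PV_val1 ?PV_val0.
Qed.

Lemma PV_sol_mulVr : PV_sol_inv *m Y = 1%:M.
Proof. exact: mulmx1C PV_sol_mulV. Qed.

Lemma PV_ring_picard_vessiot :
  picard_vessiot (@ks_shift k) (PV_shift rho) base (system_mx rho) Y.
Proof.
split.
- exact: (PV_difference_extension char_k N_gt0 rhoP).
- exact: (PV_simple char_k N_gt0 rhoP).
- exact: PV_equation.
exists (\det PV_sol_inv); first by rewrite -det_mulmx PV_sol_mulV det1.
apply/seteqP; split=> // x _; move: x; apply: PV_generated.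
- split=> [B [[]]//|x y Sx Sy B BP|x y Sx Sy B BP]; case: (BP) => -[B1 BB BM] _.
  + by apply: BB; [exact: Sx|exact: Sy].
  + by apply: BM; [exact: Sx|exact: Sy].
- by move=> a; apply: sub_subring_gen; left; left; exists a.
- by move=> i j; apply: sub_subring_gen; left; right; exists i, j.
Qed.

Definition cst_mx (C : 'M[k]_d) : 'M[PV]_d := map_mx (fun c => base (ks_const c)) C.

Lemma PV_val_cst (c : k) : val (base (ks_const c)) = germ (fun=> c).
Proof. by rewrite (PV_val_base char_k) ks_seq_const. Qed.

Lemma cst_mx_inj : injective cst_mx.
Proof.
move=> C D /matrixP CD; apply/matrixP => i j.
have := congr1 val (CD i j); rewrite !mxE !PV_val_cst => /germP[n0 /(_ n0 (leqnn _))].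
exact.
Qed.

Lemma sol_mul_inj (C D : 'M[PV]_d) : Y *m C = Y *m D -> C = D.
Proof.
by move=> /(congr1 (mulmx PV_sol_inv)); rewrite !mulmxA PV_sol_mulVr !mul1mx.
Qed.

Lemma Theta_inj : injective Theta.
Proof.
move=> g h gh; apply: rho_inj; apply: cst_mx_inj; apply: sol_mul_inj.
by rewrite -!(Theta_sol char_k N_gt0 rhoP) gh.
Qed.

Lemma PV_morphism_eq (f f' : PV -> PV) :
    zmod_morphism f -> monoid_morphism f -> zmod_morphism f' -> monoid_morphism f' ->
    (forall a, f (base a) = f' (base a)) -> (forall i j, f (Y i j) = f' (Y i j)) ->
  f = f'.
Proof.
move=> fB [f1 fM] f'B [f'1 f'M] fbase fY; apply/funext.
apply: (PV_generated (B := [set x | f x = f' x])) => //.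
split=> /= [|x y ex ey|x y ex ey]; first by rewrite f1 f'1.
- by rewrite fB f'B ex ey.
- by rewrite fM f'M ex ey.
Qed.

(** Both [Y] and its image by the automorphism solve the system, so they
differ by a right factor fixed by the shift. *)
Lemma PV_group_sol tau : PV_group rho tau -> exists C, map_mx tau Y = Y *m cst_mx C.
Proof.
move=> [tB tM _ tS tbase].
pose tauM : {rmorphism PV -> PV} := HB.pack tau
  (GRing.isZmodMorphism.Build _ _ _ tB) (GRing.isMonoidMorphism.Build _ _ _ tM).
pose sigM : {rmorphism PV -> PV} := HB.pack (PV_shift rho)
  (GRing.isZmodMorphism.Build _ _ _ (PV_shift_zmod char_k N_gt0 rhoP))
  (GRing.isMonoidMorphism.Build _ _ _ (PV_shift_monoid char_k N_gt0 rhoP)).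
pose C' := PV_sol_inv *m map_mx tauM Y.
have tY : map_mx tau Y = Y *m C' by rewrite mulmxA PV_sol_mulV mul1mx.
have sY : map_mx sigM Y = map_mx base (system_mx rho) *m Y := PV_equation.
(* [sigma Y * sigma C'] and [sigma Y * C'] are both the image of [tau Y]. *)
have sC : map_mx sigM C' = C'.
  have e : map_mx sigM Y *m map_mx sigM C' = map_mx sigM Y *m C'.
    rewrite -map_mxM -tY [in RHS]sY -mulmxA -tY.
    have -> : map_mx sigM (map_mx tau Y) = map_mx tauM (map_mx sigM Y).
      by apply/matrixP => i j; rewrite !mxE /= tS.
    rewrite sY map_mxM; congr (_ *m _).
    by apply/matrixP => i j; rewrite !mxE; exact: tbase.
  have := congr1 (mulmx (map_mx sigM PV_sol_inv)) e.
  by rewrite !mulmxA -map_mxM PV_sol_mulVr map_mx1 !mul1mx.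
have Ccst i j : exists c, C' i j = base (ks_const c).
  have /matrixP/(_ i j) := sC; rewrite mxE => /(congr1 val) /=.
  rewrite (PV_shiftE char_k N_gt0 rhoP) => /Seq_shift_fix[c cE].
  by exists c; apply: val_inj; rewrite PV_val_cst.
have [C CE] : {C : 'I_d * 'I_d -> k & forall ij, C' ij.1 ij.2 = base (ks_const (C ij))}.
  apply: (choice (P := fun (ij : 'I_d * 'I_d) c =>
    C' ij.1 ij.2 = base (ks_const c))) => -[i j].
  exact: Ccst.
exists (\matrix_(i, j) C (i, j)); rewrite tY; congr (_ *m _).
by apply/matrixP => i j; rewrite (CE (i, j)) mxE [in RHS]mxE.
Qed.

(** By induction on [p]. The element [x] is built along with [p], because the
subexpressions of [p] have to be realized in the ring before the automorphism
can be applied to them. *)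
Lemma PV_group_poly tau C (p : 'M[k]_d -> k) : PV_group rho tau ->
    map_mx tau Y = Y *m cst_mx C -> polyfun p ->
  exists x : PV, val x = germ (fun M => p (rho (Phi M))) /\
    val (tau x) = germ (fun M => p (rho (Phi M) *m C)).
Proof.
move=> [tB tM _ tS tbase] tY.
pose tauM : {rmorphism PV -> PV} := HB.pack tau
  (GRing.isZmodMorphism.Build _ _ _ tB) (GRing.isMonoidMorphism.Build _ _ _ tM).
have tYE i j : val (tauM (Y i j)) = germ (fun M => (rho (Phi M) *m C) i j).
  have /matrixP/(_ i j) := tY; rewrite mxE => /= ->.
  rewrite mxE PV_val_sum.
  transitivity (\sum_l germ (fun M => rho (Phi M) i l * C l j)).
    by apply: eq_bigr => l _; rewrite PV_valM PV_val_solE mxE PV_val_cst germM.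
  by rewrite germ_sum; apply/germP; exists 0%N => M _; rewrite mxE.
elim=> [c|l|f g _ [x [xE txE]] _ [y [yE tyE]]|f g _ [x [xE txE]] _ [y [yE tyE]]].
- by exists (base (ks_const c)); rewrite tbase PV_val_cst.
- exists (\sum_i \sum_j Y i j * base (ks_const (l (delta_mx i j)))).
  have lE (u : nat -> 'M[k]_d) : @germ k (fun M => l (u M)) =
      \sum_i \sum_j germ (fun M => u M i j * l (delta_mx i j)).
    rewrite (eq_bigr _ (fun i _ => germ_sum _ _ _)) germ_sum.
    by apply/germP; exists 0%N => M _; rewrite linear_entries.
  split.
    rewrite lE PV_val_sum; apply: eq_bigr => i _; rewrite PV_val_sum.
    by apply: eq_bigr => j _; rewrite PV_valM PV_val_solE PV_val_cst germM.
  rewrite lE -[tau _]/(tauM _) rmorph_sum PV_val_sum; apply: eq_bigr => i _.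
  rewrite rmorph_sum PV_val_sum; apply: eq_bigr => j _.
  by rewrite rmorphM PV_valM tYE /= tbase PV_val_cst germM.
- exists (x + y); have -> : tau (x + y) = tau x + tau y := rmorphD tauM x y.
  rewrite !PV_valD xE yE txE tyE.
  by rewrite !germD.
- exists (x * y); have -> : tau (x * y) = tau x * tau y by exact: tM.2.
  rewrite !PV_valM xE yE txE tyE.
  by rewrite !germM.
Qed.

(** Membership in [rho(G)] is expressed by the vanishing of the polynomials
[p ij] that compare a matrix [D] with the exponential of its logarithm. Being
polynomial relations of [rho(Phi)], they also hold for its image
[rho(Phi) C], at every large enough integer; one such integer puts [C] in
[rho(G)]. *)
Lemma Theta_surj tau : PV_group rho tau -> exists g, Theta g = tau.
Proof.
move=> tauP; have [C tY] := PV_group_sol tauP.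
have [lg [lgP lgE]] := rho_log char_k N_gt0 rhoP.
pose p (ij : 'I_d * 'I_d) (D : 'M[k]_d) := rho (Exp (lg D)) ij.1 ij.2 - D ij.1 ij.2.
have pP ij : polyfun (p ij).
  apply: polyfunB; last exact: polyfun_entry.
  exact: (lgP _ (rho_poly ij.1 ij.2)).
have p0 ij g : p ij (rho g) = 0.
  by rewrite /p lgE; case: g => x; rewrite subrr.
have [n nP] : {n : 'I_d * 'I_d -> nat & forall ij M, (n ij <= M)%N ->
    p ij (rho (Phi M) *m C) = 0}.
  apply: (choice (P := fun (ij : 'I_d * 'I_d) n => forall M, (n <= M)%N ->
    p ij (rho (Phi M) *m C) = 0)) => ij.
  have [x [xE txE]] := PV_group_poly tauP tY (pP ij).
  have x0 : x = 0.
    apply: val_inj; rewrite xE PV_val0 -germ0; apply/germP; exists 0%N => M _.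
    exact: p0.
  move: txE; rewrite x0; have -> : tau 0 = 0.
    by case: tauP => tB _ _ _ _; have := tB 0 0; rewrite subr0 subrr.
  rewrite PV_val0 -germ0 => /germP[n0 n0P]; exists n0 => M /n0P <- //.
pose M := (\sum_ij n ij)%N; pose D := rho (Phi M) *m C.
have DE : rho (Exp (lg D)) = D.
  apply/matrixP => i j; apply: subr0_eq; apply: (nP (i, j)).
  by rewrite /M (bigD1 (i, j)) //= leq_addr.
pose g := GN_mul (GN_inv (Phi M)) (Exp (lg D)).
have gE : rho g = C.
  by rewrite /g rhoM DE /D mulmxA -rhoM (GN_mulVr N_gt0) rho1 mul1mx.
exists g; have [tB tM _ _ tbase] := tauP.
apply: PV_morphism_eq => //.
- exact: Theta_zmod.
- exact: Theta_monoid.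
- by move=> a; rewrite tbase; exact: Theta_base.
move=> i j; have /matrixP/(_ i j) := Theta_sol char_k N_gt0 rhoP g.
rewrite -/(cst_mx (rho g)) gE -tY !mxE; exact.
Qed.

Lemma Theta_iso : group_iso_onto (@GN_mul k N) (fun t t' : PV -> PV => t \o t')
  (PV_group rho) Theta.
Proof.
split; last by move=> g h; apply/funext => x; exact: Theta_mul.
split=> [g _|g h _ _|tau /Theta_surj[g <-]].
- exact: Theta_aut.
- exact: Theta_inj.
- by exists g.
Qed.

Lemma PV_group_mxE : PV_group_mx rho = range rho.
Proof.
apply/seteqP; split=> [C [tau /Theta_surj[g <-] tY]|_ [g _ <-]].
  exists g => //; apply: cst_mx_inj; apply: sol_mul_inj.
  by rewrite -[RHS]tY -(Theta_sol char_k N_gt0 rhoP).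
by exists (Theta g); [exact: Theta_aut|exact: Theta_sol].
Qed.

(** The image of [rho] is defined by the equations saying that a
matrix is the image of its logarithm. *)
Lemma rho_closed_embedding : closed_embedding_onto rho (PV_group_mx rho).
Proof.
have [lg [lgP lgE]] := rho_log char_k N_gt0 rhoP.
rewrite PV_group_mxE; split=> //.
- pose p (i j : 'I_d) (D : 'M[k]_d) := rho (Exp (lg D)) i j - D i j.
  exists [set f | exists i j, f = p i j].
    move=> _ [i [j ->]]; apply: polyfunB; last exact: polyfun_entry.
    exact: (lgP _ (rho_poly i j)).
  apply/seteqP; split=> [_ [g _ <-]|C [_ pC]].
    split; last by move=> _ [i [j ->]]; rewrite /p lgE; case: g => x; rewrite subrr.
    by case: (mulmx1_unit (_ : rho g *m rho (GN_inv g) = 1%:M)) => //;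
       rewrite -rhoM (GN_mulV N_gt0).
  exists (Exp (lg C)) => //; apply/matrixP => i j; apply: subr0_eq.
  by apply: (pC (p i j)); exists i, j.
- split=> [g _|g h _ _|_ [g _ <-]]; [by exists g|exact: rho_inj|by exists g].
exists lg => // l; exists (l \o lg), 0%N; split.
  by apply: lgP; exact: polyfun_lin.
by move=> C _; rewrite expr0 divr1.
Qed.
End GaloisGroup.

(** * Restriction to smaller weight *)

Section Restriction.
Variables (k : closedFieldType) (char_k : [pchar k] =i pred0).

Lemma GN_proj_mul N (g h : GN k N.+1) :
  GN_proj (GN_mul g h) = GN_mul (GN_proj g) (GN_proj h).
Proof.
by rewrite /GN_proj /GN_mul /= (lie_morph_bch (free_le_proj_morphism k N)) free_le_bchS.
Qed.

Lemma GN_proj_one N : GN_proj (GN_one k N.+1) = GN_one k N.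
Proof. by rewrite /GN_proj /= (lie_morph0 (free_le_proj_morphism k N)). Qed.

Lemma GN_proj_xN N t : GN_proj (xN N.+1 t : GN k N.+1) = xN N t.
Proof.
congr Exp; rewrite /= (lie_morph_sum (free_le_proj_morphism k N)) big_ord_recr /=.
rewrite [X in _ + X](_ : _ = 0) ?addr0.
  apply: eq_bigr => m _.
  by rewrite (lie_morphZ (free_le_proj_morphism k N)) free_le_projE.
rewrite (lie_morphZ (free_le_proj_morphism k N)) free_le_projE.
suff -> : free_le_pi N (free_gen k N) = 0 by rewrite scaler0.
rewrite -(lie_morph0 (free_le_pi_morphism k N)); apply/lie_piP; rewrite subr0.
by apply: (@weight_gt_mono _ _ N.+1) => //; exact: mon_gen.
Qed.

Lemma GN_proj_PhiN N M : GN_proj (PhiN k N.+1 M) = PhiN k N M.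
Proof.
elim: M => [|M IH]; first exact: GN_proj_one.
rewrite -[PhiN k N.+1 M.+1]/(GN_mul (xN N.+1 M.+1%:R^-1) (PhiN k N.+1 M)).
by rewrite GN_proj_mul GN_proj_xN IH.
Qed.

Lemma Phi_germ_proj N (g : GN k N.+1) (f : free_le k N -> k) :
  Phi_germ (GN_proj g) f = Phi_germ g (fun x => f (free_le_proj x)).
Proof.
apply/germP; exists 0%N => M _.
rewrite -(GN_proj_PhiN N M) -(GN_proj_mul (PhiN k N.+1 M) g).
by case: (GN_mul _ _).
Qed.

Lemma regular_proj N (Psi : GN k N -> Seq k) :
  regular char_k Psi -> regular char_k (fun g : GN k N.+1 => Psi (GN_proj g)).
Proof.
move=> [n [a [F [FP E]]]].
exists n, a, (fun i (x : free_le k N.+1) => F i (free_le_proj x)); split=> [i|g].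
  apply: (polyfun_comp_linear (phi := @free_le_proj k N)) (FP i).
  by case: (free_le_proj_morphism k N).
by rewrite E; apply: eq_bigr => i _; rewrite Phi_germ_proj.
Qed.

Variables (N d d' : nat) (N_gt0 : (0 < N)%N).
Variables (rho : GN k N -> 'M[k]_d) (rhoP : faithful_rep rho).
Variables (rho' : GN k N.+1 -> 'M[k]_d') (rho'P : faithful_rep rho').

Lemma PV_ring_sub (x : PV_ring rho) : exists x' : PV_ring rho', val x' = val x.
Proof.
have [Psi [PsiP Psi1]] := PV_regular char_k rhoP x.
exists (PV_of_regular (ltn0Sn N) rho'P (regular_proj PsiP) (GN_one k N.+1)).
by rewrite /= GN_proj_one.
Qed.

Lemma Theta_restricts (g : GN k N.+1) :
  restricts_to (Theta char_k rho'P g) (Theta char_k rhoP (GN_proj g)).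
Proof.
move=> x x' xx'; have [Psi [PsiP Psi1]] := PV_regular char_k rhoP x.
rewrite (ThetaE N_gt0 rhoP _ PsiP Psi1).
by rewrite (ThetaE (ltn0Sn N) rho'P g (regular_proj PsiP)) // GN_proj_one Psi1.
Qed.

(** The smaller ring is contained in the larger one, so a map on the
larger ring determines its restriction. *)
Lemma restricts_to_uniq (tau' : PV_ring rho' -> PV_ring rho') tau1 tau2 :
  restricts_to tau' tau1 -> restricts_to tau' tau2 -> tau1 = tau2 :> (PV_ring rho -> PV_ring rho).
Proof.
move=> r1 r2; apply/funext => x; apply: val_inj.
by have [x' xx'] := PV_ring_sub x; rewrite (r1 x x') ?(r2 x x').
Qed.
End Restriction.

(** * Inverse limits *)

Section Limits.
Variable k : fieldType.

Lemma lim_GN_ext (g h : lim_GN k) : (forall n, g n = h n) -> g = h.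
Proof.
case: g h => [g cg] [h ch] /= gh.
have {}gh : g = h by exact: functional_extensionality_dep.
by case: h / gh ch => ch; congr LimGN; exact: Prop_irrelevance.
Qed.

Lemma exp_hat_trunc_iso :
  group_iso_onto (@exp_hat_mul k) (@lim_mul k) [set: lim_GN k] (@exp_hat_trunc k).
Proof.
split; last first.
  move=> x y; apply: lim_GN_ext => n; congr Exp.
  exact: (lie_morph_bch (hat_fun_morphism k n.+1)).
split=> // [[x] [y] _ _ xy|g _].
  congr Exp; apply: free_hatP.
  have S n : x n.+1 = y n.+1 by have := congr1 (fun g : lim_GN k => Log (g n)) xy.
  by case=> [|n]; [rewrite -(hat_compat x 0) -(hat_compat y 0) S|exact: S].
pose x N : free_le k N :=
  if N is n.+1 then Log (g n) else free_le_proj (Log (g 0%N)).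
have xC N : free_le_proj (x N.+1) = x N.
  case: N => [|n]; first by [].
  exact: (congr1 (@Log _) (lim_compat g n)).
exists (Exp (FreeHat xC)) => //; apply: lim_GN_ext => n /=.
by case: (g n).
Qed.

Lemma group_iso_onto_comp (T U W : Type) (mulT : T -> T -> T) (mulU : U -> U -> U)
    (mulW : W -> W -> W) (H : set W) (f : T -> U) (h : U -> W) :
    group_iso_onto mulT mulU [set: U] f -> group_iso_onto mulU mulW H h ->
  group_iso_onto mulT mulW H (h \o f).
Proof.
move=> [fbij fM] [hbij hM]; split; last by move=> x y /=; rewrite fM hM.
exact: set_bij_comp fbij hbij.
Qed.
End Limits.

(** A compatible family of automorphisms comes from elements of the
groups one level at a time; these are compatible because restrictions are
unique and [Theta] is injective. *)
Lemma pro_PV_group_iso (k : closedFieldType) (char_k : [pchar k] =i pred0)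
    (d : nat -> nat) (rho : forall n : nat, GN k n.+1 -> 'M[k]_(d n))
    (rhoP : forall n : nat, faithful_rep (rho n)) :
  group_iso_onto (@lim_mul k) (pro_comp rho)
  (pro_PV_group rho) (fun g n => Theta char_k (rhoP n) (g n)).
Proof.
have ThP n := Theta_iso char_k (ltn0Sn n) (rhoP n).
split; last first.
  by move=> g h; apply: functional_extensionality_dep => n; case: (ThP n) => _ ->.
split=> [g _|g h _ _ gh|tau [tauP taur]].
- split=> n; first exact: Theta_aut.
  by rewrite -(lim_compat g n); exact: Theta_restricts.
- apply: lim_GN_ext => n; apply: (Theta_inj (char_k := char_k) (ltn0Sn n) (rhoP := rhoP n)).
  exact: (congr1 (fun f : pro_fun rho => f n) gh).
have [g gE] : {g : forall n, GN k n.+1 & forall n, Theta char_k (rhoP n) (g n) = tau n}.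
  pose gs n := cid (Theta_surj char_k (ltn0Sn n) (rhoP n) (tauP n)).
  by exists (fun n => projT1 (gs n)) => n; exact: (projT2 (gs n)).
have gC n : GN_proj (g n.+1) = g n.
  apply: (Theta_inj (char_k := char_k) (ltn0Sn n) (rhoP := rhoP n)).
  have r1 : restricts_to (Theta char_k (rhoP n.+1) (g n.+1)) (tau n).
    by rewrite gE; exact: taur.
  have r2 := Theta_restricts char_k (ltn0Sn n) (rhoP n) (rhoP n.+1) (g n.+1).
  by rewrite gE (restricts_to_uniq char_k (rhoP n) (rhoP n.+1) r1 r2).
exists (LimGN gC) => //.
by apply: functional_extensionality_dep => n /=; exact: gE.
Qed.

(* The index n stands for N = n + 1; rho n is the representation rho_N. *)
Theorem corollary2 (k : closedFieldType) (char_k : [pchar k] =i pred0)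
    (d : nat -> nat) (rho : forall n : nat, GN k n.+1 -> 'M[k]_(d n))
    (rhoP : forall n : nat, faithful_rep (rho n)) :
  [/\ (* R_N is a Picard-Vessiot ring of the N-th system *)
      forall n : nat,
        shift_stable (rho n) /\
        picard_vessiot (@ks_shift k) (PV_shift (rho n)) (PV_base (rho n))
          (system_mx (rho n)) (PV_sol (rho n)),
      (* restriction of automorphisms gives the transition maps *)
      forall n : nat,
        (forall x : PV_ring (rho n),
           exists x' : PV_ring (rho n.+1), val x' = val x) /\
        (forall tau', PV_group (rho n.+1) tau' ->
           exists2 tau, PV_group (rho n) tau & restricts_to tau' tau),
      (* the inverse limit of the G_N is exp of the completed Lie algebra *)
      group_iso_onto (@exp_hat_mul k) (@lim_mul k) [set: lim_GN k]
        (@exp_hat_trunc k)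
    & (* the pro-Picard-Vessiot group is the inverse limit of the G_N, the
         isomorphism being the limit of isomorphisms of algebraic groups *)
      exists Theta : forall n : nat,
          GN k n.+1 -> PV_ring (rho n) -> PV_ring (rho n),
        [/\ forall n : nat,
              [/\ group_iso_onto (@GN_mul k n.+1) (fun t t' : PV_ring (rho n) -> PV_ring (rho n) => t \o t')
                    (PV_group (rho n)) (Theta n),
                  forall g, map_mx (Theta n g) (PV_sol (rho n)) =
                    PV_sol (rho n) *m
                    map_mx (fun c => PV_base (rho n) (ks_const c)) (rho n g)
                & closed_embedding_onto (rho n) (PV_group_mx (rho n))],
            forall (n : nat) (g : GN k n.+2),
              restricts_to (Theta n.+1 g) (Theta n (GN_proj g)),
            group_iso_onto (@lim_mul k) (pro_comp rho)
              (pro_PV_group rho) (fun g n => Theta n (g n))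
          & group_iso_onto (@exp_hat_mul k) (pro_comp rho)
              (pro_PV_group rho)
              (fun g n => Theta n (exp_hat_trunc g n))]].
Proof.
split=> [n|n||].
- split; first exact: (PV_shiftE char_k (ltn0Sn n) (rhoP n)).
  exact: (PV_ring_picard_vessiot char_k (ltn0Sn n) (rhoP n)).
- split=> [x|tau' /(Theta_surj char_k (ltn0Sn n.+1) (rhoP n.+1))[g <-]].
    exact: (PV_ring_sub char_k (rhoP n) (rhoP n.+1)).
  exists (Theta char_k (rhoP n) (GN_proj g)); first exact: Theta_aut.
  exact: Theta_restricts.
- exact: exp_hat_trunc_iso.
exists (fun n => Theta char_k (rhoP n)); split=> [n|n g||].
- split=> [|g|]; first exact: Theta_iso.
  + exact: Theta_sol.
  + exact: rho_closed_embedding.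
- exact: Theta_restricts.
- exact: pro_PV_group_iso.
exact: (group_iso_onto_comp (exp_hat_trunc_iso k) (pro_PV_group_iso char_k rhoP)).
Qed.
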